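(* Let $n=p+q$. The $\mathfrak{so}(p,q)$-module $\mathcal{R}^\nabla(\mathfrak{so}(p,q))$ admits the following decomposition into the sum of irreducible $\mathfrak{so}(p,q)$-modules: $$\mathcal{R}^\nabla(\mathfrak{so}(p,q))\simeq V_{6\pi_1}\oplus V_{4\pi_1}\oplus\mathbb{R}^{p,q}\quad\text{if } n=3,$$ $$\mathcal{R}^\nabla(\mathfrak{so}(p,q))\simeq (V_{5\pi_1+\pi'_1}\oplus V_{\pi_1+5\pi'_1})\oplus V_{3\pi_1+3\pi'_1}\oplus(V_{3\pi_1+\pi'_1}\oplus V_{\pi_1+3\pi'_1})\oplus\mathbb{R}^{p,q}\quad\text{if }(p,q)\in\{(4,0),(2,2),(0,4)\},$$ $$\mathcal{R}^\nabla(\mathfrak{so}(p,q))\simeq V_{\pi_1+2\bar\pi_2}\oplus V_{3\pi_1}\oplus V_{\pi_1+\bar\pi_2}\oplus\mathbb{R}^{p,q}\quad\text{if } n\ge 5,$$ where $\bar\pi_2=2\pi_2$ if $n=5$ and $\bar\pi_2=\pi_2$ if $n\ge 6$.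
   Context: $\mathbb{R}^{p,q}$ is $\mathbb{R}^n$, $n=p+q$, with a pseudo-Euclidean metric $g$ of signature $(p,q)$, and $\mathfrak{so}(p,q)=\mathfrak{so}(\mathbb{R}^{p,q},g)$, which acts on $\mathbb{R}^{p,q}$ by the standard representation. For a subalgebra $\mathfrak{h}\subset\mathfrak{so}(p,q)$, the space of algebraic curvature tensors is $$\mathcal{R}(\mathfrak{h})=\{R\in\mathrm{Hom}(\Lambda^2\mathbb{R}^{p,q},\mathfrak{h})\mid R(X,Y)Z+R(Y,Z)X+R(Z,X)Y=0\ \text{for all } X,Y,Z\in\mathbb{R}^{p,q}\},$$ and $$\mathcal{R}^\nabla(\mathfrak{h})=\{S\in\mathrm{Hom}(\mathbb{R}^{p,q},\mathcal{R}(\mathfrak{h}))\mid S_X(Y,Z)+S_Y(Z,X)+S_Z(X,Y)=0\ \text{for all } X,Y,Z\in\mathbb{R}^{p,q}\}.$$ Both are $\mathfrak{h}$-modules in the natural way. $V_\Lambda$ denotes the real irreducible representation of $\mathfrak{so}(p,q)$ defined by the complex irreducible representation of $\mathfrak{so}(n,\mathbb{C})$ with highest weight $\Lambda$. Here $\pi_1,\pi_2,\dots$ denote the fundamental weights of $\mathfrak{so}(n,\mathbb{C})$, with notation for simple Lie algebras as in Vinberg and Onishchik. For $n=3$, $\pi_1$ is the fundamental weight of $\mathfrak{so}(3,\mathbb{C})\simeq\mathfrak{sl}(2,\mathbb{C})$, so that $\dim V_{k\pi_1}=k+1$. For $n=4$, $\pi_1,\pi_1'$ are the fundamental weights of the two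 simple ideals of $\mathfrak{so}(4,\mathbb{C})\simeq\mathfrak{sl}(2,\mathbb{C})\oplus\mathfrak{sl}(2,\mathbb{C})$, so that $\dim V_{k\pi_1+l\pi_1'}=(k+1)(l+1)$.
   Formalization: For n=6 the weight \bar\pi_2 is taken to be \pi_2+\pi_3 (the highest weight of \Lambda^2 C^6) instead of \pi_2, since with \bar\pi_2=\pi_2 the dimensions of the summands cannot add up to dim R^\nabla = 420. *)

(* Defs.v *)
From HB Require Import structures.
From mathcomp Require Import all_boot all_order all_algebra.
From mathcomp Require Import boolp classical_sets reals.
From mathcomp Require Import complex.
From mathcomp Require Import zify.

Set Implicit Arguments.
Unset Strict Implicit.
Unset Printing Implicit Defensive.

Import GRing.Theory Num.Theory.
Local Open Scope ring_scope.

(* The subspace whose set of elements is [P]; see [mem_subspace_of] for the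
   side condition under which it exists (otherwise the value is [0]). *)
Definition subspace_of (F : fieldType) (V : vectType F) (P : set V) :
    {vspace V} :=
  xget 0%VS [set U : {vspace V} | forall v, v \in U <-> P v].

Lemma mem_subspace_of (F : fieldType) (V : vectType F) (P : set V) :
  P 0 -> (forall a u v, P u -> P v -> P (a *: u + v)) ->
  forall v, v \in subspace_of P <-> P v.
Proof.
move=> P0 Plin; rewrite /subspace_of; case: xgetP => [U _ //|noU].
suff [U HU] : exists U : {vspace V}, forall v, v \in U <-> P v by case: (noU U).
suff key : forall k (U : {vspace V}), (dim V - \dim U <= k)%N ->
    (forall v, v \in U -> P v) -> exists U : {vspace V}, forall v, v \in U <-> P v.
  by apply: (key _ 0%VS (leqnn _)) => v; rewrite memv0 => /eqP ->.
elim=> [|k IHk] U dU UP.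
  exists U => v; split; first exact: UP.
  suff -> : U = fullv by rewrite memvf.
  apply/eqP; rewrite eqEdim subvf /= dimvf.
  by move: dU; rewrite leqn0 subn_eq0.
have [PU|/existsNP [v /not_implyP [Pv vU]]] := pselect (forall v, P v -> v \in U).
  by exists U => v; split; [exact: UP|exact: PU].
apply: (IHk (<[v]> + U)%VS); last first.
  by move=> w /memv_addP [_ /vlineP [a ->] [u /UP Pu ->]]; exact: Plin.
have ltUv : (\dim U < \dim (<[v]> + U))%N.
  rewrite ltnNge; apply/negP => le.
  have /eqP UE : U == (<[v]> + U)%VS by rewrite eqEdim addvSr.
  by apply: vU; rewrite UE (subvP (addvSl _ _)) // memv_line.
have := dimvS (subvf (<[v]> + U)%VS); rewrite dimvf => le2.
by rewrite -ltnS (leq_trans _ dU) // ltn_sub2l // (leq_trans ltUv).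
Qed.

Fact zmod_bracket_identity (V : zmodType) (x1 x2 x3 x4 y1 y2 : V) :
  x1 - x2 - (x3 - x4) = x1 - y1 - (y2 - x4) - (x2 - y2 - (y1 - x3)).
Proof.
rewrite !opprB !addrA [RHS](AC 8 (1*8*3*6*(2*5)*(4*7)))%AC /=.
by rewrite !addNr !addr0.
Qed.

Fact zmod_cyclic_identity (V : zmodType) (a1 a2 a3 b1 b2 b3 c1 c2 c3 d1 d2 d3 : V) :
  a1 + a2 + a3 = 0 -> b1 + c2 + d3 = 0 -> c1 + d2 + b3 = 0 ->
  d1 + b2 + c3 = 0 ->
  (a1 - b1 - c1 - d1) + (a2 - b2 - c2 - d2) + (a3 - b3 - c3 - d3) = 0.
Proof.
move=> a0 b0 c0 d0; rewrite !addrA.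
rewrite (AC 12 ((1*5*9)*(2*7*12)*(3*8*10)*(4*6*11)))%AC /=.
by rewrite -!opprD a0 b0 c0 d0 !subr0.
Qed.

Fact scaler_sum3 (F : nzRingType) (V : lmodType F) (a : F) (x1 x2 x3 y1 y2 y3 : V) :
  (a *: x1 + y1) + (a *: x2 + y2) + (a *: x3 + y3) =
  a *: (x1 + x2 + x3) + (y1 + y2 + y3).
Proof. by rewrite !scalerDr [RHS]addrACA; congr (_ + _); rewrite addrACA. Qed.

Section Representations.
Variables (F : fieldType) (n : nat).

(* A finite-dimensional representation of a matrix Lie algebra [h]; the
   values of [rep_act] outside [h] are irrelevant. *)
Record lie_rep (h : {vspace 'M[F]_n}) := LieRep {
  rep_sort :> vectType F;
  rep_act : 'M[F]_n -> 'End(rep_sort);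
  rep_act_linear : forall a A B, A \in h -> B \in h ->
    rep_act (a *: A + B) = a *: rep_act A + rep_act B;
  rep_act_bracket : forall A B, A \in h -> B \in h ->
    rep_act (A *m B - B *m A) =
    ((rep_act A \o rep_act B) - (rep_act B \o rep_act A))%VF }.

Variable h : {vspace 'M[F]_n}.
Implicit Types V W : lie_rep h.

Definition rep_stable V (U : {vspace V}) : Prop :=
  forall A, A \in h -> forall u, u \in U -> rep_act V A u \in U.

Definition rep_irreducible V : Prop :=
  (0 < \dim {:V})%N /\
  forall U : {vspace V}, rep_stable U -> U = 0%VS \/ U = fullv.

Definition rep_iso V W : Prop :=
  exists2 f : 'Hom(V, W), bijective f &
    forall A, A \in h -> forall v, f (rep_act V A v) = rep_act W A (f v).

Definition std_act (A : 'M[F]_n) : 'End('cV[F]_n) := linfun (mulmx A).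

Lemma std_act_linear a A B :
  A \in h -> B \in h -> std_act (a *: A + B) = a *: std_act A + std_act B.
Proof.
by move=> _ _; apply/lfunP => v; do !rewrite lfunE /=; rewrite mulmxDl -scalemxAl.
Qed.

Lemma std_act_bracket A B : A \in h -> B \in h ->
  std_act (A *m B - B *m A) = ((std_act A \o std_act B) - (std_act B \o std_act A))%VF.
Proof.
move=> _ _; apply/lfunP => v.
by do !rewrite !(lfunE, lfun_simp) /=; rewrite mulmxBl !mulmxA.
Qed.

Definition rep_std : lie_rep h := LieRep std_act_linear std_act_bracket.

Definition ad_fun (A B : 'M[F]_n) := A *m B - B *m A.

Fact ad_fun_linear A : linear (ad_fun A).
Proof.
move=> a B C; rewrite /ad_fun mulmxDr mulmxDl -scalemxAr -scalemxAl.
by rewrite scalerBr opprD addrACA.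
Qed.
HB.instance Definition _ A :=
  GRing.isLinear.Build F 'M[F]_n 'M[F]_n _ (ad_fun A) (ad_fun_linear A).

Definition ad_act (A : 'M[F]_n) : 'End('M[F]_n) := linfun (ad_fun A).

Lemma ad_act_linear a A B :
  A \in h -> B \in h -> ad_act (a *: A + B) = a *: ad_act A + ad_act B.
Proof.
move=> _ _; apply/lfunP => v; do !rewrite lfunE /=; rewrite /ad_fun.
by rewrite mulmxDl mulmxDr -scalemxAr -scalemxAl scalerBr opprD addrACA.
Qed.

Lemma ad_act_bracket A B : A \in h -> B \in h ->
  ad_act (A *m B - B *m A) = ((ad_act A \o ad_act B) - (ad_act B \o ad_act A))%VF.
Proof.
move=> _ _; apply/lfunP => v; do !rewrite !(lfunE, lfun_simp) /=.
by rewrite /ad_fun !(mulmxBl, mulmxBr) !mulmxA; exact: zmod_bracket_identity.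
Qed.

(* [h] acting on all of [gl(n)] by commutators. *)
Definition rep_gl : lie_rep h := LieRep ad_act_linear ad_act_bracket.

Definition hom_fun V W (A : 'M[F]_n) (f : 'Hom(V, W)) : 'Hom(V, W) :=
  ((rep_act W A \o f) - (f \o rep_act V A))%VF.

Fact hom_fun_linear V W A : linear (@hom_fun V W A).
Proof.
move=> a f g; rewrite /hom_fun comp_lfunDr comp_lfunDl -comp_lfunZr -comp_lfunZl.
by rewrite scalerBr opprD addrACA.
Qed.
HB.instance Definition _ V W A :=
  GRing.isLinear.Build F 'Hom(V, W) 'Hom(V, W) _ (@hom_fun V W A)
    (@hom_fun_linear V W A).

Definition hom_act V W (A : 'M[F]_n) : 'End('Hom(V, W)) :=
  linfun (@hom_fun V W A).

Lemma hom_act_linear V W a A B : A \in h -> B \in h ->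
  hom_act V W (a *: A + B) = a *: hom_act V W A + hom_act V W B.
Proof.
move=> hA hB; apply/lfunP => f; do !rewrite lfunE /=; rewrite /hom_fun.
rewrite !rep_act_linear // comp_lfunDl comp_lfunDr -comp_lfunZl -comp_lfunZr.
by rewrite scalerBr opprD addrACA.
Qed.

Lemma hom_act_bracket V W A B : A \in h -> B \in h ->
  hom_act V W (A *m B - B *m A) =
  ((hom_act V W A \o hom_act V W B) - (hom_act V W B \o hom_act V W A))%VF.
Proof.
move=> hA hB; apply/lfunP => f; do !rewrite !(lfunE, lfun_simp) /=; rewrite /hom_fun.
rewrite !rep_act_bracket // !(comp_lfunDl, comp_lfunNl, comp_lfunDr, comp_lfunNr).
by rewrite !comp_lfunA; exact: zmod_bracket_identity.
Qed.

Definition rep_hom V W : lie_rep h :=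
  LieRep (@hom_act_linear V W) (@hom_act_bracket V W).

Lemma hom_actE V W A (f : rep_hom V W) v :
  (rep_act (rep_hom V W) A f : 'Hom(V, W)) v =
  rep_act W A ((f : 'Hom(V, W)) v) - (f : 'Hom(V, W)) (rep_act V A v).
Proof. by do !rewrite !(lfunE, lfun_simp) /=. Qed.

Definition prod_fun V W (A : 'M[F]_n) (x : V * W) : V * W :=
  (rep_act V A x.1, rep_act W A x.2).

Fact prod_fun_linear V W A : linear (@prod_fun V W A).
Proof. by move=> a [u1 u2] [v1 v2]; rewrite /prod_fun /= !linearP. Qed.
HB.instance Definition _ V W A :=
  GRing.isLinear.Build F (V * W)%type (V * W)%type _ (@prod_fun V W A)
    (@prod_fun_linear V W A).

Definition prod_act V W (A : 'M[F]_n) : 'End((V * W)%type) :=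
  linfun (@prod_fun V W A).

Lemma prod_act_linear V W a A B : A \in h -> B \in h ->
  prod_act V W (a *: A + B) = a *: prod_act V W A + prod_act V W B.
Proof.
move=> hA hB; apply/lfunP => -[u v]; rewrite !(lfunE, lfun_simp) /= !lfunE /=.
by rewrite /prod_fun !rep_act_linear //= !(lfunE, lfun_simp) /= !lfunE.
Qed.

Lemma prod_act_bracket V W A B : A \in h -> B \in h ->
  prod_act V W (A *m B - B *m A) =
  ((prod_act V W A \o prod_act V W B) - (prod_act V W B \o prod_act V W A))%VF.
Proof.
move=> hA hB; apply/lfunP => -[u v]; rewrite !(lfunE, lfun_simp) /= !lfunE /=.
by rewrite /prod_fun !rep_act_bracket //=; do !rewrite !(lfunE, lfun_simp) /=.
Qed.

Definition rep_sum V W : lie_rep h :=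
  LieRep (@prod_act_linear V W) (@prod_act_bracket V W).

Definition sub_act V (U : {vspace V}) (A : 'M[F]_n) : 'End(subvs_of U) :=
  linfun (vsproj U \o rep_act V A \o vsval).

Lemma sub_actE V (U : {vspace V}) : rep_stable U ->
  forall A, A \in h -> forall u, vsval (sub_act U A u) = rep_act V A (vsval u).
Proof.
by move=> stU A hA u; rewrite lfunE /= vsprojK //; apply: stU => //; exact: subvsP.
Qed.

Section SubRep.
Variables (V : lie_rep h) (U : {vspace V}) (stU : rep_stable U).
Hypothesis hLie : forall A B, A \in h -> B \in h -> A *m B - B *m A \in h.

Lemma sub_act_linear a A B : A \in h -> B \in h ->
  sub_act U (a *: A + B) = a *: sub_act U A + sub_act U B.
Proof.
move=> hA hB; apply/lfunP => u; apply: val_inj; rewrite /= sub_actE ?rpredD ?rpredZ //.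
by rewrite rep_act_linear // !add_lfunE !scale_lfunE [RHS]linearP /= !sub_actE.
Qed.

Lemma sub_act_bracket A B : A \in h -> B \in h ->
  sub_act U (A *m B - B *m A) = ((sub_act U A \o sub_act U B) - (sub_act U B \o sub_act U A))%VF.
Proof.
move=> hA hB; apply/lfunP => u; apply: val_inj; rewrite /= sub_actE ?hLie //.
rewrite rep_act_bracket // !add_lfunE !opp_lfunE !comp_lfunE.
by rewrite [RHS]linearB /= !sub_actE.
Qed.

Definition rep_sub : lie_rep h := LieRep sub_act_linear sub_act_bracket.
End SubRep.

End Representations.

Section Curvature.
Variables (F : fieldType) (n : nat).
Local Notation V := 'cV[F]_n.

(* An element of [Hom(Lambda^2 V, gl(V))] is an alternating bilinear map. *)
Local Notation curvT := 'Hom(V, 'Hom(V, 'M[F]_n)).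

Definition is_curvature (h : {vspace 'M[F]_n}) : set curvT :=
  [set T : curvT |
    [/\ forall X Y, T X Y \in h,
        forall X, T X X = 0 &
        forall X Y Z, T X Y *m Z + T Y Z *m X + T Z X *m Y = 0]].

Definition curvature_space (h : {vspace 'M[F]_n}) : {vspace curvT} :=
  subspace_of (is_curvature h).

Definition is_nabla_curvature (h : {vspace 'M[F]_n}) : set 'Hom(V, curvT) :=
  [set S : 'Hom(V, curvT) |
    (forall X, S X \in curvature_space h) /\
    (forall X Y Z, S X Y Z + S Y Z X + S Z X Y = 0)].

Definition nabla_curvature_space (h : {vspace 'M[F]_n}) :
    {vspace 'Hom(V, curvT)} :=
  subspace_of (is_nabla_curvature h).

Lemma mem_curvature_space h T : T \in curvature_space h <-> is_curvature h T.
Proof.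
apply: mem_subspace_of.
  by split=> [X Y|X|X Y Z]; rewrite !lfunE /= ?lfunE ?rpred0 // !mul0mx !addr0.
move=> a T1 T2 [T1h T1a T1b] [T2h T2a T2b]; split=> [X Y|X|X Y Z].
- by do !rewrite !lfunE /=; rewrite rpredD ?rpredZ.
- by do !rewrite !lfunE /=; rewrite T1a T2a scaler0 addr0.
- do !rewrite !lfunE /=; rewrite !mulmxDl -!scalemxAl.
  by rewrite scaler_sum3 T1b T2b scaler0 addr0.
Qed.

Lemma mem_nabla_curvature_space h S :
  S \in nabla_curvature_space h <-> is_nabla_curvature h S.
Proof.
apply: mem_subspace_of.
  by split=> [X|X Y Z]; rewrite !zero_lfunE ?rpred0 // !addr0.
move=> a S1 S2 [S1h S1b] [S2h S2b]; split=> [X|X Y Z].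
  by do !rewrite !lfunE /=; rewrite rpredD ?rpredZ.
do !rewrite !lfunE /=.
by rewrite scaler_sum3 S1b S2b scaler0 addr0.
Qed.

(* [h] acts on [Hom(V, Hom(V, Hom(V, gl(V))))], hence on the subspace
   [nabla_curvature_space h] when [h] is a Lie algebra. *)
Definition rep_hom3 (h : {vspace 'M[F]_n}) : lie_rep h :=
  rep_hom (rep_std h) (rep_hom (rep_std h) (rep_hom (rep_std h) (rep_gl h))).

Definition lie_closed (h : {vspace 'M[F]_n}) :=
  forall A B, A \in h -> B \in h -> A *m B - B *m A \in h.

Lemma curvature_actE h A (T : curvT) X Y :
  (rep_act (rep_hom (rep_std h) (rep_hom (rep_std h) (rep_gl h))) A T : curvT) X Y
    = ad_fun A (T X Y) - T X (A *m Y) - T (A *m X) Y.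
Proof.
have E1 : (rep_act (rep_hom (rep_std h) (rep_hom (rep_std h) (rep_gl h))) A T : curvT) X
   = (rep_act (rep_hom (rep_std h) (rep_gl h)) A (T X) : 'Hom(V, 'M[F]_n)) - T (std_act A X).
  exact: (hom_actE (V := rep_std h) (W := rep_hom (rep_std h) (rep_gl h)) A T X).
have E2 : (rep_act (rep_hom (rep_std h) (rep_gl h)) A (T X) : 'Hom(V, 'M[F]_n)) Y
   = ad_act A (T X Y) - T X (std_act A Y).
  exact: (hom_actE (V := rep_std h) (W := rep_gl h) A (T X) Y).
apply: (etrans (congr1 (fun f : 'Hom(V, 'M[F]_n) => f Y) E1)).
apply: (etrans (add_lfunE _ _ _)); rewrite [X in _ + X]opp_lfunE.
by rewrite [X in X - _]E2 !lfunE.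
Qed.

Lemma curvature_space_stable h : lie_closed h ->
  forall A, A \in h -> forall T, T \in curvature_space h ->
  rep_act (rep_hom (rep_std h) (rep_hom (rep_std h) (rep_gl h))) A T
    \in curvature_space h.
Proof.
move=> hL A hA T /mem_curvature_space [Th Ta Tb].
have Tn X Y : T X Y = - T Y X.
  apply/eqP; rewrite -addr_eq0; apply/eqP.
  have := Ta (X + Y); rewrite linearD /= linearD !add_lfunE !Ta.
  by rewrite add0r addr0 addrC.
apply/mem_curvature_space; split=> [X Y|X|X Y Z]; rewrite !curvature_actE.
- by rewrite rpredB // rpredB //; exact: (hL _ _ hA (Th X Y)).
- by rewrite Ta /ad_fun mulmx0 mul0mx subr0 sub0r (Tn (A *m X)) subrr.
- rewrite /ad_fun !mulmxBl; apply: zmod_cyclic_identity.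
  + by rewrite -!mulmxA -!mulmxDr Tb mulmx0.
  + by rewrite -[T X Y *m A *m Z]mulmxA.
  + by rewrite -[T Z X *m A *m Y]mulmxA.
  + by rewrite -[T Y Z *m A *m X]mulmxA.
Qed.

Lemma nabla_curvature_space_stable h : lie_closed h ->
  rep_stable (V := rep_hom3 h) (nabla_curvature_space h).
Proof.
move=> hL A hA S /mem_nabla_curvature_space [Sh Sb].
have E0 X : (rep_act (rep_hom3 h) A S : 'Hom(V, curvT)) X =
    rep_act (rep_hom (rep_std h) (rep_hom (rep_std h) (rep_gl h))) A (S X)
    - S (A *m X).
  by rewrite -[A *m X]lfunE; exact: (hom_actE (V := rep_std h)
    (W := rep_hom (rep_std h) (rep_hom (rep_std h) (rep_gl h))) A S X).
have E X Y Z : (rep_act (rep_hom3 h) A S : 'Hom(V, curvT)) X Y Z =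
    ad_fun A (S X Y Z) - S X Y (A *m Z) - S X (A *m Y) Z - S (A *m X) Y Z.
  by rewrite E0 !(add_lfunE, opp_lfunE) curvature_actE.
apply/mem_nabla_curvature_space; split=> [X|X Y Z].
  by rewrite E0 rpredB //; apply: curvature_space_stable.
rewrite !E; apply: zmod_cyclic_identity => //.
by rewrite -!linearD /= Sb linear0.
Qed.

Definition rep_nabla_curvature (h : {vspace 'M[F]_n}) (hL : lie_closed h) :
    lie_rep h :=
  rep_sub (nabla_curvature_space_stable hL) hL.

Definition is_skew (g : 'M[F]_n) : set 'M[F]_n :=
  [set A : 'M[F]_n | A^T *m g + g *m A = 0].

Definition so (g : 'M[F]_n) : {vspace 'M[F]_n} := subspace_of (is_skew g).

Lemma mem_so g A : A \in so g <-> A^T *m g + g *m A = 0.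
Proof.
apply: (mem_subspace_of (P := is_skew g)) => [|a B C]; rewrite /is_skew /=.
  by rewrite trmx0 mul0mx mulmx0 addr0.
move=> Bg Cg; rewrite linearP /= mulmxDl mulmxDr -scalemxAl -scalemxAr.
by rewrite addrACA -scalerDr Bg Cg scaler0 addr0.
Qed.

Lemma so_lie_closed g : lie_closed (so g).
Proof.
move=> A B /mem_so Ag /mem_so Bg; apply/mem_so.
have {Ag} gA : A^T *m g = - (g *m A) by apply/eqP; rewrite -addr_eq0 Ag.
have {Bg} gB : B^T *m g = - (g *m B) by apply/eqP; rewrite -addr_eq0 Bg.
rewrite linearB /= !trmx_mul mulmxBl mulmxBr -!mulmxA gA gB !mulmxN !mulmxA.
by rewrite gA gB !mulNmx !opprK addrC addrA subrK subrr.
Qed.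

End Curvature.

Section HighestWeight.
Variables (C : fieldType) (n : nat).

(* The columns [b_0, .., b_(n-1)] of [P] satisfy [g(b_i, b_j) = 1] if
   [i + j = n - 1] and [0] otherwise.  The elements of [so g] that are diagonal
   in this basis, [diag(a_0, .., a_(m-1), .., -a_(m-1), .., -a_0)] with
   [m = n./2], form a Cartan subalgebra with coordinates [eps_k = a_(k-1)], and
   the strictly upper triangular ones are the sum of the root spaces of the
   positive roots [eps_i - eps_j], [eps_i + eps_j] ([i < j]) and, for odd [n],
   [eps_i]. *)
Definition is_witt_basis (g P : 'M[C]_n) : Prop :=
  P^T *m g *m P = \matrix_(i, j) ((i + j).+1 == n)%N%:R.

Fact half_le : (n./2 <= n)%N.
Proof. by rewrite leq_half_double -addnn -addnS leq_addr. Qed.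

Definition half_ord (k : 'I_n./2) : 'I_n := widen_ord half_le k.

Definition is_highest_weight (g P : 'M[C]_n) (W : lie_rep (so g))
    (Lambda : 'rV[rat]_(n./2)) : Prop :=
  exists2 v : W, v != 0 &
    (forall A, A \in so g ->
       (forall i j : 'I_n, (j <= i)%N -> (invmx P *m A *m P) i j = 0) ->
       rep_act W A v = 0) /\
    (forall A, A \in so g -> is_diag_mx (invmx P *m A *m P) ->
       rep_act W A v =
       (\sum_k ratr (Lambda 0 k) *
          (invmx P *m A *m P) (half_ord k) (half_ord k)) *: v).

End HighestWeight.

(* Coordinates of the [k]-th fundamental weight of so(n, C) ([1 <= k <= n./2])
   with respect to [eps_1, .., eps_(n./2)]. *)
Definition fund_weight (n k : nat) : 'rV[rat]_(n./2) :=
  let m := n./2 in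
  \row_(i < m)
    if odd n then
      if (k < m)%N then (i < k)%N%:R else 2^-1
    else
      if (k.+1 < m)%N then (i < k)%N%:R
      else if (k < m)%N then (if (i.+1 < m)%N then 2^-1 else - 2^-1)
      else 2^-1.

(* The highest weight of the representation of so(n, C) on Lambda^2 C^n.  For
   n = 6 the fundamental weights [pi_2], [pi_3] are those of the half-spin
   representations and Lambda^2 C^6 has highest weight [pi_2 + pi_3]. *)
Definition pi2bar (n : nat) : 'rV[rat]_(n./2) :=
  if (n == 5)%N then fund_weight n 2 *+ 2
  else if (n == 6)%N then fund_weight n 2 + fund_weight n 3
  else fund_weight n 2.

Section RealRepresentations.
Variables (R : realType) (n : nat).
Local Open Scope complex_scope.

Definition has_signature (p q : nat) (g : 'M[R]_n) : Prop :=
  (p + q)%N = n /\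
  exists2 Q : 'M[R]_n, Q \in unitmx &
    Q^T *m g *m Q = diag_mx (\row_(i < n) if (i < p)%N then 1 else -1).

Local Notation toC := (map_mx (real_complex R)).

Definition real_intertwiner (g : 'M[R]_n) (V : lie_rep (so g))
    (W : lie_rep (so (toC g))) (f : V -> W) : Prop :=
  (forall (a : R) u v, f (a *: u + v) = a%:C *: f u + f v) /\
  (forall A, A \in so g -> forall v,
     f (rep_act V A v) = rep_act W (toC A) (f v)).

(* [W = f(V) + i f(V)], i.e. [W] is the complexification of [V]. *)
Definition is_real_form (g : 'M[R]_n) (V : lie_rep (so g))
    (W : lie_rep (so (toC g))) : Prop :=
  exists2 f : V -> W, real_intertwiner f &
    bijective (fun x : V * V => f x.1 + 'i *: f x.2).

Definition is_realification (g : 'M[R]_n) (V : lie_rep (so g))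
    (W : lie_rep (so (toC g))) : Prop :=
  exists2 f : V -> W, real_intertwiner f & bijective f.

(* [V] is the real irreducible representation defined by the complex
   irreducible representation [W] with highest weight [Lambda]: a real form of
   [W] if there is one, and otherwise [W] regarded as a real representation
   (which is reducible when [W] has a real form). *)
Definition is_real_irrep (g : 'M[R]_n) (P : 'M[R[i]]_n)
    (Lambda : 'rV[rat]_(n./2)) (V : lie_rep (so g)) : Prop :=
  rep_irreducible V /\
  exists W : lie_rep (so (toC g)),
    [/\ rep_irreducible W, is_highest_weight P W Lambda &
        is_real_form V W \/ is_realification V W].

Lemma witt_basis_exists (p q : nat) (g : 'M[R]_n) :
  has_signature p q g -> exists P : 'M[R[i]]_n, is_witt_basis (toC g) P.
Proof.
move=> [_ [Q _ QgQ]].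
pose D : 'M[R[i]]_n := diag_mx (\row_(i < n) if (i < p)%N then 1 else 'i).
have ii : ('i : R[i]) * 'i = -1 by rewrite -expr2 sqr_i.
have DgD : (toC Q *m D)^T *m toC g *m (toC Q *m D) = 1%:M.
  have -> : (toC Q *m D)^T *m toC g *m (toC Q *m D) = D *m toC (Q^T *m g *m Q) *m D.
    by rewrite trmx_mul tr_diag_mx !map_mxM matrix.map_trmx !mulmxA.
  rewrite QgQ map_diag_mx !mulmx_diag.
  apply/matrixP => i j; rewrite !mxE; case: eqP => // _; congr (_ *+ _).
  case: ifP => _; first by rewrite rmorph1 !mulr1.
  by rewrite rmorphN1 mulrN1 mulNr ii opprK.
pose J : 'M[R[i]]_n := \matrix_(i, j) ((i + j).+1 == n)%N%:R.
have JE (i j : 'I_n) : J i j = (j == rev_ord i)%:R.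
  rewrite mxE -val_eqE /=; congr (_ %:R); congr nat_of_bool.
  have := ltn_ord i; have := ltn_ord j; lia.
have JT : J^T = J by apply/matrixP => i j; rewrite !mxE addnC.
have JJ : J *m J = 1%:M.
  apply/matrixP => i j; rewrite !mxE (bigD1 (rev_ord i)) //= big1 ?addr0.
    by rewrite !JE eqxx mul1r rev_ordK eq_sym.
  by move=> k /negbTE kn; rewrite !JE kn mul0r.
pose a : 'rV[R[i]]_n :=
  \row_(j < n) if (j <= rev_ord j)%N then 1 else - ('i / 2).
pose b : 'rV[R[i]]_n :=
  \row_(j < n) if (j < rev_ord j)%N then 'i
               else if (j == rev_ord j) then 0 else 2^-1.
pose T := diag_mx a + J *m diag_mx b.
have TT : T^T *m T = J.
  have -> : T^T *m T = diag_mx a *m diag_mx a + diag_mx b *m diag_mx b +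
      (diag_mx a *m J *m diag_mx b + diag_mx b *m J *m diag_mx a).
    rewrite /T [(_ + _)^T]linearD /= trmx_mul !tr_diag_mx JT mulmxDl !mulmxDr !mulmxA.
    rewrite -(mulmxA (diag_mx b) J J) JJ mulmx1.
    by rewrite (AC (2*2) ((1*4)*(2*3)))%AC.
  have DKD (c d : 'rV[R[i]]_n) (K : 'M[R[i]]_n) i j :
      (diag_mx c *m K *m diag_mx d) i j = c 0 i * K i j * d 0 j.
    by rewrite mul_mx_diag mul_diag_mx !mxE.
  have addE (A B : 'M[R[i]]_n) i j : (A + B) i j = A i j + B i j by rewrite mxE.
  have two0 : (2 : R[i]) != 0 by rewrite pnatr_eq0.
  apply/matrixP => i j; rewrite !addE !DKD !mulmx_diag 2![diag_mx _ i j]mxE.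
  rewrite 2![(\row_(_ < n) _) 0 i]mxE JE.
  have [<-{j}|nij] := eqVneq i j.
    rewrite !mulr1n; have [ri|nri] := eqVneq i (rev_ord i).
      by rewrite /a /b !mxE -ri ltnn leqnn eqxx !(mulr1, mulr0, mul0r, addr0).
    rewrite !(mulr0, mul0r, addr0) /a /b !mxE (negbTE nri).
    case: ltngtP => [_|_|/val_inj e]; last by rewrite -e eqxx in nri.
      by rewrite ii mulr1 subrr.
    by rewrite mulrNN mulrACA ii mulN1r addNr.
  rewrite /= !mulr0n !add0r; case: eqP => [ej|_]; last by rewrite !(mulr0, mul0r) addr0.
  rewrite {j}ej in nij *.
  rewrite /a /b !mxE !rev_ordK !mulr1.
  have half2 : 2^-1 + 2^-1 = 1 :> R[i] by rewrite -mulr2n -[_ *+ 2]mulr_natr mulVf.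
  rewrite [rev_ord i == i]eq_sym (negbTE nij).
  case: ltngtP => [_|_|/val_inj e]; last by case/eqP: nij.
    by rewrite mulNr mulrAC ii mulN1r opprK mulr1 half2.
  by rewrite mul1r mulrN mulrA ii mulN1r opprK half2.
have eP : (toC Q *m D *m T)^T *m toC g *m (toC Q *m D *m T) =
    T^T *m ((toC Q *m D)^T *m toC g *m (toC Q *m D)) *m T.
  by rewrite trmx_mul !mulmxA.
by exists (toC Q *m D *m T); rewrite /is_witt_basis eP DgD mulmx1 TT.
Qed.
End RealRepresentations.

(* Main.v *)
From HB Require Import structures.
Require Import Defs.
From mathcomp Require Import all_boot all_order all_algebra.
From mathcomp Require Import boolp classical_sets reals.
From mathcomp Require Import complex ring lra zify.

Set Implicit Arguments.
Unset Strict Implicit.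
Unset Printing Implicit Defensive.
Import Order.TTheory GRing.Theory Num.Theory.
Local Open Scope ring_scope.

(** After complexification, the module carries a positive definite Hermitian form for which the
    adjoint of each root vector is the opposite root vector (the unitary trick,
    [nab_form_contravariant]). It is therefore completely reducible, and its structure is read off
    its singular vectors, the weight vectors killed by all positive root vectors. It remains to find
    these vectors and to separate the components they generate by an invariant operator defined over
    the reals.

    Upper bound. [nab_sym] turns a tensor satisfying both Bianchi identities into a form
    T(x1,x2,x3;y1,y2), symmetric in the x and in the y, whose symmetrisation over four arguments
    vanishes. This is the symmetric model of the Young shape (3,2), and the passage to it is
    injective ([nab_sym_inj]). For a singular vector, T is invariant under the null rotations fixing
    the highest isotropic vector b_o of a Witt basis. Its weight is dominant because norms are
    nonnegative. Together these facts make T vanish once a few coefficients T(b_N,b_N,b_N;b_l,b_m)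
    vanish, where b_N is the isotropic partner of b_o ([singular_form_eq0], [singular_eq0]). The
    surviving weights are 3 eps_1 + 2 eps_2, 3 eps_1, 2 eps_1 + eps_2 and eps_1, each with a
    singular line of dimension at most one. For n = 4 the mirror images under eps_2 -> - eps_2 join
    them. For n = 3 there is no eps_2 and three weights remain.

    Existence. A vector and an algebraic curvature tensor combine equivariantly into an element of
    the module ([nabla_ext]). Applied to the square of a bivector, to products of the metric with a
    quadratic form, and to the constant curvature tensor, this gives explicit singular vectors
    [hw_vec], whose decisive coefficient is nonzero ([slot_hw_vec]).

    Separation. The Casimir operator takes distinct values on the weights in question when n = 3 or
    n >= 5, so its eigenspaces are exactly the irreducible components ([eigenspace_simple],
    [eigenspace_sum]). The operator and its eigenvalues are real. Hence each complex eigenspace is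
    the complexification of a real one, which is irreducible as well ([real_form_eigenspace],
    [real_form_irreducible]). For n = 4 mirror weights share their Casimir value, and the Casimir
    element is twisted by the Hodge star of so(g). In terms of a Witt basis P the suitable multiple
    involves \det P, which is real for the signatures (4,0), (2,2), (0,4) because det g > 0. The
    component of weight eps_1 is the image of the equivariant map [vec10] from the standard
    representation. *)

Section Representations.
Variables (F : fieldType) (n : nat) (h : {vspace 'M[F]_n}).
Implicit Types V W : lie_rep h.

(** * Linearity of the action, stable subspaces and equivariant embeddings *)

Lemma rep_actD V (A B : 'M[F]_n) : A \in h -> B \in h ->
  rep_act V (A + B) = rep_act V A + rep_act V B.
Proof. by move=> hA hB; rewrite -[A]scale1r rep_act_linear // !scale1r. Qed.

Lemma rep_act0 V : rep_act V 0 = 0.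
Proof.
by apply: (addrI (rep_act V 0)); rewrite -rep_actD ?mem0v // !addr0.
Qed.

Lemma rep_actZ V a (A : 'M[F]_n) : A \in h -> rep_act V (a *: A) = a *: rep_act V A.
Proof. by move=> hA; rewrite -[a *: A]addr0 rep_act_linear ?mem0v // rep_act0 addr0. Qed.

Lemma rep_actN V (A : 'M[F]_n) : A \in h -> rep_act V (- A) = - rep_act V A.
Proof. by move=> hA; rewrite -scaleN1r rep_actZ // scaleN1r. Qed.

Lemma rep_actB V (A B : 'M[F]_n) : A \in h -> B \in h ->
  rep_act V (A - B) = rep_act V A - rep_act V B.
Proof. by move=> hA hB; rewrite rep_actD ?rpredN // rep_actN. Qed.

Lemma rep_act_sum V (I : Type) (r : seq I) (P : pred I) (A : I -> 'M[F]_n) :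
  (forall i, P i -> A i \in h) ->
  rep_act V (\sum_(i <- r | P i) A i) = \sum_(i <- r | P i) rep_act V (A i).
Proof.
move=> hA; elim: r => [|i r IH]; first by rewrite !big_nil rep_act0.
rewrite !big_cons; case: ifP => // Pi.
by rewrite rep_actD ?hA ?IH // rpred_sum.
Qed.

Lemma rep_act_comm V (A B : 'M[F]_n) v : A \in h -> B \in h ->
  rep_act V A (rep_act V B v) =
  rep_act V B (rep_act V A v) + rep_act V (ad_fun A B) v.
Proof.
move=> hA hB; rewrite /ad_fun rep_act_bracket // add_lfunE opp_lfunE !comp_lfunE.
by rewrite addrC subrK.
Qed.

Lemma rep_act_subr V (A : 'M[F]_n) (u v : V) :
  rep_act V A (u - v) = rep_act V A u - rep_act V A v.
Proof. exact: linearB. Qed.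

Lemma rep_act_scaler V (A : 'M[F]_n) a (u : V) : rep_act V A (a *: u) = a *: rep_act V A u.
Proof. exact: linearZ. Qed.

Lemma rep_stable_sum V (I : finType) (U : I -> {vspace V}) :
  (forall i, rep_stable (U i)) -> rep_stable (\sum_i U i)%VS.
Proof.
move=> st A hA _ /memv_sumP [u Uu ->]; rewrite linear_sum /= memv_sumr // => i _.
by apply: st => //; apply: Uu.
Qed.

Lemma rep_stable_eigenspace V (Z : 'End(V)) c :
  (forall A, A \in h -> forall v, rep_act V A (Z v) = Z (rep_act V A v)) ->
  rep_stable (lker (Z - c *: \1%VF)).
Proof.
move=> ZA A hA v /eqlfunP; rewrite scale_lfunE id_lfunE => Zv.
by apply/eqlfunP; rewrite scale_lfunE id_lfunE -ZA // Zv linearZ.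
Qed.

(** A subspace of the restricted representation is pushed forward along the inclusion, so that
    irreducibility becomes minimality of [U] among stable subspaces of the ambient space. *)
Lemma rep_sub_irreducible V (U : {vspace V}) (stU : rep_stable U)
    (hL : lie_closed h) :
  U != 0%VS ->
  (forall U', (U' <= U)%VS -> rep_stable U' -> U' != 0%VS -> (U <= U')%VS) ->
  rep_irreducible (rep_sub stU hL).
Proof.
move=> U0 irr; split.
  by rewrite dimvf /dim /= lt0n dimv_eq0.
move=> U'; pose i : 'Hom(subvs_of U, V) := linfun vsval.
have iE u : i u = vsval u by rewrite lfunE.
have i_inj : lker i == 0%VS.
  by apply/lker0P => u v; rewrite !iE; apply: val_inj.
move=> stU'; have [->|U'0] := eqVneq U' 0%VS; [by left|right].
have : (U <= i @: U')%VS.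
  apply: irr.
  - by apply/subvP => _ /memv_imgP [u _ ->]; rewrite iE subvsP.
  - move=> A hA _ /memv_imgP [u Uu ->].
    by rewrite iE -sub_actE // -iE memv_img //; apply: stU'.
  - rewrite -(limg0 i); apply: contra U'0.
    by rewrite eq_limg_ker0.
move=> UiU'; apply/eqP; rewrite eqEsubv subvf /=; apply/subvP => u _.
have : i u \in (i @: U')%VS by apply: (subvP UiU'); rewrite iE subvsP.
by rewrite [i u \in _]memvE -limg_line limg_ker0 // -memvE.
Qed.

(** An isomorphism onto an invariant subspace, kept inside one ambient representation: internal
    direct sums then become external ones, and the case of the full space gives [rep_iso]. *)
Definition rep_embeds (A V : lie_rep h) (U : {vspace V}) : Prop :=
  exists2 f : 'Hom(A, V), lker f == 0%VS /\ limg f = U &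
    forall M, M \in h -> forall a, f (rep_act A M a) = rep_act V M (f a).

Lemma rep_embeds_sub V (U : {vspace V}) (stU : rep_stable U) (hL : lie_closed h) :
  rep_embeds (rep_sub stU hL) U.
Proof.
pose i : 'Hom(subvs_of U, V) := linfun vsval.
have iE u : i u = vsval u by rewrite lfunE.
exists i; [split|].
- by apply/lker0P => u v; rewrite !iE; apply: val_inj.
- apply/eqP; rewrite eqEsubv; apply/andP; split; apply/subvP.
    by move=> _ /memv_imgP [u _ ->]; rewrite iE subvsP.
  by move=> u Uu; rewrite -(vsprojK Uu) -iE memv_img // memvf.
- by move=> M hM a; rewrite !iE sub_actE.
Qed.

Lemma rep_embeds_sum (A B : lie_rep h) V (U U' : {vspace V}) :
  (U :&: U' = 0)%VS -> rep_embeds A U -> rep_embeds B U' ->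
  rep_embeds (rep_sum A B) (U + U')%VS.
Proof.
move=> UU' [f [kf imf] fE] [f' [kf' imf'] f'E].
pose G (x : A * B) : V := f x.1 + f' x.2.
have G_lin : linear G.
  by move=> a [x1 x2] [y1 y2]; rewrite /G /= !linearP /= scalerDr addrACA.
pose GL : {linear (A * B)%type -> V} := HB.pack G (GRing.isLinear.Build _ _ _ _ G G_lin).
pose g : 'Hom((A * B)%type, V) := linfun GL.
have gE x : g x = f x.1 + f' x.2 by rewrite lfunE.
exists g; [split|].
- apply/lker0P => -[x1 x2] [y1 y2]; rewrite !gE /= => E.
  have E' : f (x1 - y1) = f' (y2 - x2).
    apply: (addIr (f' x2)); rewrite !linearB /= subrK.
    by rewrite addrAC E addrC addKr.
  have z : f (x1 - y1) = 0.
    apply/eqP; rewrite -memv0 -UU' memv_cap {2}E' -imf -imf'.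
    by rewrite !memv_img ?memvf.
  have /eqP : x1 - y1 = 0 by apply: (lker0P kf); rewrite z linear0.
  have /eqP : y2 - x2 = 0 by apply: (lker0P kf'); rewrite -E' z linear0.
  by rewrite !subr_eq0 => /eqP -> /eqP ->.
- apply/eqP; rewrite eqEsubv; apply/andP; split; apply/subvP.
    by move=> _ /memv_imgP [u _ ->]; rewrite gE -imf -imf' memv_add ?memv_img ?memvf.
  move=> _ /memv_addP [u + [v + ->]]; rewrite -imf -imf'.
  move=> /memv_imgP [a _ ->] /memv_imgP [b _ ->]; rewrite -[_ + _](gE (a, b)).
  by rewrite memv_img ?memvf.
- by move=> M hM [a b]; rewrite !gE lfunE /= fE // f'E // linearD.
Qed.

Lemma rep_embeds_iso (A : lie_rep h) V : rep_embeds A (fullv : {vspace V}) -> rep_iso V A.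
Proof.
case=> f [kf imf] fE; exists (f^-1)%VF.
  exists f; last by apply: lker0_lfunK.
  by move=> v; rewrite limg_lfunVK // imf memvf.
move=> M hM v; apply: (lker0P kf).
by rewrite fE // !limg_lfunVK // imf memvf.
Qed.

End Representations.

(** Sealing [dot], [wedge] and [crd] keeps conversion from unfolding them into matrix products, so
    that they act as atoms for rewriting and [ring]. *)
Fact lock_key : unit. Proof. by []. Qed.

(** * The metric, bivectors as elements of so(g), and the standard representation *)

Section Wedge.
Variables (F : fieldType) (n : nat) (g : 'M[F]_n).
Implicit Types (X Y Z : 'cV[F]_n) (A B : 'M[F]_n).

Definition dot X Y : F := locked_with lock_key ((X^T *m g *m Y) 0 0).
(** The identification of bivectors with skew endomorphisms, sending Z to g(Y,Z) X - g(X,Z) Y. *)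
Definition wedge X Y : 'M[F]_n :=
  locked_with lock_key (X *m (Y^T *m g) - Y *m (X^T *m g)).

Lemma dotE X Y : dot X Y = (X^T *m g *m Y) 0 0.
Proof. by rewrite /dot unlock. Qed.
Lemma wedge_def X Y : wedge X Y = X *m (Y^T *m g) - Y *m (X^T *m g).
Proof. by rewrite /wedge unlock. Qed.

Lemma dotPl a X Y Z : dot (a *: X + Y) Z = a * dot X Z + dot Y Z.
Proof. by rewrite !dotE linearP /= !mulmxDl -!scalemxAl !mxE. Qed.
Lemma dotPr a X Y Z : dot Z (a *: X + Y) = a * dot Z X + dot Z Y.
Proof. by rewrite !dotE mulmxDr -scalemxAr !mxE. Qed.
Lemma dotDl X Y Z : dot (X + Y) Z = dot X Z + dot Y Z.
Proof. by rewrite -[X]scale1r dotPl mul1r scale1r. Qed.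
Lemma dotDr X Y Z : dot Z (X + Y) = dot Z X + dot Z Y.
Proof. by rewrite -[X]scale1r dotPr mul1r scale1r. Qed.
Lemma dot0l Z : dot 0 Z = 0.
Proof. by rewrite !dotE trmx0 !mul0mx mxE. Qed.
Lemma dot0r Z : dot Z 0 = 0.
Proof. by rewrite !dotE !mulmx0 mxE. Qed.
Lemma dotZl a X Z : dot (a *: X) Z = a * dot X Z.
Proof. by rewrite -[a *: X]addr0 dotPl dot0l addr0. Qed.
Lemma dotZr a X Z : dot Z (a *: X) = a * dot Z X.
Proof. by rewrite -[a *: X]addr0 dotPr dot0r addr0. Qed.
Lemma dotNl X Z : dot (- X) Z = - dot X Z.
Proof. by rewrite -scaleN1r dotZl mulN1r. Qed.
Lemma dotNr X Z : dot Z (- X) = - dot Z X.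
Proof. by rewrite -scaleN1r dotZr mulN1r. Qed.

Lemma wedgePl a X Y Z : wedge (a *: X + Y) Z = a *: wedge X Z + wedge Y Z.
Proof.
rewrite !wedge_def linearP /= !mulmxDl mulmxDr -!scalemxAl -scalemxAr scalerBr.
by rewrite opprD addrACA.
Qed.
Lemma wedgeC X Y : wedge Y X = - wedge X Y.
Proof. by rewrite !wedge_def opprB. Qed.
Lemma wedgePr a X Y Z : wedge Z (a *: X + Y) = a *: wedge Z X + wedge Z Y.
Proof. by rewrite wedgeC wedgePl opprD -scalerN -!(wedgeC _ Z). Qed.
Lemma wedgeDl X Y Z : wedge (X + Y) Z = wedge X Z + wedge Y Z.
Proof. by rewrite -[X]scale1r wedgePl !scale1r. Qed.
Lemma wedgeDr X Y Z : wedge Z (X + Y) = wedge Z X + wedge Z Y.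
Proof. by rewrite -[X]scale1r wedgePr !scale1r. Qed.
Lemma wedge0l Z : wedge 0 Z = 0.
Proof. by rewrite !wedge_def trmx0 !mul0mx mulmx0 subr0. Qed.
Lemma wedge0r Z : wedge Z 0 = 0.
Proof. by rewrite wedgeC wedge0l oppr0. Qed.
Lemma wedgeZl a X Z : wedge (a *: X) Z = a *: wedge X Z.
Proof. by rewrite -[a *: X]addr0 wedgePl wedge0l addr0. Qed.
Lemma wedgeZr a X Z : wedge Z (a *: X) = a *: wedge Z X.
Proof. by rewrite -[a *: X]addr0 wedgePr wedge0r addr0. Qed.
Lemma wedgeNl X Z : wedge (- X) Z = - wedge X Z.
Proof. by rewrite -scaleN1r wedgeZl scaleN1r. Qed.
Lemma wedgeNr X Z : wedge Z (- X) = - wedge Z X.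
Proof. by rewrite -scaleN1r wedgeZr scaleN1r. Qed.
Lemma wedgexx X : wedge X X = 0.
Proof. by rewrite !wedge_def subrr. Qed.

Lemma wedgeE X Y Z : wedge X Y *m Z = dot Y Z *: X - dot X Z *: Y.
Proof.
have E U W : U *m (W^T *m g) *m Z = dot W Z *: U.
  rewrite dotE -mulmxA. by rewrite {1}[_ *m Z]mx11_scalar mul_mx_scalar.
by rewrite !wedge_def mulmxBl !E.
Qed.

Lemma mulmx_ext (A B : 'M[F]_n) : (forall Z : 'cV_n, A *m Z = B *m Z) -> A = B.
Proof.
move=> E; apply/matrixP => i j; have /colP /(_ i) := E (delta_mx j 0).
by rewrite -!colE !mxE.
Qed.

Lemma col_sum_delta (X : 'cV[F]_n) : X = \sum_a X a 0 *: delta_mx a 0.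
Proof. by rewrite {1}[X]matrix_sum_delta; apply: eq_bigr => i _; rewrite big_ord1. Qed.

Lemma so_dot A X Y : A \in so g -> dot (A *m X) Y = - dot X (A *m Y).
Proof.
move=> /mem_so /eqP; rewrite addr_eq0 => /eqP E.
rewrite !dotE trmx_mul -[X^T *m A^T *m g]mulmxA E mulmxN mulNmx mxE.
by rewrite !mulmxA.
Qed.

Hypothesis gT : g^T = g.

Lemma dotC X Y : dot X Y = dot Y X.
Proof.
rewrite !dotE; have -> : X^T *m g *m Y = (Y^T *m g *m X)^T by rewrite !trmx_mul trmxK gT mulmxA.
by rewrite mxE.
Qed.

Lemma wedge_so X Y : wedge X Y \in so g.
Proof.
apply/mem_so; rewrite !wedge_def linearB /= !trmx_mul !trmxK gT mulmxBl mulmxBr.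
by rewrite !mulmxA addrA subrK subrr.
Qed.

Lemma so_of_dot A : (forall X Y, dot (A *m X) Y = - dot X (A *m Y)) -> A \in so g.
Proof.
move=> E; apply/mem_so/matrixP => i j.
have := E (delta_mx i 0) (delta_mx j 0); rewrite !dotE trmx_mul -!mulmxA.
rewrite trmx_delta -!rowE !mulmxA -!colE => /eqP.
by rewrite -addr_eq0 !mxE => /eqP.
Qed.

Lemma ad_wedge A X Y : A \in so g ->
  ad_fun A (wedge X Y) = wedge (A *m X) Y + wedge X (A *m Y).
Proof.
move=> hA; apply: mulmx_ext => Z.
rewrite /ad_fun [LHS]mulmxBl [RHS]mulmxDl -[A *m wedge X Y *m Z]mulmxA.
rewrite -[wedge X Y *m A *m Z]mulmxA !wedgeE mulmxBr -!scalemxAr !so_dot //.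
by rewrite !scaleNr opprB opprK [LHS](AC (2*2) ((1*3)*(4*2)))%AC.
Qed.

Hypothesis gU : g \in unitmx.
Local Notation G := (invmx g).

Lemma dot_nondeg X : (forall Y, dot X Y = 0) -> X = 0.
Proof.
move=> E; have : X^T *m g = 0.
  apply/matrixP => i j; have := E (delta_mx j 0).
  by rewrite !dotE -colE mxE (ord1 i) => ->; rewrite mxE.
move/(congr1 (mulmxr G)); rewrite /= mulmxK // mul0mx => /(congr1 trmx).
by rewrite trmxK trmx0.
Qed.

(** A nonzero w in [U] brings its whole orthogonal complement into [U]. Since n >= 3, there is a
    second independent vector in [U], and every X is orthogonal to some nonzero combination of the
    two. *)
Lemma rep_std_irreducible : (3 <= n)%N -> rep_irreducible (rep_std (so g)).
Proof.
move=> n3; split; first by rewrite dimvf /dim /= muln1 (leq_trans _ n3).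
move=> U stU; have [->|U0] := eqVneq U 0%VS; [by left|right].
(* With Y chosen so that g(Y,w) is nonzero, the bivector of X and Y maps w to a nonzero multiple of
   X. *)
have key w X : w \in U -> w != 0 -> dot w X = 0 -> X \in U.
  move=> Uw w0 wX.
  have [Y Yw] : exists Y, dot Y w != 0.
    have [//|no] := pselect (exists Y, dot Y w != 0); case/eqP: w0.
    apply: dot_nondeg => Y; rewrite dotC; apply/eqP; apply/negPn/negP => h.
    by case: no; exists Y.
  have := stU _ (wedge_so X Y) _ Uw; rewrite lfunE /= wedgeE [dot X w]dotC wX scale0r subr0.
  by rewrite rpredZeq (negbTE Yw).
pose w := vpick U; have w0 : w != 0 by rewrite vpick0.
have Uw : w \in U by apply: memv_pick.
have dU : (1 < \dim U)%N.
  pose f : 'Hom('cV[F]_n, 'cV[F]_1) := linfun (mulmx (w^T *m g)).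
  have := limg_ker_dim f fullv; rewrite dimvf /dim /= muln1 capfv => E.
  have : (\dim (limg f) <= 1)%N by rewrite (leq_trans (dimvS (subvf _))) // dimvf.
  have : (\dim (lker f) <= \dim U)%N.
    apply/dimvS/subvP => X; rewrite memv_ker lfunE /= => /eqP X0.
    by apply: (key w) => //; rewrite !dotE X0 mxE.
  move=> kU imf; have : (n <= \dim U + 1)%N by rewrite -[X in (X <= _)%N]E leq_add.
  by rewrite addn1 => /(leq_trans n3); rewrite ltnS.
have /subvPn [w' Uw' ww'] : ~~ (U <= <[w]>)%VS.
  by apply: contraL dU => /dimvS; rewrite dim_vline w0 -leqNgt.
apply/eqP; rewrite eqEsubv subvf; apply/subvP => X _.
have [wX|wX] := eqVneq (dot w X) 0; first exact: (key w).
(* This combination of w and w' is orthogonal to X, and nonzero because w' is not proportional to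
   w. *)
apply: (key (dot w' X *: w - dot w X *: w')).
- by rewrite rpredB ?rpredZ.
- rewrite subr_eq0; apply: contra ww' => /eqP E.
  by rewrite -[w'](scalerK wX) -E !rpredZ ?memv_line.
- by rewrite dotDl dotNl !dotZl mulrC subrr.
Qed.

(** The sum of e_a tensor G e_a is the inverse metric, an invariant element: moving A across the two
    slots costs a sign. *)
Lemma dual_basis_invariant (E : lmodType F) (be : 'cV[F]_n -> 'cV[F]_n -> E) A :
  (forall Y, linear (be^~ Y)) -> (forall X, linear (be X)) -> A \in so g ->
  \sum_a be (A *m delta_mx a 0) (G *m delta_mx a 0) =
  - \sum_a be (delta_mx a 0) (A *m (G *m delta_mx a 0)).
Proof.
move=> bl br hA.
pose L Y : {linear 'cV[F]_n -> E} := HB.pack (be^~ Y) (GRing.isLinear.Build _ _ _ _ (be^~ Y) (bl Y)).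
pose K X : {linear 'cV[F]_n -> E} := HB.pack (be X) (GRing.isLinear.Build _ _ _ _ (be X) (br X)).
have e1 X Y : be X Y = \sum_a X a 0 *: be (delta_mx a 0) Y.
  rewrite {1}[X]col_sum_delta -[be _ Y]/(L Y _) linear_sum.
  by apply: eq_bigr => a _; rewrite linearZ.
have GA : G *m A^T = - (A *m G).
  move/mem_so: hA => /(congr1 (fun B => G *m B *m G)) /eqP.
  rewrite mulmxDr mulmxDl mulmx0 mul0mx addr_eq0 !mulmxA mulVmx // mul1mx.
  by rewrite -[G *m A^T *m g *m G]mulmxA mulmxV // mulmx1 => /eqP.
under eq_bigr => a _ do rewrite e1.
rewrite exchange_big /= -sumrN; apply: eq_bigr => c _.
rewrite -[be _ (A *m _)]/(K _ _) -linearN -mulNmx mulmxA mulNmx -GA -mulmxA.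
rewrite [A^T *m _]col_sum_delta mulmx_sumr linear_sum; apply: eq_bigr => a _.
by rewrite -scalemxAr linearZ /= -!colE !mxE.
Qed.
End Wedge.

(** * Casimir operators twisted by an equivariant endomorphism of so(g) *)

Section Casimir.
Variables (F : fieldType) (n : nat) (g : 'M[F]_n).
Hypotheses (gT : g^T = g) (gU : g \in unitmx).
Variables (tau : 'End('M[F]_n)) (M : lie_rep (so g)).
Hypothesis tau_so : forall A, A \in so g -> tau A \in so g.
Hypothesis tau_ad : forall A B, A \in so g -> B \in so g ->
  tau (ad_fun A B) = ad_fun A (tau B).
Local Notation G := (invmx g).
Local Notation rho := (rep_act M).
Local Notation e_ a := (delta_mx a 0 : 'cV[F]_n).

(** For [tau] the identity this is the Casimir operator up to normalisation, since the vectors G e_a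
    form the basis dual to e_a. A nontrivial [tau] weights the ideals of so(g) differently, which
    matters for n = 4. *)
Definition casimir : 'End(M) :=
  \sum_a \sum_b (rho (wedge g (e_ a) (e_ b)) \o
    rho (tau (wedge g (G *m e_ b) (G *m e_ a))))%VF.

Let be v (x y z u : 'cV[F]_n) := rho (wedge g x y) (rho (tau (wedge g z u)) v).

Let casimirE v : casimir v = \sum_a \sum_b be v (e_ a) (e_ b) (G *m e_ b) (G *m e_ a).
Proof.
rewrite sum_lfunE; apply: eq_bigr => a _; rewrite sum_lfunE.
by apply: eq_bigr => b _; rewrite comp_lfunE.
Qed.

Let tw x y := tau_so (wedge_so gT x y).

Let be1 v y z u : linear (fun x => be v x y z u).
Proof.
by move=> a x x'; rewrite /be wedgePl rep_act_linear ?wedge_so // add_lfunE scale_lfunE.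
Qed.
Let be2 v x z u : linear (fun y => be v x y z u).
Proof.
by move=> a y y'; rewrite /be wedgePr rep_act_linear ?wedge_so // add_lfunE scale_lfunE.
Qed.
Let be3 v x y u : linear (fun z => be v x y z u).
Proof.
move=> a z z'; rewrite /be wedgePl linearP /= rep_act_linear ?tw //.
by rewrite add_lfunE scale_lfunE linearP.
Qed.
Let be4 v x y z : linear (fun u => be v x y z u).
Proof.
move=> a u u'; rewrite /be wedgePr linearP /= rep_act_linear ?tw //.
by rewrite add_lfunE scale_lfunE linearP.
Qed.

(** Commuting A past the two factors produces four correction terms. They pair into two contractions
    with the inverse metric, each of which vanishes by invariance. *)
Lemma casimir_comm A v : A \in so g -> rho A (casimir v) = casimir (rho A v).
Proof.
move=> hA; rewrite !casimirE.
have E x y z u : rho A (be v x y z u) = be (rho A v) x y z u +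
   (be v (A *m x) y z u + be v x y z (A *m u)) + (be v x (A *m y) z u + be v x y (A *m z) u).
  rewrite /be rep_act_comm ?wedge_so // [rho A (rho (tau _) v)]rep_act_comm ?tw // linearD /=.
  rewrite ad_wedge // -tau_ad ?wedge_so // ad_wedge // linearD /=.
  rewrite !rep_actD ?tw ?wedge_so // !add_lfunE linearD /= -!addrA; congr (_ + _).
  by rewrite !addrA [LHS](AC 4 (3*2*4*1))%AC.
(* The first and fourth slots are contracted over a, the second and third over b. *)
have z1 : \sum_a (\sum_b (be v (A *m e_ a) (e_ b) (G *m e_ b) (G *m e_ a)
         + be v (e_ a) (e_ b) (G *m e_ b) (A *m (G *m e_ a)))) = 0.
  rewrite exchange_big big1 //= => b _; rewrite big_split /=.
  by rewrite (@dual_basis_invariant _ _ _ gU _ (fun x u => be v x (e_ b) (G *m e_ b) u)) // addNr.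
have z2 : \sum_a (\sum_b (be v (e_ a) (A *m e_ b) (G *m e_ b) (G *m e_ a)
         + be v (e_ a) (e_ b) (A *m (G *m e_ b)) (G *m e_ a))) = 0.
  rewrite big1 //= => a _; rewrite big_split /=.
  by rewrite (@dual_basis_invariant _ _ _ gU _ (fun x u => be v (e_ a) x u (G *m e_ a))) // addNr.
have := congr2 +%R z1 z2; rewrite addr0 => z12.
rewrite -[RHS]addr0 -[X in _ = _ + X]z12 -!big_split linear_sum; apply: eq_bigr => a _ /=.
rewrite linear_sum -!big_split; apply: eq_bigr => b _ /=.
by rewrite E addrA.
Qed.

Variable P : 'M[F]_n.
Hypothesis hP : is_witt_basis g P.

(** The inverse metric does not depend on the basis used to write it, and in a Witt basis b_(rev i)
    is dual to b_i. *)
Lemma dual_basis_witt (E : lmodType F) (bb : 'cV[F]_n -> 'cV[F]_n -> E) :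
  (forall Y, linear (bb^~ Y)) -> (forall X, linear (bb X)) ->
  \sum_a bb (e_ a) (G *m e_ a) = \sum_i bb (col i P) (col (rev_ord i) P).
Proof.
move=> bl br.
pose L Y : {linear 'cV[F]_n -> E} := HB.pack (bb^~ Y) (GRing.isLinear.Build _ _ _ _ (bb^~ Y) (bl Y)).
pose K X : {linear 'cV[F]_n -> E} := HB.pack (bb X) (GRing.isLinear.Build _ _ _ _ (bb X) (br X)).
(* From P^T g P = J with J the antidiagonal involution one gets G = P J P^T, whose columns give this
   expansion. *)
have PG a : G *m e_ a = \sum_i P a i *: col (rev_ord i) P.
  have PJ (i j : 'I_n) : (P^T *m g *m P) i j = (j == rev_ord i)%:R.
    rewrite hP mxE -val_eqE /=; congr (_ %:R); congr nat_of_bool.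
    have := ltn_ord i; have := ltn_ord j; lia.
  pose J : 'M[F]_n := \matrix_(i, j) (j == rev_ord i)%:R.
  have PJ' : P^T *m g *m P = J by apply/matrixP => i j; rewrite PJ mxE.
  have JJ : J *m J = 1%:M.
    apply/matrixP => i j; rewrite !mxE (bigD1 (rev_ord i)) //= big1 ?addr0.
      by rewrite !mxE eqxx mul1r rev_ordK eq_sym.
    by move=> k /negbTE kn; rewrite !mxE kn mul0r.
  have GP : g *m (P *m J *m P^T) = 1%:M.
    apply: mulmx1C; rewrite -!mulmxA; apply: mulmx1C; rewrite -!mulmxA.
    by apply: mulmx1C; rewrite !mulmxA PJ' JJ.
  have -> : G = P *m J *m P^T.
    by rewrite -[LHS]mulmx1 -GP [LHS]mulmxA mulVmx // mul1mx.
  rewrite -(mulmxA (P *m J)) -colE.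
  apply/matrixP => i j; rewrite ord1 summxE mxE; apply: eq_bigr => k _.
  have -> : (P *m J) i k = P i (rev_ord k).
    rewrite mxE (bigD1 (rev_ord k)) //= big1 ?addr0 => [|l /negbTE h].
      by rewrite mxE rev_ordK eqxx mulr1.
    by rewrite mxE -[k]rev_ordK (inj_eq rev_ord_inj) eq_sym h mulr0.
  by rewrite !mxE mulrC.
under eq_bigr => a _ do rewrite PG -[bb _ _]/(K _ _) linear_sum.
rewrite exchange_big /=; apply: eq_bigr => i _.
rewrite [col i P]col_sum_delta -[RHS]/(L _ _) linear_sum; apply: eq_bigr => a _ /=.
by rewrite -[bb _ (_ *: _)]/(K _ _) -[bb (_ *: _) _]/(L _ _) !linearZ /= mxE.
Qed.

(** In Witt coordinates this is the matrix unit at (i,j) minus the one at (rev j, rev i). It is a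
    Cartan element for i = j, a positive root vector for i < j, and zero for j = rev i. *)
Definition root_elt (i j : 'I_n) : 'M[F]_n := wedge g (col i P) (col (rev_ord j) P).

Lemma casimir_witt v :
  casimir v = \sum_i \sum_j rho (root_elt i j) (rho (tau (root_elt j i)) v).
Proof.
rewrite casimirE.
under eq_bigr => a _ do rewrite
  (@dual_basis_witt _ (fun x u => be v (e_ a) x u (G *m e_ a))) //.
rewrite exchange_big /=.
under eq_bigr => b _ do rewrite
  (@dual_basis_witt _ (fun x u => be v x (col b P) (col (rev_ord b) P) u)) //.
rewrite exchange_big /=; apply: eq_bigr => i _.
rewrite (reindex_inj rev_ord_inj) /=; apply: eq_bigr => j _.
by rewrite rev_ordK.
Qed.

End Casimir.

Lemma scaler_injr (F : fieldType) (V : lmodType F) (u : V) (a b : F) :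
  u != 0 -> a *: u = b *: u -> a = b.
Proof.
move=> u0 /eqP; rewrite -subr_eq0 -scalerBl scaler_eq0 (negbTE u0) orbF subr_eq0.
by move/eqP.
Qed.

(** * Root vectors, weights and singular vectors in a Witt basis *)

Section WittBasis.
Variables (F : fieldType) (n : nat) (g P : 'M[F]_n).
Hypothesis hP : is_witt_basis g P.
Local Notation b i := (col i P).
Local Notation E := (root_elt g P).
Implicit Types i j k : 'I_n.

Lemma ord_sum_rev i j : ((i + j).+1 == n)%N = (j == rev_ord i).
Proof.
rewrite -val_eqE /=; have := ltn_ord i; have := ltn_ord j; lia.
Qed.

Let PgP i j : (P^T *m g *m P) i j = (j == rev_ord i)%:R.
Proof. by rewrite hP mxE ord_sum_rev. Qed.

Lemma witt_units : (P \in unitmx) && (g \in unitmx).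
Proof.
have /mulmx1_unit [] : (P^T *m g) *m (P *m (P^T *m g *m P)) = 1%:M.
  rewrite mulmxA; apply/matrixP => i j; rewrite mxE (bigD1 (rev_ord i)) //= big1.
    by rewrite !PgP eqxx rev_ordK mul1r addr0 mxE eq_sym.
  by move=> k /negbTE h; rewrite !PgP h mul0r.
by rewrite !unitmx_mul => /andP[_ ->] /andP[->].
Qed.

Lemma witt_unit : P \in unitmx.
Proof. by case/andP: witt_units. Qed.
Lemma metric_unit : g \in unitmx.
Proof. by case/andP: witt_units. Qed.

Lemma metric_sym : g^T = g.
Proof.
have PU := witt_unit; have PTU : P^T \in unitmx by rewrite unitmx_tr.
have S : (P^T *m g *m P)^T = P^T *m g *m P.
  by rewrite hP; apply/matrixP => i j; rewrite !mxE addnC.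
apply: (can_inj (mulKmx PTU)); apply: (can_inj (mulmxK PU)).
by rewrite -S !trmx_mul trmxK mulmxA.
Qed.

Lemma dot_witt i j : dot g (b i) (b j) = (j == rev_ord i)%:R.
Proof.
rewrite dotE -PgP [LHS]mxE [RHS]mxE; apply: eq_bigr => k _.
rewrite [col j P k 0]mxE; congr (_ * _); rewrite [LHS]mxE [RHS]mxE.
by apply: eq_bigr => l _; rewrite !mxE.
Qed.

Lemma root_elt_so i j : E i j \in so g.
Proof. exact: wedge_so metric_sym _ _. Qed.

Lemma root_eltE i j k :
  E i j *m b k = (k == j)%:R *: b i - (k == rev_ord i)%:R *: b (rev_ord j).
Proof. by rewrite /root_elt wedgeE !dot_witt rev_ordK. Qed.

Lemma root_elt_rev i j : E (rev_ord i) (rev_ord j) = - E j i.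
Proof. by rewrite /root_elt rev_ordK wedgeC. Qed.

Lemma root_elt_rev0 i : E i (rev_ord i) = 0.
Proof. by rewrite /root_elt rev_ordK wedgexx. Qed.

(** The weight of b_i evaluated on the Cartan element [E k k]. *)
Definition eps k i : F := (i == k)%:R - (i == rev_ord k)%:R.

Lemma eps_rev k i : eps k (rev_ord i) = - eps k i.
Proof. by rewrite /eps opprB -{1}[k]rev_ordK !(inj_eq rev_ord_inj). Qed.

Lemma eps_rev_l k i : eps (rev_ord k) i = - eps k i.
Proof. by rewrite /eps opprB rev_ordK. Qed.

Lemma cartanE k i : E k k *m b i = eps k i *: b i.
Proof.
rewrite root_eltE /eps scalerBl; congr (_ - _).
  by case: eqP => [->|]; rewrite ?scale0r.
by case: eqP => [->|]; rewrite ?scale0r.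
Qed.

Lemma ad_root_opp i j : j != rev_ord i -> ad_fun (E i j) (E j i) = E i i - E j j.
Proof.
move=> /negbTE ij; rewrite [X in ad_fun _ X]/root_elt ad_wedge ?root_elt_so //.
rewrite !root_eltE eqxx ij scale0r subr0 !scale1r.
by rewrite [rev_ord i == j]eq_sym ij eqxx scale0r scale1r sub0r wedgeNr.
Qed.

Lemma ad_cartan k i j : ad_fun (E k k) (E i j) = (eps k i - eps k j) *: E i j.
Proof.
rewrite [X in ad_fun _ X]/root_elt ad_wedge ?root_elt_so //.
by rewrite !cartanE eps_rev wedgeZl wedgeZr -scalerDl.
Qed.

Variable M : lie_rep (so g).
Local Notation rho := (rep_act M).

(** Weights are indexed by all n positions instead of the rank; [is_weight_rev] shows that reversal
    changes the sign, so half of the values determine the rest. *)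
Definition is_weight (u : M) (lam : 'I_n -> F) : Prop :=
  forall k, rho (E k k) u = lam k *: u.

Definition is_singular (u : M) : Prop :=
  forall i j, (i < j)%N -> rho (E i j) u = 0.

Lemma is_weight_rev u lam i : u != 0 -> is_weight u lam -> lam (rev_ord i) = - lam i.
Proof.
move=> u0 wu; apply: (scaler_injr u0); rewrite -wu root_elt_rev rep_actN ?root_elt_so //.
by rewrite opp_lfunE wu scaleNr.
Qed.

Lemma is_weight_root u lam i j :
  is_weight u lam -> is_weight (rho (E i j) u) (fun k => lam k + eps k i - eps k j).
Proof.
move=> wu k; rewrite rep_act_comm ?root_elt_so // wu linearZ /= ad_cartan.
by rewrite rep_actZ ?root_elt_so // scale_lfunE -scalerDl addrA.
Qed.

Lemma singular_root_root u lam i j : is_weight u lam -> is_singular u ->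
  (i < j)%N -> j != rev_ord i ->
  rho (E i j) (rho (E j i) u) = (lam i - lam j) *: u.
Proof.
move=> wu su ij nij; rewrite rep_act_comm ?root_elt_so // su // linear0 add0r.
by rewrite ad_root_opp // rep_actB ?root_elt_so // add_lfunE opp_lfunE !wu scalerBl.
Qed.

(** Coordinates of the sum of the positive roots, continued antisymmetrically to all indices. The
    term j = rev i is left out because there is no root vector there. *)
Definition two_rho i : F := \sum_(j | j != rev_ord i) ((i < j)%N%:R - (j < i)%N%:R).

Lemma two_rhoE i : (i < rev_ord i)%N -> two_rho i = n%:R - 2 - (2 * i)%:R.
Proof.
move=> lti; have := ltn_ord i => ltin.
have -> : two_rho i = \sum_(j < n) ((i < j)%N%:R - (j < i)%N%:R) - 1.
  rewrite [X in _ = X - 1](bigD1 (rev_ord i)) //= lti ltnNge (ltnW lti) subr0.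
  by rewrite addrC addrK.
have cnt m : (m <= n)%N -> \sum_(j < n) (j < m)%N%:R = m%:R :> F.
  have /(_ n) : forall k : nat, \sum_(j < k) (j < m)%N%:R = (minn m k)%:R :> F.
    elim=> [|k IH]; first by rewrite big_ord0 minn0.
    rewrite big_ord_recr /= IH -natrD; congr _%:R; lia.
  by move=> -> mn; congr _%:R; lia.
rewrite sumrB (cnt i) 1?ltnW //.
have -> : \sum_(j < n) (i < j)%N%:R = n%:R - (i.+1)%:R :> F.
  apply: (addrI (\sum_(j < n) (j < i.+1)%N%:R)).
  rewrite [in RHS]cnt // [RHS]addrC subrK -big_split /=.
  rewrite (eq_bigr (fun=> 1)) ?sumr_const ?card_ord // => k _.
  by rewrite ltnS; case: (leqP k i); rewrite ?addr0 ?add0r.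
ring.
Qed.

(** On a singular vector the terms with i > j die, those with i < j reduce to lam_i - lam_j, and the
    diagonal gives squares. As every coordinate occurs along with its reverse, the scalar is twice
    the usual (lam, lam + 2 rho). *)
Lemma casimir_weight u lam : is_weight u lam -> is_singular u ->
  \sum_i \sum_j rho (E i j) (rho (E j i) u) =
  (\sum_i lam i ^+ 2 + \sum_i lam i * two_rho i) *: u.
Proof.
move=> wu su.
pose w i j : F := (j != rev_ord i)%:R.
have wC i j : w i j = w j i by rewrite /w eq_sym -{1}[j]rev_ordK (inj_eq rev_ord_inj) eq_sym.
have t i j : rho (E i j) (rho (E j i) u) =
   ((i == j)%:R * lam i ^+ 2 + w i j * ((i < j)%N%:R * (lam i - lam j))) *: u.
  have [<-{j}|nij] := eqVneq i j.
    by rewrite ltnn mul0r mulr0 addr0 mul1r wu linearZ /= wu scalerA expr2.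
  rewrite mul0r add0r /w; have [->|nrij] := eqVneq j (rev_ord i).
    by rewrite root_elt_rev0 rep_act0 zero_lfunE mul0r scale0r.
  rewrite mul1r; case: ltngtP => [ltij|ltji|/val_inj e].
  - by rewrite mul1r (singular_root_root wu su).
  - by rewrite (su j i) // linear0 mul0r scale0r.
  - by rewrite e eqxx in nij.
under eq_bigr => i _ do under eq_bigr => j _ do rewrite t.
under eq_bigr => i _ do rewrite -scaler_suml.
rewrite -scaler_suml; congr (_ *: _).
under eq_bigr => i _ do rewrite big_split /=.
rewrite big_split /=; congr (_ + _).
  apply: eq_bigr => i _; rewrite (bigD1 i) //= eqxx mul1r big1 ?addr0 // => j /negbTE.
  by rewrite eq_sym => ->; rewrite mul0r.
have -> : \sum_i \sum_j w i j * ((i < j)%N%:R * (lam i - lam j)) =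
   \sum_i \sum_j w i j * ((i < j)%N%:R * lam i) - \sum_i \sum_j w i j * ((i < j)%N%:R * lam j).
  rewrite -sumrB; apply: eq_bigr => i _; rewrite -sumrB.
  by apply: eq_bigr => j _; rewrite !mulrBr.
rewrite [X in _ - X]exchange_big /= -sumrB; apply: eq_bigr => i _.
rewrite -sumrB /two_rho [X in _ * X]big_mkcond /= mulr_sumr; apply: eq_bigr => j _.
rewrite (wC j i) /w; case: (j != rev_ord i); last by rewrite !mul0r subr0 mulr0.
by rewrite !mul1r mulrBr ![lam i * _]mulrC.
Qed.

End WittBasis.

(** * Joint eigenvectors over an algebraically closed field *)

Section Eigenvectors.
Variable K : closedFieldType.

Import VectorInternalTheory.

Lemma lfun_eigen_char (V : vectType K) (f : 'End(V)) a v :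
  v != 0 -> f v = a *: v -> root (char_poly (f2mx f)) a.
Proof.
move=> v0 fv; rewrite -eigenvalue_root_char; apply/eigenvalueP; exists (v2r v).
  by rewrite -linearZ /= -fv unlock /= r2vK.
by rewrite -[X in _ != X](linear0 v2r) (can_eq v2rK).
Qed.

Lemma lfun_eigen_exists (V : vectType K) (f : 'End(V)) :
  (0 < \dim {:V})%N -> exists a, exists2 v, v != 0 & f v = a *: v.
Proof.
rewrite dimvf => dV.
have /closed_rootP [a] : size (char_poly (f2mx f)) != 1%N.
  by rewrite size_char_poly eqSS -lt0n.
rewrite -eigenvalue_root_char => /eigenvalueP [v /eqP fv v0]; exists a, (r2v v).
  by rewrite -[X in _ != X](linear0 r2v) (can_eq r2vK).
by rewrite unlock /= r2vK (eqP fv) linearZ.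
Qed.

Lemma lfun_eigen_in (V : vectType K) (f : 'End(V)) (U : {vspace V}) :
  U != 0%VS -> (forall u, u \in U -> f u \in U) ->
  exists a, exists2 v, v \in U & v != 0 /\ f v = a *: v.
Proof.
move=> U0 fU; pose f' : 'End(subvs_of U) := linfun (vsproj U \o f \o vsval).
have [|a [v v0 fv]] := lfun_eigen_exists f'.
  by rewrite dimvf /dim /= lt0n dimv_eq0.
exists a, (vsval v); [exact: subvsP|split].
  by apply: contra v0 => /eqP v0; apply/eqP/val_inj; rewrite [LHS]v0.
by have := congr1 vsval fv; rewrite lfunE /= vsprojK ?fU ?subvsP // => ->; rewrite linearZ.
Qed.

(** Induction on the list, cutting [U] down to an eigenspace of one operator, which the others
    preserve because they commute. The [foldr] spells out the conjunction over the list. *)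
Lemma lfun_joint_eigen (V : vectType K) (I : Type) (f : I -> 'End(V)) (s : seq I) :
  (forall i j v, f i (f j v) = f j (f i v)) ->
  forall U : {vspace V}, U != 0%VS -> (forall i u, u \in U -> f i u \in U) ->
  exists2 v, v \in U & v != 0 /\ foldr (fun i P => (exists a, f i v = a *: v) /\ P) True s.
Proof.
move=> fC; elim: s => [|i s IH] U U0 fU.
  by exists (vpick U); rewrite ?memv_pick // vpick0.
have [a [w Uw [w0 fw]]] := lfun_eigen_in U0 (fU i).
pose U' := (U :&: lker (f i - a *: \1%VF))%VS.
have memU' v : v \in U' -> v \in U /\ f i v = a *: v.
  rewrite memv_cap => /andP[Uv /eqlfunP].
  by rewrite scale_lfunE id_lfunE.
have mU' v : v \in U -> f i v = a *: v -> v \in U'.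
  move=> Uv fv; rewrite memv_cap Uv; apply/eqlfunP.
  by rewrite scale_lfunE id_lfunE.
have [||v U'v [v0 vs]] := IH U'.
- by apply: contra w0 => /eqP E; have := mU' _ Uw fw; rewrite E memv0.
- by move=> j u /memU' [Uu fu]; apply: mU'; [apply: fU|rewrite fC fu linearZ].
exists v; first by have [] := memU' _ U'v.
by split=> //; split=> //; exists a; have [] := memU' _ U'v.
Qed.

End Eigenvectors.

(** A positive definite Hermitian form for which so(g) is closed under adjoints and transposition of
    indices is the adjoint on root vectors. It plays the role of a form invariant under the compact
    real form. *)
Record contravariant_form (C : numClosedFieldType) (n : nat) (g P : 'M[C]_n)
    (M : lie_rep (so g)) (H : M -> M -> C) : Prop := ContravariantForm {
  form_linear : forall a u v w, H (a *: u + v) w = a * H u w + H v w;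
  form_conj : forall u v, H u v = (H v u)^*;
  form_ge0 : forall u, 0 <= H u u;
  form_def : forall u, H u u = 0 -> u = 0;
  form_adj : forall A, A \in so g -> exists2 B, B \in so g &
    forall u v, H (rep_act M A u) v = H u (rep_act M B v);
  form_root : forall i j u v,
    H (rep_act M (root_elt g P i j) u) v = H u (rep_act M (root_elt g P j i) v) }.

(** * Complete reducibility and highest weights from a contravariant form *)

Section HighestWeightTheory.
Variables (C : numClosedFieldType) (n : nat) (g P : 'M[C]_n).
Hypothesis hP : is_witt_basis g P.
Variables (M : lie_rep (so g)) (H : M -> M -> C).
Hypothesis hH : contravariant_form P H.
Local Notation rho := (rep_act M).
Local Notation E := (root_elt g P).

Implicit Types (u v w : M) (i j k : 'I_n).

Let Eso i j : E i j \in so g.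
Proof. exact: root_elt_so. Qed.

Lemma form_linear_r u a v w : H u (a *: v + w) = a^* * H u v + H u w.
Proof.
by rewrite [LHS](form_conj hH) (form_linear hH) rmorphD rmorphM /= [in RHS](form_conj hH) [H u w](form_conj hH).
Qed.

Lemma cform0l u : H 0 u = 0.
Proof.
have := form_linear hH 1 0 0 u; rewrite scale1r addr0 mul1r => /esym/eqP.
by rewrite -subr_eq0 addrK => /eqP.
Qed.

Lemma cform0r u : H u 0 = 0.
Proof. by rewrite (form_conj hH) cform0l conjC0. Qed.

(** The squared norm of [E j i] applied to u is lam_i - lam_j times the squared norm of u, up to
    conjugation. *)
Lemma singular_dominant u lam i j : u != 0 -> is_weight P u lam -> is_singular P u ->
  (i < j)%N -> j != rev_ord i -> 0 <= lam i - lam j.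
Proof.
move=> u0 wu su ij nij; have Hu0 : 0 < H u u.
  by rewrite lt_neqAle (form_ge0 hH) andbT eq_sym; apply: contra u0 => /eqP /(form_def hH) ->.
have := form_ge0 hH (rho (E j i) u).
rewrite (form_root hH) (singular_root_root hP wu su) // -[_ *: u]addr0 form_linear_r.
by rewrite cform0r addr0 pmulr_lge0 // conjC_ge0.
Qed.

(** Pairing with a basis of [U] is then injective on [W], so dim W <= dim U. Conjugate linearity in
    the second slot is harmless because only the first argument varies. *)
Lemma form_orthogonal (U W : {vspace M}) : (U <= W)%VS ->
  (forall w, w \in W -> (forall u, u \in U -> H w u = 0) -> w = 0) -> (W <= U)%VS.
Proof.
move=> UW orth; pose ph w : 'rV[C]_(\dim U) := \row_i H w (vbasis U)`_i.
have ph_lin : linear ph by move=> a u v; apply/rowP => i; rewrite !mxE (form_linear hH).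
pose f : 'Hom(M, 'rV[C]_(\dim U)) :=
  linfun (HB.pack ph (GRing.isLinear.Build _ _ _ _ ph ph_lin) : {linear M -> 'rV[C]_(\dim U)}).
have fE w : f w = ph w by rewrite lfunE.
have W0 : (W :&: lker f = 0)%VS.
  apply/eqP; rewrite -subv0; apply/subvP => w; rewrite memv_cap memv_ker fE memv0.
  move=> /andP[Ww /eqP w0]; apply/eqP/orth => // u /coord_vbasis ->.
  have HU (s : seq 'I_(\dim U)) (x : 'I_(\dim U) -> C) :
      H w (\sum_(i <- s) x i *: (vbasis U)`_i) = 0.
    elim: s => [|i s IH].
      by rewrite big_nil cform0r.
    rewrite big_cons form_linear_r IH addr0.
    by have /rowP /(_ i) := w0; rewrite !mxE => ->; rewrite mulr0.
  exact: HU.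
have dW : (\dim W <= \dim U)%N.
  rewrite -(limg_dim_eq W0) (leq_trans (dimvS (subvf _))) // dimvf /dim /= mul1n.
  exact: leqnn.
by have := dimv_leqif_sup UW; case=> _ <-; rewrite eqn_leq dimvS.
Qed.

(** Start from a joint eigenvector of the Cartan elements and raise it as long as possible. The
    height strictly increases and is always an eigenvalue of one fixed operator, so the process
    stops. *)
Lemma singular_exists (U : {vspace M}) : rep_stable U -> U != 0%VS ->
  exists2 u, u \in U & u != 0 /\ exists2 lam, is_weight P u lam & is_singular P u.
Proof.
move=> stU U0; apply: contrapT => no.
(* With coefficients -k, raising by [E i j] increases the height by 2(j - i). *)
pose ht (lam : 'I_n -> C) : C := \sum_(k < n) - k%:R * lam k.
pose D : 'M[C]_n := \sum_(k < n) - k%:R *: E k k.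
have DE u lam : is_weight P u lam -> rho D u = ht lam *: u.
  move=> wu; rewrite /D rep_act_sum => [|k _]; last by rewrite rpredZ.
  rewrite sum_lfunE /ht scaler_suml; apply: eq_bigr => k _.
  by rewrite rep_actZ // scale_lfunE wu scalerA.
have htS lam i j : ht (fun k => lam k + eps C k i - eps C k j) = ht lam + 2 * (j%:R - i%:R).
  have hte i' : \sum_(k < n) - k%:R * eps C k i' = (rev_ord i')%:R - i'%:R.
    have [e|ne] := eqVneq i' (rev_ord i').
      rewrite -e subrr big1 // => k _.
      by rewrite /eps -[i' == rev_ord k](inj_eq rev_ord_inj) rev_ordK -e subrr mulr0.
    rewrite (bigD1 i') //= (bigD1 (rev_ord i')) 1?eq_sym //= big1 ?addr0 => [|k /andP[k1 k2]].
      by rewrite /eps eqxx rev_ordK (negbTE ne) eqxx subr0 sub0r mulr1 mulrN1 opprK addrC.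
    rewrite /eps eq_sym (negbTE k1) -{1}[i']rev_ordK (inj_eq rev_ord_inj) eq_sym (negbTE k2).
    by rewrite subrr mulr0.
  rewrite /ht; under eq_bigr => k _ do rewrite mulrBr mulrDr.
  rewrite sumrB big_split /= !hte.
  have revR i' : (rev_ord i')%:R = n%:R - i'%:R - 1 :> C.
    by rewrite /= natrB ?ltn_ord // -addn1 natrD opprD addrA.
  rewrite !revR; ring.
pose p := char_poly (VectorInternalTheory.f2mx (rho D)).
have p0 : p != 0 by rewrite monic_neq0 ?char_poly_monic.
(* If no singular vector existed, one could collect arbitrarily many distinct roots of the
   characteristic polynomial of [D]. *)
suff chain m : exists s u lam, [/\ size s = m, uniq s, all (root p) s,
    u \in U /\ u != 0 & is_weight P u lam /\ all (fun x => x < ht lam) s].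
  have [s [u [lam [sz us rs _ _]]]] := chain (size p).
  by have := max_poly_roots p0 rs us; rewrite sz ltnn.
elim: m => [|m [s [u [lam [sz us rs [Uu u0] [wu ls]]]]]].
  have [||u Uu [u0 eu]] := @lfun_joint_eigen C M _ (fun k => rho (E k k)) (enum 'I_n) _ U U0.
  - move=> i j v; rewrite rep_act_comm // ad_cartan //.
    by rewrite /eps subrr scale0r rep_act0 zero_lfunE addr0.
  - by move=> i u Uu; apply: stU.
  have /choice [lam wu] k : exists a, rho (E k k) u = a *: u.
    have : k \in enum 'I_n by rewrite mem_enum.
    elim: (enum 'I_n) eu => //= i s IH [e eu]; rewrite inE => /orP[/eqP -> //|].
    exact: IH.
  by exists [::], u, lam.
have [i [j [ij Eu]]] : exists i j, (i < j)%N /\ rho (E i j) u != 0.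
  apply: contrapT => no'; apply: no; exists u => //; split=> //; exists lam => // i j ij.
  by apply/eqP/negPn/negP => h; apply: no'; exists i, j.
have ltht : ht lam < ht (fun k => lam k + eps C k i - eps C k j).
  by rewrite htS ltrDl mulr_gt0 ?ltr0n // subr_gt0 ltr_nat.
exists (ht lam :: s), (rho (E i j) u), (fun k => lam k + eps C k i - eps C k j).
split=> /=.
- by rewrite sz.
- rewrite us andbT; apply/negP => /(allP ls); by rewrite ltxx.
- by rewrite rs andbT (lfun_eigen_char u0 (DE _ _ wu)).
- by split=> //; apply: stU.
- split; first exact: is_weight_root.
  by rewrite ltht; apply/allP => x /(allP ls) h; apply: lt_trans ltht.
Qed.

Lemma form_orthogonal_stable (U : {vspace M}) A w : rep_stable U -> A \in so g ->
  (forall u, u \in U -> H w u = 0) -> forall u, u \in U -> H (rho A w) u = 0.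
Proof.
move=> stU hA wU u Uu; have [B hB ->] := form_adj hH hA.
by apply/wU/stU.
Qed.

Definition form_perp (U : {vspace M}) : {vspace M} :=
  subspace_of [set w : M | forall u, u \in U -> H w u = 0].

Lemma mem_form_perp (U : {vspace M}) w :
  w \in form_perp U <-> forall u, u \in U -> H w u = 0.
Proof.
apply: mem_subspace_of => [u Uu|a u v Hu Hv w' Uw']; first exact: cform0l.
by rewrite (form_linear hH) Hu // Hv // mulr0 addr0.
Qed.

Lemma form_perp_stable (U : {vspace M}) : rep_stable U -> rep_stable (form_perp U).
Proof.
move=> stU A hA w /mem_form_perp wU; apply/mem_form_perp.
exact: form_orthogonal_stable.
Qed.

Lemma rep_stable_cap (U W : {vspace M}) :
  rep_stable U -> rep_stable W -> rep_stable (U :&: W)%VS.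
Proof.
move=> stU stW A hA u; rewrite memv_cap => /andP[Uu Wu].
by rewrite memv_cap stU ?stW.
Qed.

Section Decomposition.
Variables (Z : 'End(M)) (I : finType) (v_ : I -> M) (c : I -> C).
Hypothesis ZC : forall A, A \in so g -> forall v, rho A (Z v) = Z (rho A v).
Hypothesis v0 : forall s, v_ s != 0.
Hypothesis Zv : forall s, Z (v_ s) = c s *: v_ s.
Hypothesis c_inj : injective c.
Hypothesis classification : forall u lam, u != 0 -> is_weight P u lam ->
  is_singular P u -> exists s a, u = a *: v_ s.
Local Notation W s := (lker (Z - c s *: \1%VF)).

Let memW s w : reflect (Z w = c s *: w) (w \in W s).
Proof. by apply: (iffP eqlfunP); rewrite scale_lfunE id_lfunE. Qed.

Let stW s : rep_stable (W s).
Proof. exact: rep_stable_eigenspace. Qed.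

Let singular_in s (U : {vspace M}) : rep_stable U -> (U <= W s)%VS -> U != 0%VS ->
  v_ s \in U.
Proof.
move=> stU UW U0; have [u Uu [u0 [lam wu su]]] := singular_exists stU U0.
have [t [a ua]] := classification u0 wu su.
have a0 : a != 0 by apply: contra u0 => /eqP a0; rewrite ua a0 scale0r.
have ct : c t = c s.
  have /memW := subvP UW _ Uu; rewrite ua linearZ /= Zv !scalerA mulrC => /(scaler_injr (v0 t)).
  by rewrite [c s * a]mulrC ![_ * a]mulrC => /(mulfI a0).
by have := Uu; rewrite ua (c_inj ct) rpredZeq (negbTE a0).
Qed.

(** A nonzero stable subspace of the eigenspace has a singular vector, necessarily a multiple of
    [v_ s] as the scalars c are distinct. If [U] were proper, its orthogonal complement in the
    eigenspace would contain [v_ s] too, against positivity. *)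
Lemma eigenspace_simple s (U : {vspace M}) : (U <= W s)%VS -> rep_stable U ->
  U != 0%VS -> (W s <= U)%VS.
Proof.
move=> UW stU U0; apply: form_orthogonal => // w Ww wU.
pose U' := (form_perp U :&: W s)%VS.
have [U'0|U'0] := eqVneq U' 0%VS.
  by apply/eqP; rewrite -memv0 -U'0 memv_cap Ww andbT; apply/mem_form_perp.
have stU' : rep_stable U' by apply: rep_stable_cap => //; apply: form_perp_stable.
have := singular_in stU' (capvSr _ _) U'0; rewrite memv_cap => /andP[/mem_form_perp vU _].
by have /(form_def hH) /eqP := vU _ (singular_in stU UW U0); rewrite (negbTE (v0 s)).
Qed.

(** A nonzero orthogonal complement of the sum would contain a singular vector, which lies in one of
    the eigenspaces and would be orthogonal to itself. *)
Lemma eigenspace_sum : (\sum_s W s)%VS = fullv.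
Proof.
apply/eqP; rewrite eqEsubv subvf; apply: form_orthogonal => [|w _ wU]; first exact: subvf.
pose U' := form_perp (\sum_s W s)%VS.
have [U'0|U'0] := eqVneq U' 0%VS.
  by apply/eqP; rewrite -memv0 -U'0; apply/mem_form_perp.
have stU' : rep_stable U' by apply/form_perp_stable/rep_stable_sum.
have [u Uu [u0 [lam wu su]]] := singular_exists stU' U'0.
have [t [a ua]] := classification u0 wu su.
have Wu : u \in (\sum_s W s)%VS.
  by rewrite ua rpredZ // (subvP (sumv_sup t _ (subvv _))) //; apply/memW.
by move/mem_form_perp: Uu => /(_ _ Wu) /(form_def hH) /eqP; rewrite (negbTE u0).
Qed.

End Decomposition.
End HighestWeightTheory.

(** * Elements of the module as trilinear maps with values in so(g) *)

Section NablaCurvature.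
Variables (F : fieldType) (n : nat) (g : 'M[F]_n).
Local Notation V := 'cV[F]_n.
Implicit Types (X Y Z W : V).

Definition nabla_rep := rep_nabla_curvature (so_lie_closed (g := g)).
Implicit Types (u v : nabla_rep).

Definition nab u X Y Z : 'M[F]_n := (vsval u : 'Hom(V, 'Hom(V, 'Hom(V, 'M[F]_n)))) X Y Z.

Let nab_prop u : is_nabla_curvature (so g) (vsval u).
Proof. exact/mem_nabla_curvature_space/subvsP. Qed.

Let curvP u X : is_curvature (so g) ((vsval u : 'Hom(V, 'Hom(V, 'Hom(V, 'M[F]_n)))) X).
Proof. by apply/mem_curvature_space; have [h _] := nab_prop u. Qed.

Lemma nab_so u X Y Z : nab u X Y Z \in so g.
Proof. by have [h _ _] := curvP u X; exact: h. Qed.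

Lemma nabxx u X Y : nab u X Y Y = 0.
Proof. by have [_ h _] := curvP u X; exact: h. Qed.

Lemma nab_bianchi1 u X Y Z W :
  nab u X Y Z *m W + nab u X Z W *m Y + nab u X W Y *m Z = 0.
Proof. by have [_ _ h] := curvP u X; exact: h. Qed.

Lemma nab_bianchi2 u X Y Z : nab u X Y Z + nab u Y Z X + nab u Z X Y = 0.
Proof. by have [_ h] := nab_prop u; exact: h. Qed.

Lemma nabP1 u a X X' Y Z : nab u (a *: X + X') Y Z = a *: nab u X Y Z + nab u X' Y Z.
Proof. by rewrite /nab linearP /= !(add_lfunE, scale_lfunE). Qed.
Lemma nabP2 u a X X' Y Z : nab u Y (a *: X + X') Z = a *: nab u Y X Z + nab u Y X' Z.
Proof. by rewrite /nab linearP /= !(add_lfunE, scale_lfunE). Qed.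
Lemma nabP3 u a X X' Y Z : nab u Y Z (a *: X + X') = a *: nab u Y Z X + nab u Y Z X'.
Proof. by rewrite /nab linearP. Qed.
Lemma nabP u a v X Y Z : nab (a *: u + v) X Y Z = a *: nab u X Y Z + nab v X Y Z.
Proof. by rewrite /nab linearP /= !(add_lfunE, scale_lfunE). Qed.

Lemma nabC u X Y Z : nab u X Z Y = - nab u X Y Z.
Proof.
apply/eqP; rewrite -addr_eq0; apply/eqP; have := nabxx u X (1 *: Y + Z).
by rewrite nabP2 !nabP3 !nabxx !scale1r add0r addr0 addrC.
Qed.

Lemma nab_act u A X Y Z : A \in so g ->
  nab (rep_act nabla_rep A u) X Y Z = ad_fun A (nab u X Y Z) -
    nab u X Y (A *m Z) - nab u X (A *m Y) Z - nab u (A *m X) Y Z.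
Proof.
move=> hA; rewrite /nab (sub_actE (nabla_curvature_space_stable (@so_lie_closed _ _ g)) hA).
have E0 : (rep_act (rep_hom3 (so g)) A (vsval u) : 'Hom(V, 'Hom(V, 'Hom(V, 'M[F]_n)))) X =
    rep_act (rep_hom (rep_std (so g)) (rep_hom (rep_std (so g)) (rep_gl (so g)))) A (vsval u X)
    - vsval u (A *m X).
  by rewrite -[A *m X]lfunE; exact: (hom_actE (V := rep_std (so g))
    (W := rep_hom (rep_std (so g)) (rep_hom (rep_std (so g)) (rep_gl (so g)))) A (vsval u) X).
by rewrite E0 !(add_lfunE, opp_lfunE) curvature_actE.
Qed.

Lemma nab_inj u v : (forall X Y Z, nab u X Y Z = nab v X Y Z) -> u = v.
Proof.
move=> E; apply: val_inj; apply/lfunP => X; apply/lfunP => Y; apply/lfunP => Z.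
exact: E.
Qed.

Lemma nab_make (s : V -> V -> V -> 'M[F]_n) :
  (forall a X X' Y Z, s (a *: X + X') Y Z = a *: s X Y Z + s X' Y Z) ->
  (forall a X X' Y Z, s Y (a *: X + X') Z = a *: s Y X Z + s Y X' Z) ->
  (forall a X X' Y Z, s Y Z (a *: X + X') = a *: s Y Z X + s Y Z X') ->
  (forall X Y Z, s X Y Z \in so g) -> (forall X Y, s X Y Y = 0) ->
  (forall X Y Z W, s X Y Z *m W + s X Z W *m Y + s X W Y *m Z = 0) ->
  (forall X Y Z, s X Y Z + s Y Z X + s Z X Y = 0) ->
  exists u, forall X Y Z, nab u X Y Z = s X Y Z.
Proof.
move=> s1 s2 s3 sso sxx b1 b2.
have l3 X Y : linear (s X Y) by move=> a Z Z'; rewrite s3.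
pose L3 X Y : {linear V -> 'M[F]_n} := HB.pack (s X Y) (GRing.isLinear.Build _ _ _ _ (s X Y) (l3 X Y)).
pose t2 X Y : 'Hom(V, 'M[F]_n) := linfun (L3 X Y).
have t2E X Y Z : t2 X Y Z = s X Y Z by rewrite lfunE.
have l2 X : linear (t2 X).
  by move=> a Y Y'; apply/lfunP => Z; rewrite add_lfunE scale_lfunE !t2E s2.
pose L2 X : {linear V -> 'Hom(V, 'M[F]_n)} := HB.pack (t2 X) (GRing.isLinear.Build _ _ _ _ (t2 X) (l2 X)).
pose t1 X : 'Hom(V, 'Hom(V, 'M[F]_n)) := linfun (L2 X).
have t1E X Y Z : t1 X Y Z = s X Y Z by rewrite [t1 X Y]lfunE t2E.
have l1 : linear t1.
  move=> a X X'; apply/lfunP => Y; apply/lfunP => Z.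
  by rewrite !(add_lfunE, scale_lfunE) !t1E s1.
pose L1 : {linear V -> 'Hom(V, 'Hom(V, 'M[F]_n))} := HB.pack t1 (GRing.isLinear.Build _ _ _ _ t1 l1).
pose S := linfun L1.
have SE X Y Z : S X Y Z = s X Y Z by rewrite [S X]lfunE t1E.
have hS : S \in nabla_curvature_space (so g).
  apply/mem_nabla_curvature_space; split=> [X|X Y Z]; last by rewrite !SE.
  by apply/mem_curvature_space; split=> [Y Z|Y|Y Z W]; rewrite !SE.
exists (vsproj _ S) => X Y Z; by rewrite /nab vsprojK.
Qed.

End NablaCurvature.

(** * Matrices written in a Witt basis *)

Section WittCoordinates.
Variables (F : fieldType) (n : nat) (g P : 'M[F]_n).
Hypothesis hP : is_witt_basis g P.
Local Notation b i := (col i P).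
Implicit Types i j k l : 'I_n.

Definition crd (A : 'M[F]_n) : 'M[F]_n := locked_with lock_key (invmx P *m A *m P).

Lemma crd_def A : crd A = invmx P *m A *m P.
Proof. by rewrite /crd unlock. Qed.

Lemma crdK A : P *m crd A *m invmx P = A.
Proof. by rewrite !crd_def !mulmxA mulmxV ?mul1mx ?mulmxK // (witt_unit hP). Qed.

Lemma crdVK A : crd (P *m A *m invmx P) = A.
Proof. by rewrite !crd_def !mulmxA mulVmx ?mul1mx ?mulmxKV // (witt_unit hP). Qed.

Lemma crd_linear : linear crd.
Proof.
by move=> a A B; rewrite !crd_def mulmxDr mulmxDl -scalemxAr -scalemxAl.
Qed.

Lemma crdM A B : crd (A *m B) = crd A *m crd B.
Proof. by rewrite !crd_def !mulmxA mulmxK // (witt_unit hP). Qed.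

Lemma mul_col_witt A k : A *m b k = \sum_l crd A l k *: b l.
Proof.
rewrite -{1}(crdK A) colE -mulmxA mulKmx ?(witt_unit hP) // -mulmxA.
rewrite -colE [col k _]col_sum_delta mulmx_sumr; apply: eq_bigr => l _.
by rewrite -scalemxAr -colE !mxE.
Qed.

Lemma witt_expand (X : 'cV[F]_n) : X = \sum_l (invmx P *m X) l 0 *: b l.
Proof.
rewrite -{1}(mulKVmx (witt_unit hP) X) {1}[invmx P *m X]col_sum_delta mulmx_sumr.
by apply: eq_bigr => l _; rewrite -scalemxAr -colE.
Qed.

Lemma crd_eqP (A B : 'M[F]_n) : (forall k, A *m b k = B *m b k) -> A = B.
Proof.
move=> E; apply: mulmx_ext => X; rewrite (witt_expand X) !mulmx_sumr.
by apply: eq_bigr => l _; rewrite -!scalemxAr E.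
Qed.

(** The Gram matrix of the basis is antidiagonal, so skewness for g becomes antisymmetry under
    reflection in the antidiagonal. *)
Lemma so_crd A : (forall i j, crd A (rev_ord j) i = - crd A (rev_ord i) j) <-> A \in so g.
Proof.
have PU := witt_unit hP; have PTU : P^T \in unitmx by rewrite unitmx_tr.
have E : P^T *m (A^T *m g + g *m A) *m P =
    (crd A)^T *m (P^T *m g *m P) + (P^T *m g *m P) *m crd A.
  rewrite mulmxDr mulmxDl; congr (_ + _).
    by rewrite !crd_def !trmx_mul !mulmxA trmx_inv mulmxKV // unitmx_tr.
  by rewrite !crd_def !mulmxA mulmxK.
have JE i j : (P^T *m g *m P) i j = (j == rev_ord i)%:R.
  by rewrite hP mxE ord_sum_rev.
have E' i j : (P^T *m (A^T *m g + g *m A) *m P) i j = crd A (rev_ord j) i + crd A (rev_ord i) j.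
  rewrite E mxE [X in X + _]mxE [X in _ + X]mxE (bigD1 (rev_ord j)) //= big1 ?addr0 => [|k kj].
    rewrite JE rev_ordK eqxx mulr1 mxE; congr (_ + _).
    rewrite (bigD1 (rev_ord i)) //= big1 ?addr0 => [|k ki]; first by rewrite JE eqxx mul1r.
    by rewrite JE (negbTE ki) mul0r.
  by rewrite JE -{1}[j]rev_ordK (inj_eq rev_ord_inj) eq_sym (negbTE kj) mulr0.
split=> [h|/mem_so h i j].
  apply/mem_so; apply: (can_inj (mulKmx PTU)); apply: (can_inj (mulmxK PU)).
  by apply/matrixP => i j; rewrite E' h addNr mulmx0 mul0mx mxE.
by apply/eqP; rewrite -addr_eq0 -E' h mulmx0 mul0mx mxE.
Qed.

Lemma crd_root_elt i j l k :
  crd (root_elt g P i j) l k = ((l == i) && (k == j))%:R - ((k == rev_ord i) && (l == rev_ord j))%:R.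
Proof.
have : crd (root_elt g P i j) = delta_mx i j - delta_mx (rev_ord j) (rev_ord i).
  rewrite -[RHS]crdVK; congr crd; apply: crd_eqP => k'; rewrite root_eltE //.
  rewrite [in RHS]colE -mulmxA mulKmx ?(witt_unit hP) // -mulmxA.
  rewrite mulmxBl !mul_delta_mx_cond -!scaler_nat mulmxBr -!scalemxAr -!colE.
  by rewrite [k' == j]eq_sym [k' == rev_ord i]eq_sym.
by move=> ->; rewrite !mxE [(l == rev_ord j) && _]andbC.
Qed.

Lemma nab_witt (u v : nabla_rep g) :
  (forall i j k, nab u (b i) (b j) (b k) = nab v (b i) (b j) (b k)) -> u = v.
Proof.
have tri (s s' : 'cV[F]_n -> 'M[F]_n) :
    (forall a X X', s (a *: X + X') = a *: s X + s X') ->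
    (forall a X X', s' (a *: X + X') = a *: s' X + s' X') ->
    (forall i, s (b i) = s' (b i)) -> forall X, s X = s' X.
  move=> sl sl' E X; rewrite (witt_expand X).
  elim: (index_enum _) => [|i r IH]; last by rewrite !big_cons sl sl' E IH.
  rewrite !big_nil; have := sl 1 0 0; have := sl' 1 0 0.
  rewrite !scale1r !addr0 => /esym/eqP; rewrite -subr_eq0 addrK => /eqP ->.
  by move=> /esym/eqP; rewrite -subr_eq0 addrK => /eqP.
move=> E; apply: nab_inj => X Y Z.
apply: (tri (fun X => nab u X Y Z) (fun X => nab v X Y Z)) X => [???|???|i]; rewrite ?nabP1 //.
apply: (tri (fun Y => nab u _ Y Z) (fun Y => nab v _ Y Z)) Y => [???|???|j]; rewrite ?nabP2 //.
by apply: (tri (nab u _ _) (nab v _ _)) Z => [???|???|k]; rewrite ?nabP3.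
Qed.

End WittCoordinates.

(** * Rearrangement of triple sums *)

Section TripleSum.
Variables (C : pzRingType) (n : nat).
Implicit Types f : 'I_n -> 'I_n -> 'I_n -> C.

Lemma sum3_linear a f1 f2 f3 : (forall i j k, f1 i j k = a * f2 i j k + f3 i j k) ->
  \sum_i \sum_j \sum_k f1 i j k =
  a * \sum_i \sum_j \sum_k f2 i j k + \sum_i \sum_j \sum_k f3 i j k.
Proof.
move=> E; rewrite mulr_sumr -big_split; apply: eq_bigr => i _ /=.
rewrite mulr_sumr -big_split; apply: eq_bigr => j _ /=.
by rewrite mulr_sumr -big_split; apply: eq_bigr => k _ /=.
Qed.

Lemma sum3_sub f f1 f2 f3 f4 :
  (forall i j k, f i j k = f1 i j k - f2 i j k - f3 i j k - f4 i j k) ->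
  \sum_i \sum_j \sum_k f i j k =
  \sum_i \sum_j \sum_k f1 i j k - \sum_i \sum_j \sum_k f2 i j k
  - \sum_i \sum_j \sum_k f3 i j k - \sum_i \sum_j \sum_k f4 i j k.
Proof.
move=> E; rewrite -!sumrB; apply: eq_bigr => i _; rewrite -!sumrB; apply: eq_bigr => j _.
by rewrite -!sumrB; apply: eq_bigr.
Qed.

Lemma sub4_congr (a a' b b' c c' d d' : C) :
  a = a' -> b = b' -> c = c' -> d = d' -> a - b - c - d = a' - b' - c' - d'.
Proof. by move=> -> -> -> ->. Qed.

Lemma sum3_rot f :
  \sum_i \sum_j \sum_k f i j k = \sum_j \sum_k \sum_i f i j k.
Proof. by rewrite exchange_big; apply: eq_bigr => j _; rewrite exchange_big. Qed.

End TripleSum.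

(** * The contravariant form on the module *)

Section HermitianForm.
Variables (C : numClosedFieldType) (n : nat) (g P : 'M[C]_n).
Hypothesis hP : is_witt_basis g P.
Local Notation b i := (col i P).
Local Notation crd := (crd P).
Implicit Types i j k l : 'I_n.
Implicit Types u v w : nabla_rep g.

Definition ctr (A : 'M[C]_n) : 'M[C]_n := (map_mx Num.conj A)^T.

Definition crd_form (A B : 'M[C]_n) : C := \tr (crd A *m ctr (crd B)).

(** The Hilbert-Schmidt form obtained by declaring the Witt basis orthonormal. *)
Definition nab_form u v : C :=
  \sum_i \sum_j \sum_k crd_form (nab u (b i) (b j) (b k)) (nab v (b i) (b j) (b k)).

(** The adjoint for the Hermitian form with the Witt basis orthonormal. Conjugate transposition
    respects antisymmetry about the antidiagonal, hence preserves so(g). *)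
Definition adj_elt (A : 'M[C]_n) : 'M[C]_n := P *m ctr (crd A) *m invmx P.

Lemma ctrE A i j : ctr A i j = (A j i)^*.
Proof. by rewrite !mxE. Qed.

Lemma ctrM A B : ctr (A *m B) = ctr B *m ctr A.
Proof. by rewrite /ctr map_mxM trmx_mul. Qed.

Lemma ctrK : involutive ctr.
Proof. by move=> A; apply/matrixP => i j; rewrite !mxE conjCK. Qed.

Lemma ctrB A B : ctr (A - B) = ctr A - ctr B.
Proof. by rewrite /ctr map_mxB linearB. Qed.

Lemma adj_elt_so A : A \in so g -> adj_elt A \in so g.
Proof.
move=> /(so_crd hP) hA; apply/(so_crd hP) => i j; rewrite /adj_elt (crdVK hP) !ctrE.
by have := hA (rev_ord j) (rev_ord i); rewrite !rev_ordK => ->; rewrite rmorphN.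
Qed.

Lemma adj_elt_root i j : adj_elt (root_elt g P i j) = root_elt g P j i.
Proof.
rewrite -[RHS](crdK hP); congr (_ *m _ *m _); apply/matrixP => k l.
by rewrite ctrE !(crd_root_elt hP) rmorphB /= !rmorph_nat andbC [(k == rev_ord i) && _]andbC.
Qed.

Lemma crd_form_linear a A A' B : crd_form (a *: A + A') B = a * crd_form A B + crd_form A' B.
Proof.
by rewrite /crd_form crd_linear mulmxDl -scalemxAl mxtraceD mxtraceZ.
Qed.

Lemma crd_form_conj A B : crd_form A B = (crd_form B A)^*.
Proof.
have tr_ctr X : \tr (ctr X) = (\tr X)^*.
  by rewrite /mxtrace rmorph_sum; apply: eq_bigr => i _; rewrite ctrE.
by rewrite /crd_form -[RHS]tr_ctr [ctr (_ *m ctr _)]ctrM ctrK.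
Qed.

Lemma crd_form_sum A : crd_form A A = \sum_i \sum_j `|crd A i j| ^+ 2.
Proof.
rewrite /crd_form /mxtrace; apply: eq_bigr => i _; rewrite mxE.
by apply: eq_bigr => j _; rewrite ctrE normCK.
Qed.

Lemma crd_form_ad A X Y : crd_form (ad_fun A X) Y = crd_form X (ad_fun (adj_elt A) Y).
Proof.
have crdB : {morph crd : A B / A - B}.
  by move=> A' B'; rewrite -scaleN1r addrC crd_linear scaleN1r addrC.
have : crd (adj_elt A) = ctr (crd A) by rewrite /adj_elt (crdVK hP).
move: (adj_elt A) => B cB; rewrite /crd_form /ad_fun !crdB !(crdM hP) cB.
rewrite ctrB !ctrM ctrK mulmxBl mulmxBr !raddfB /= -mulmxA mxtrace_mulC -!mulmxA.
by [].
Qed.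

(** Orthonormality of the basis moves A, as its adjoint, from an argument of one linear map to the
    same argument of the other. *)
Let conj_sum_shift A (f f' : 'cV[C]_n -> 'M[C]_n) :
  (forall a X X', f (a *: X + X') = a *: f X + f X') ->
  (forall a X X', f' (a *: X + X') = a *: f' X + f' X') ->
  \sum_k crd_form (f (A *m b k)) (f' (b k)) =
  \sum_k crd_form (f (b k)) (f' (adj_elt A *m b k)).
Proof.
move=> fl fl'.
have lin0 (s : 'cV[C]_n -> 'M[C]_n) : (forall a X X', s (a *: X + X') = a *: s X + s X') -> s 0 = 0.
  move=> sl; have := sl 1 0 0; rewrite !scale1r !addr0 => /esym/eqP.
  by rewrite -subr_eq0 addrK => /eqP.
have fsum (s : 'cV[C]_n -> 'M[C]_n) (x : 'I_n -> C) :
    (forall a X X', s (a *: X + X') = a *: s X + s X') ->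
    s (\sum_l x l *: b l) = \sum_l x l *: s (b l).
  move=> sl; elim: (index_enum _) => [|i r IH]; first by rewrite !big_nil lin0.
  by rewrite !big_cons sl IH.
have Hsum (x : 'I_n -> C) (X : 'I_n -> 'M[C]_n) Y :
    crd_form (\sum_l x l *: X l) Y = \sum_l x l * crd_form (X l) Y.
  elim: (index_enum _) => [|i r IH]; last by rewrite !big_cons crd_form_linear IH.
  rewrite !big_nil; have := crd_form_linear 1 0 0 Y; rewrite scale1r addr0 mul1r => /esym/eqP.
  by rewrite -subr_eq0 addrK => /eqP.
under eq_bigr => k _ do rewrite (mul_col_witt hP) fsum // Hsum.
under [RHS]eq_bigr => k _ do
  rewrite crd_form_conj (mul_col_witt hP) fsum // Hsum rmorph_sum /=.
rewrite exchange_big /=; apply: eq_bigr => k _; apply: eq_bigr => l _.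
by rewrite (crdVK hP) ctrE rmorphM /= conjCK -crd_form_conj.
Qed.

Lemma nab_form_adj A u v : A \in so g ->
  nab_form (rep_act (nabla_rep g) A u) v = nab_form u (rep_act (nabla_rep g) (adj_elt A) v).
Proof.
move=> hA; have hB := adj_elt_so hA; rewrite /nab_form.
have Hl3 X1 X2 X3 X4 Y : crd_form (X1 - X2 - X3 - X4) Y =
    crd_form X1 Y - crd_form X2 Y - crd_form X3 Y - crd_form X4 Y.
  have HB X X' : crd_form (X - X') Y = crd_form X Y - crd_form X' Y.
    by rewrite -scaleN1r addrC crd_form_linear mulN1r addrC.
  by rewrite !HB.
have Hr3 X1 X2 X3 X4 Y : crd_form Y (X1 - X2 - X3 - X4) =
    crd_form Y X1 - crd_form Y X2 - crd_form Y X3 - crd_form Y X4.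
  by rewrite crd_form_conj Hl3 !rmorphB /= -!crd_form_conj.
rewrite (sum3_sub (fun i j k => etrans (congr1 (crd_form^~ _) (nab_act _ _ _ _ hA)) (Hl3 _ _ _ _ _))).
rewrite [RHS](sum3_sub (fun i j k => etrans (congr1 (crd_form _) (nab_act _ _ _ _ hB)) (Hr3 _ _ _ _ _))).
apply: sub4_congr.
- apply: eq_bigr => i _; apply: eq_bigr => j _; apply: eq_bigr => k _.
  exact: crd_form_ad.
- apply: eq_bigr => i _; apply: eq_bigr => j _.
  by apply: (conj_sum_shift A (f := nab u _ _) (f' := nab v _ _)) => ???; rewrite nabP3.
- apply: eq_bigr => i _; rewrite exchange_big [RHS]exchange_big /=; apply: eq_bigr => j _.
  by apply: (conj_sum_shift A (f := fun Y => nab u _ Y _) (f' := fun Y => nab v _ Y _)) => ???; rewrite nabP2.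
- rewrite sum3_rot [RHS]sum3_rot; apply: eq_bigr => i _; apply: eq_bigr => j _ /=.
  by apply: (conj_sum_shift A (f := fun Y => nab u Y _ _) (f' := fun Y => nab v Y _ _)) => ???; rewrite nabP1.
Qed.

Lemma nab_form_contravariant : contravariant_form P nab_form.
Proof.
have ge0 A : 0 <= crd_form A A.
  by rewrite crd_form_sum; do 2![apply: sumr_ge0 => ? _]; rewrite exprn_ge0.
split.
- by move=> a u v w; apply: sum3_linear => i j k; rewrite nabP crd_form_linear.
- move=> u v; rewrite /nab_form rmorph_sum; apply: eq_bigr => i _ /=.
  rewrite rmorph_sum; apply: eq_bigr => j _ /=.
  by rewrite rmorph_sum; apply: eq_bigr => k _ /=; apply: crd_form_conj.
- by move=> u; do 3![apply: sumr_ge0 => ? _]; apply: ge0.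
- move=> u /eqP; rewrite psumr_eq0 => [/allP h|i _]; last by do 2![apply: sumr_ge0 => ? _].
  apply: (nab_witt hP) => i j k.
  have /(_ i) := h; rewrite mem_index_enum => /(_ isT) /=.
  rewrite psumr_eq0 => [/allP h'|? _]; last by apply: sumr_ge0 => ? _.
  have /(_ j) := h'; rewrite mem_index_enum => /(_ isT) /=.
  rewrite psumr_eq0 => [/allP h2|? _]; last exact: ge0.
  have /(_ k) := h2; rewrite mem_index_enum => /(_ isT) /=.
  rewrite crd_form_sum psumr_eq0 => [/allP h3|? _]; last by apply: sumr_ge0 => ? _; rewrite exprn_ge0.
  have z : crd (nab u (b i) (b j) (b k)) = 0.
    apply/matrixP => a c; have /(_ a) := h3; rewrite mem_index_enum => /(_ isT) /=.
    rewrite psumr_eq0 => [/allP h4|? _]; last by rewrite exprn_ge0.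
    have /(_ c) := h4; rewrite mem_index_enum => /(_ isT) /=.
    by rewrite expf_eq0 normr_eq0 mxE => /eqP.
  by rewrite -[LHS](crdK hP) z mulmx0 mul0mx /nab linear0 !zero_lfunE.
- by move=> A hA; exists (adj_elt A); [apply: adj_elt_so|move=> u v; apply: nab_form_adj].
- move=> i j u v; apply: (etrans (nab_form_adj u v (root_elt_so hP i j))).
  by rewrite adj_elt_root.
Qed.

End HermitianForm.

(** * From curvature symmetries to symmetric forms of Young shape (3,2) *)

Section CurvatureSymmetries.
Variables (F : numFieldType) (V : lmodType F).
Variable s : V -> V -> V -> V -> V -> F.
Hypothesis s1 : forall a X X' Y Z U W, s (a *: X + X') Y Z U W = a * s X Y Z U W + s X' Y Z U W.
Hypothesis s2 : forall a X X' Y Z U W, s Y (a *: X + X') Z U W = a * s Y X Z U W + s Y X' Z U W.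
Hypothesis s3 : forall a X X' Y Z U W, s Y Z (a *: X + X') U W = a * s Y Z X U W + s Y Z X' U W.
Hypothesis s5 : forall a X X' Y Z U W, s Y Z U W (a *: X + X') = a * s Y Z U W X + s Y Z U W X'.
Hypothesis sC : forall X Y Z U W, s X Z Y U W = - s X Y Z U W.
Hypothesis sD : forall X Y Z U W, s X Y Z W U = - s X Y Z U W.
Hypothesis sB : forall X Y Z U W, s X Y Z U W + s X Z U Y W + s X U Y Z W = 0.
Hypothesis sB2 : forall X Y Z U W, s X Y Z U W + s Y Z X U W + s Z X Y U W = 0.

Lemma lin_solve (k x : F) : k * x = 0 -> k != 0 -> x = 0.
Proof. by move=> /eqP; rewrite mulf_eq0 => /orP[->//|/eqP]. Qed.

(** The classical argument: four instances of the first Bianchi identity, combined by skewness in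
    each pair, give twice the difference. *)
Lemma pair_symmetry X Y Z U W : s X U W Y Z = s X Y Z U W.
Proof.
have b1 : s X Y Z U W + s X Z U Y W - s X Y U Z W = 0.
  by rewrite -(sC X Y U) sB.
have b2 : - s X Z U Y W - s X U W Y Z + s X Z W Y U = 0.
  by rewrite -(sD X Z U) -(sD X U W) -[s X Z W Y U]opprK -(sD X Z W Y) -(sC X Z W) sB.
have b3 : s X U W Y Z + s X Y W Z U - s X Y U Z W = 0.
  by rewrite -(sD X Y U) -[s X Y W Z U]opprK -(sD X Y W) -(sC X Y W) sB.
have b4 : - s X Y W Z U - s X Y Z U W + s X Z W Y U = 0.
  by rewrite -(sC X Y W) -(sD X Y Z) sB.
apply/eqP; rewrite -subr_eq0; apply/eqP/(lin_solve (k := 2)); last by rewrite pnatr_eq0.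
set a := s X U W Y Z in b2 b3 *; set b := s X Y Z U W in b1 b4 *.
have -> : 2 * (a - b) = (a + s X Y W Z U - s X Y U Z W) + (- s X Y W Z U - b + s X Z W Y U)
   - (b + s X Z U Y W - s X Y U Z W) - (- s X Z U Y W - a + s X Z W Y U) by ring.
by rewrite b1 b2 b3 b4 !subr0 addr0.
Qed.

(** Symmetrisation over the x and over the y, passing from the alternating to the symmetric model of
    the shape (3,2); pair symmetry makes these six terms symmetric in all three x. *)
Definition sym_form x1 x2 x3 y1 y2 : F :=
  s x1 x2 y1 y2 x3 + s x1 x2 y2 y1 x3 + (s x2 x3 y1 y2 x1 + s x2 x3 y2 y1 x1)
  + (s x3 x1 y1 y2 x2 + s x3 x1 y2 y1 x2).

Let pairC X x1 x3 y1 y2 : s X x1 y1 y2 x3 = s X x3 y2 y1 x1.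
Proof. by rewrite pair_symmetry sC sD opprK. Qed.

Lemma sym_form12 x1 x2 x3 y1 y2 : sym_form x2 x1 x3 y1 y2 = sym_form x1 x2 x3 y1 y2.
Proof.
rewrite /sym_form (pairC x2 x1 x3) (pairC x2 x1 x3) (pairC x1 x3 x2) (pairC x1 x3 x2).
rewrite (pairC x3 x2 x1) (pairC x3 x2 x1); ring.
Qed.

Lemma sym_form_rot x1 x2 x3 y1 y2 : sym_form x2 x3 x1 y1 y2 = sym_form x1 x2 x3 y1 y2.
Proof. by rewrite /sym_form; ring. Qed.

Lemma sym_form45 x1 x2 x3 y1 y2 : sym_form x1 x2 x3 y2 y1 = sym_form x1 x2 x3 y1 y2.
Proof. by rewrite /sym_form; ring. Qed.

Lemma sym_form23 x1 x2 x3 y1 y2 : sym_form x1 x3 x2 y1 y2 = sym_form x1 x2 x3 y1 y2.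
Proof. by rewrite sym_form12 -sym_form_rot sym_form12 sym_form_rot -sym_form12 sym_form_rot. Qed.

Lemma sym_formP1 a x x' x2 x3 y1 y2 :
  sym_form (a *: x + x') x2 x3 y1 y2 = a * sym_form x x2 x3 y1 y2 + sym_form x' x2 x3 y1 y2.
Proof. by rewrite /sym_form !s1 !s2 !s5; ring. Qed.

(** This relation, that symmetrising over four arguments gives zero, is what characterises the
    symmetric model of the shape (3,2). *)
Lemma sym_form_cycle x1 x2 x3 x4 y :
  sym_form x1 x2 x3 x4 y + sym_form x2 x3 x4 x1 y + sym_form x3 x4 x1 x2 y
  + sym_form x4 x1 x2 x3 y = 0.
Proof.
(* Pair symmetry brings [y] to the fourth argument slot, after which skewness orders the second and
   third and everything cancels. *)
have p a b d c : s a b y d c = s a c d y b by rewrite pairC.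
rewrite /sym_form !p.
have q a b d c : s a d b y c = - s a b d y c by rewrite sC.
rewrite (q x1 x2 x3 x4)
  (q x1 x2 x4 x3)
  (q x1 x3 x4 x2)
  (q x2 x1 x3 x4)
  (q x2 x1 x4 x3)
  (q x2 x3 x4 x1)
  (q x3 x1 x2 x4)
  (q x3 x1 x4 x2)
  (q x3 x2 x4 x1)
  (q x4 x1 x2 x3)
  (q x4 x1 x3 x2)
  (q x4 x2 x3 x1).
ring.
Qed.

(** The analogue of recovering a curvature tensor from its sectional curvatures: the diagonal values
    s(z,x,y,y,x) vanish, polarisation makes s skew in its last four arguments, and the first Bianchi
    identity finishes. *)
Lemma sym_form_eq0 : (forall x1 x2 x3 y1 y2, sym_form x1 x2 x3 y1 y2 = 0) ->
  forall X Y Z U W, s X Y Z U W = 0.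
Proof.
move=> T0.
have two0 : (2 : F) != 0 by rewrite pnatr_eq0.
have half z x y : s x z y y x = - (2^-1 * s z x y y x).
  have := T0 z x x y y; rewrite /sym_form (pairC x x z).
  rewrite (_ : _ + _ = 2 * s z x y y x + 4 * s x z y y x); last by ring.
  move=> h; apply/eqP; rewrite -addr_eq0; apply/eqP/(lin_solve (k := 4)); last by rewrite pnatr_eq0.
  by rewrite -h; field.
(* The second Bianchi identity turns the two [half] relations into 2 s(z,x,y,y,x) = 0. *)
have K0 z x y : s z x y y x = 0.
  have h1 := half z x y; have h2 := half z y x.
  have b := sB2 z x y y x.
  have e1 : s x y z y x = - s x z y y x by rewrite sC.
  have e2 : s y z x y x = - s y z x x y by rewrite sD.
  have e3 : s z y x x y = s z x y y x by rewrite sC sD opprK.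
  move: b; rewrite e1 e2 h1 h2 e3 => b; apply: (lin_solve (k := 2)) => //.
  by rewrite -[RHS]b; field.
have r1 z x y w : s z x y w x = 0.
  have : s z x (1 *: y + w) (1 *: y + w) x = 0 by [].
  have s4 a X X' Y Z U W : s Y Z U (a *: X + X') W = a * s Y Z U X W + s Y Z U X' W.
    by rewrite sD s5 opprD -mulrN -!sD.
  rewrite s3 !s4 !K0 mulr0 addr0 add0r !mul1r (pairC z x x w y) => h.
  by apply: (lin_solve (k := 2)) => //; rewrite -h; ring.
have r14 z x y w v : s z v y w x = - s z x y w v.
  have : s z (1 *: x + v) y w (1 *: x + v) = 0 by [].
  by rewrite s2 !s5 !r1 mulr0 addr0 add0r !mul1r => /eqP; rewrite addrC addr_eq0 => /eqP.
have r13 z a b c d : s z c b a d = - s z a b c d.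
  by rewrite sD r14 opprK sD.
(* By skewness in the last four arguments the three terms of the first Bianchi identity coincide. *)
move=> X Y Z U W; apply: (lin_solve (k := 3)); last by rewrite pnatr_eq0.
have e1 : s X Z U Y W = s X Y Z U W by rewrite r13 sC opprK r13 sC opprK.
have e2 : s X U Y Z W = s X Y Z U W by rewrite sC r13 opprK.
by rewrite -[RHS](sB X Y Z U W) e1 e2; ring.
Qed.

End CurvatureSymmetries.

(** * Symmetric forms invariant under null rotations *)

Section SymmetricForms.
Variables (F : numFieldType) (V : lmodType F).
Variable T : V -> V -> V -> V -> V -> F.
Hypothesis TP1 : forall a x x' x2 x3 y1 y2,
  T (a *: x + x') x2 x3 y1 y2 = a * T x x2 x3 y1 y2 + T x' x2 x3 y1 y2.
Hypothesis TP4 : forall a y y' x1 x2 x3 y2,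
  T x1 x2 x3 (a *: y + y') y2 = a * T x1 x2 x3 y y2 + T x1 x2 x3 y' y2.
Hypothesis T12 : forall x1 x2 x3 y1 y2, T x2 x1 x3 y1 y2 = T x1 x2 x3 y1 y2.
Hypothesis T23 : forall x1 x2 x3 y1 y2, T x1 x3 x2 y1 y2 = T x1 x2 x3 y1 y2.
Hypothesis T45 : forall x1 x2 x3 y1 y2, T x1 x2 x3 y2 y1 = T x1 x2 x3 y1 y2.
Hypothesis Tcyc : forall x1 x2 x3 x4 y,
  T x1 x2 x3 x4 y + T x2 x3 x4 x1 y + T x3 x4 x1 x2 y + T x4 x1 x2 x3 y = 0.

Definition invariant_under (A : V -> V) := forall x1 x2 x3 y1 y2,
  T (A x1) x2 x3 y1 y2 + T x1 (A x2) x3 y1 y2 + T x1 x2 (A x3) y1 y2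
  + T x1 x2 x3 (A y1) y2 + T x1 x2 x3 y1 (A y2) = 0.

Lemma T0 i x2 x3 y1 y2 (c := nth 0 [:: 0]) : T (c i) x2 x3 y1 y2 = 0.
Proof.
have -> : c i = 0 by case: i => [|[|i]].
by have := TP1 1 0 0 x2 x3 y1 y2; rewrite scale1r addr0 mul1r => /esym/eqP; rewrite -subr_eq0 addrK => /eqP.
Qed.

Lemma T01 x2 x3 y1 y2 : T 0 x2 x3 y1 y2 = 0.
Proof. exact: (T0 0). Qed.
Lemma T02 x2 x3 y1 y2 : T x2 0 x3 y1 y2 = 0.
Proof. by rewrite T12 T01. Qed.
Lemma T03 x2 x3 y1 y2 : T x2 x3 0 y1 y2 = 0.
Proof. by rewrite T23 T02. Qed.
Lemma T04 x2 x3 y1 y2 : T y1 x2 x3 0 y2 = 0.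
Proof.
by have := TP4 1 0 0 y1 x2 x3 y2; rewrite scale1r addr0 mul1r => /esym/eqP; rewrite -subr_eq0 addrK => /eqP.
Qed.
Lemma T05 x2 x3 y1 y2 : T y1 x2 x3 y2 0 = 0.
Proof. by rewrite T45 T04. Qed.

Lemma TZ1 a x x2 x3 y1 y2 : T (a *: x) x2 x3 y1 y2 = a * T x x2 x3 y1 y2.
Proof. by rewrite -[a *: x]addr0 TP1 T01 addr0. Qed.
Lemma TZ2 a x x2 x3 y1 y2 : T x2 (a *: x) x3 y1 y2 = a * T x2 x x3 y1 y2.
Proof. by rewrite T12 TZ1 T12. Qed.
Lemma TZ3 a x x2 x3 y1 y2 : T x2 x3 (a *: x) y1 y2 = a * T x2 x3 x y1 y2.
Proof. by rewrite T23 TZ2 T23. Qed.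
Lemma TZ4 a x x1 x2 x3 y2 : T x1 x2 x3 (a *: x) y2 = a * T x1 x2 x3 x y2.
Proof. by rewrite -[a *: x]addr0 TP4 T04 addr0. Qed.
Lemma TZ5 a x x1 x2 x3 y2 : T x1 x2 x3 y2 (a *: x) = a * T x1 x2 x3 y2 x.
Proof. by rewrite T45 TZ4 T45. Qed.

Lemma TN1 x x2 x3 y1 y2 : T (- x) x2 x3 y1 y2 = - T x x2 x3 y1 y2.
Proof. by rewrite -scaleN1r TZ1 mulN1r. Qed.
Lemma TN2 x x2 x3 y1 y2 : T x2 (- x) x3 y1 y2 = - T x2 x x3 y1 y2.
Proof. by rewrite -scaleN1r TZ2 mulN1r. Qed.
Lemma TN3 x x2 x3 y1 y2 : T x2 x3 (- x) y1 y2 = - T x2 x3 x y1 y2.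
Proof. by rewrite -scaleN1r TZ3 mulN1r. Qed.
Lemma TN4 x x2 x3 y1 y2 : T x2 x3 y1 (- x) y2 = - T x2 x3 y1 x y2.
Proof. by rewrite -scaleN1r TZ4 mulN1r. Qed.
Lemma TN5 x x2 x3 y1 y2 : T x2 x3 y1 y2 (- x) = - T x2 x3 y1 y2 x.
Proof. by rewrite -scaleN1r TZ5 mulN1r. Qed.

Lemma TD1 x x' x2 x3 y1 y2 : T (x + x') x2 x3 y1 y2 = T x x2 x3 y1 y2 + T x' x2 x3 y1 y2.
Proof. by rewrite -[x]scale1r TP1 mul1r scale1r. Qed.
Lemma TD4 x x' x2 x3 y1 y2 : T x2 x3 y1 (x + x') y2 = T x2 x3 y1 x y2 + T x2 x3 y1 x' y2.
Proof. by rewrite -[x]scale1r TP4 mul1r scale1r. Qed.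

Lemma TD2 x x' x2 x3 y1 y2 : T x2 (x + x') x3 y1 y2 = T x2 x x3 y1 y2 + T x2 x' x3 y1 y2.
Proof. by rewrite !(T12 _ x2) TD1. Qed.
Lemma TD3 x x' x2 x3 y1 y2 : T x2 x3 (x + x') y1 y2 = T x2 x3 x y1 y2 + T x2 x3 x' y1 y2.
Proof. by rewrite !(T23 x2 _ x3) TD2. Qed.
Lemma TD5 x x' x2 x3 y1 y2 : T x2 x3 y1 y2 (x + x') = T x2 x3 y1 y2 x + T x2 x3 y1 y2 x'.
Proof. by rewrite !(T45 _ _ _ _ y2) TD4. Qed.

Lemma invariant_underD A B : invariant_under A -> invariant_under B ->
  invariant_under (fun x => A x + B x).
Proof.
move=> iA iB x1 x2 x3 y1 y2.
rewrite !(TD1, TD2, TD3, TD4, TD5) -[RHS](addr0 0) -{1}(iA x1 x2 x3 y1 y2) -(iB x1 x2 x3 y1 y2).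
ring.
Qed.

Let Tz := (T01, T02, T03, T04, T05, TN1, TN2, TN3, TN4, TN5, TZ1, TZ2, TZ3, TZ4, TZ5).

Section NullRotation.
Variables (o N : V).

(** Three invariance equations under A and four cyclic relations form a linear system in eight
    coefficients on the span of N, o, e; eliminating all but two leaves this relation. *)
Lemma null_rotation_relation A e (d : F) : invariant_under A ->
  A o = 0 -> A N = - e -> A e = d *: o -> d != 0 ->
  3 * T N N o e e = - (2 * d * T N N N o o).
Proof.
move=> iA Ao AN Ae d0.
have h1 := iA N N N o e; have h2 := iA e N N e e; have h3 := iA e e e N N.
have c1 := Tcyc e e e N e; have c2 := Tcyc o e e N N.
have c3 := Tcyc e e N N o; have c4 := Tcyc o e N N e.
rewrite !(Ao, AN, Ae, Tz) in h1 h2 h3.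
(* Arguments are sorted in the order N, o, e within each symmetric group, so that equal coefficients
   become syntactically equal. *)
pose srt := (T12 N o, T12 N e, T12 o e, (fun x => T23 x N o), (fun x => T23 x N e),
  (fun x => T23 x o e), (fun x y z => T45 x y z N o), (fun x y z => T45 x y z N e),
  (fun x y z => T45 x y z o e)).
rewrite !srt in h1 h2 h3 c1 c2 c3 c4.
have k0 : - (4 * d) != 0 by rewrite oppr_eq0 mulf_neq0 // pnatr_eq0.
apply/eqP; rewrite -addr_eq0; apply/eqP/(lin_solve _ k0).
move: (T N N N o o) (T N N o e e) (T e e e N e) (T N e e e e) (T N N e o e) (T N e e N o)
  (T N o e N e) (T o e e N N) => u0 u1 a b x1 x2 x3 x4 in h1 h2 h3 c1 c2 c3 c4 *.
(* The multipliers are those that eliminate the six auxiliary coefficients from the seven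
   equations. *)
have -> : - (4 * d) * (3 * u1 + 2 * d * u0) =
    6 * d * (x4 + x2 + x3 + x3) - 2 * (d * x4 + d * x4 + d * x4 - a - a)
    - 4 * (a + b + b + b) - 6 * (d * u1 - b - b + d * x1 + d * x1)
    - 3 * d * (x2 + x1 + x1 + x2) - 6 * d * (x3 + x1 + u1 + x3)
    - 8 * d * (- x1 - x1 - x1 + 0 + d * u0) by ring.
by rewrite c2 h3 c1 h2 c3 c4 h1 !mulr0 !subr0.
Qed.

(* Let [mid] be the middle part of the space: invariance under the null
   rotations [A z] propagates the vanishing of [T] from the plane [<o, N>]. *)
Section Propagation.
Variables (mid : V -> Prop) (A : V -> V -> V) (d : V -> V -> F).
Hypothesis iA : forall z, mid z -> invariant_under (A z).
Hypothesis Ao : forall z, mid z -> A z o = 0.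
Hypothesis AN : forall z, mid z -> A z N = - z.
Hypothesis Az : forall z z', mid z -> mid z' -> A z z' = d z z' *: o.
Hypothesis T3 : forall y y', T N N N y y' = 0.
Hypothesis T2 : forall y y', T N N o y y' = 0.
Hypothesis T1 : forall y y', T N o o y y' = 0.
Hypothesis T0' : forall y y', T o o o y y' = 0.

Let P x := [\/ x = o, x = N | mid x].

Lemma null_rotation_propagation x1 x2 x3 y y' :
  P x1 -> P x2 -> P x3 -> T x1 x2 x3 y y' = 0.
Proof.
have k2 : (2 : F) != 0 by rewrite pnatr_eq0.
have k3 : (3 : F) != 0 by rewrite pnatr_eq0.
have zNN z w w' : mid z -> T z N N w w' = 0.
  move=> mz; have := iA mz N N N w w'; rewrite AN // !Tz !T3 !addr0 (T23 N z N) !(T12 z N) => h.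
  by apply: (lin_solve (k := 3)) => //; rewrite -[RHS]oppr0 -h; ring.
have zNo z w w' : mid z -> T z N o w w' = 0.
  move=> mz; have := iA mz N N o w w'; rewrite AN // Ao // !Tz !T2 !addr0 T12 => h.
  by apply: (lin_solve (k := 2)) => //; rewrite -[RHS]oppr0 -h; ring.
have zoo z w w' : mid z -> T z o o w w' = 0.
  move=> mz; have := iA mz N o o w w'; rewrite AN // Ao // !Tz !T1 !addr0 => /eqP.
  by rewrite oppr_eq0 => /eqP.
have zzN z z' w w' : mid z -> mid z' -> T z z' N w w' = 0.
  move=> mz mz'; have := iA mz' z N N w w'; rewrite AN // Az // !Tz !(zNN z) // (T12 N o) (T23 N N o) T2.
  rewrite mulr0 add0r !addr0 (T23 z z' N) => h.
  by apply: (lin_solve (k := 2)) => //; rewrite -[RHS]oppr0 -h; ring.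
have zzo z z' w w' : mid z -> mid z' -> T z z' o w w' = 0.
  move=> mz mz'; have := iA mz' z N o w w'.
  rewrite AN // Az // Ao // !Tz !(zNo z) // (T12 N o) T1 mulr0 add0r !addr0 => /eqP.
  by rewrite oppr_eq0 => /eqP.
have zzz z z' z2 w w' : mid z -> mid z' -> mid z2 -> T z z' z2 w w' = 0.
  move=> mz mz' mz2; have := iA mz2 z z' N w w'.
  rewrite AN // (Az mz2 mz) (Az mz2 mz') !Tz !(zzN _ _ _ _ mz mz') (T12 z' o) (T23 z' N o) (T23 z N o) (zNo z) // (zNo z') //.
  by rewrite !mulr0 !add0r !addr0 => /eqP; rewrite oppr_eq0 => /eqP.
have zxx z u v w w' : mid z -> u = o \/ u = N -> v = o \/ v = N -> T z u v w w' = 0.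
  move=> mz [->|->] [->|->]; rewrite ?(T23 z N o) ?zoo ?zNo ?zNN //.
have zzx z z' u w w' : mid z -> mid z' -> u = o \/ u = N -> T z z' u w w' = 0.
  by move=> mz mz' [->|->]; rewrite ?zzo ?zzN.
have Q x : P x -> mid x \/ (x = o \/ x = N) by case=> ?; auto.
move=> /Q [m1|p1] /Q [m2|p2] /Q [m3|p3].
- exact: zzz.
- exact: zzx.
- by rewrite (T23 x1 x3 x2) zzx.
- exact: zxx.
- by rewrite (T12 x2 x1) (T23 x2 x3 x1) zzx.
- by rewrite (T12 x2 x1) zxx.
- by rewrite (T23 x1 x3 x2) (T12 x3 x1) zxx.
- by case: p1 p2 p3 => [->|->] [->|->] [->|->];
    rewrite ?(T12 N o) ?(T23 _ N o) ?(T12 N o) ?T3 ?T2 ?T1 ?T0'.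
Qed.
End Propagation.

End NullRotation.
End SymmetricForms.

(** * A singular form vanishes once a few of its coefficients do *)

Section Classification.
Variables (F : numFieldType) (n : nat) (g P : 'M[F]_n).
Hypothesis hP : is_witt_basis g P.
Local Notation V := 'cV[F]_n.
Local Notation b i := (col i P).
Local Notation E := (root_elt g P).
Variable T : V -> V -> V -> V -> V -> F.
Hypothesis TP1 : forall a x x' x2 x3 y1 y2,
  T (a *: x + x') x2 x3 y1 y2 = a * T x x2 x3 y1 y2 + T x' x2 x3 y1 y2.
Hypothesis TP4 : forall a y y' x1 x2 x3 y2,
  T x1 x2 x3 (a *: y + y') y2 = a * T x1 x2 x3 y y2 + T x1 x2 x3 y' y2.
Hypothesis T12 : forall x1 x2 x3 y1 y2, T x2 x1 x3 y1 y2 = T x1 x2 x3 y1 y2.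
Hypothesis T23 : forall x1 x2 x3 y1 y2, T x1 x3 x2 y1 y2 = T x1 x2 x3 y1 y2.
Hypothesis T45 : forall x1 x2 x3 y1 y2, T x1 x2 x3 y2 y1 = T x1 x2 x3 y1 y2.
Hypothesis Tcyc : forall x1 x2 x3 x4 y,
  T x1 x2 x3 x4 y + T x2 x3 x4 x1 y + T x3 x4 x1 x2 y + T x4 x1 x2 x3 y = 0.
Variable lam : 'I_n -> F.
Local Notation inv A := (invariant_under T (fun x => A *m x)).
Hypothesis Tinv : forall i j : 'I_n, (i < j)%N -> inv (E i j).
Hypothesis Twt : forall (k i j l m r : 'I_n), T (b i) (b j) (b l) (b m) (b r) != 0 ->
  lam k = - (eps F k i + eps F k j + eps F k l + eps F k m + eps F k r).
Hypothesis lam_rev : forall i, lam (rev_ord i) = - lam i.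
Hypothesis lam_dom : forall i j : 'I_n, (i < j)%N -> j != rev_ord i -> 0 <= lam i - lam j.
Hypothesis Tlow : forall i j : 'I_n, (i < j)%N -> j != rev_ord i -> lam i = lam j -> inv (E j i).
Hypothesis n3 : (3 <= n)%N.

Let lt0n : (0 < n)%N. Proof. exact: leq_trans n3. Qed.
Let lt1n : (1 < n)%N. Proof. exact: leq_trans n3. Qed.
Definition ord_fst : 'I_n := Ordinal lt0n.
Definition ord_snd : 'I_n := Ordinal lt1n.
Local Notation o := ord_fst.
Local Notation p := ord_snd.
Local Notation q := (rev_ord p).
Local Notation N := (rev_ord o).

Let valN : val N = n.-1. Proof. by rewrite /= subn1. Qed.
Let valq : val q = n.-2. Proof. by rewrite /= subn2. Qed.

Definition middle (k : 'I_n) := (k != o) && (k != N).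

Lemma middleE k : middle k = (0 < k < n.-1)%N.
Proof.
rewrite /middle -!val_eqE /= subn1; have := ltn_ord k; lia.
Qed.

Let eps_oo : eps F o o = 1.
Proof.
by rewrite /eps eqxx -val_eqE /= subn1 (_ : 0 == _ = false)%N ?subr0 //; lia.
Qed.
Let eps_oN : eps F o N = -1.
Proof. by rewrite eps_rev eps_oo. Qed.
Let eps_om k : middle k -> eps F o k = 0.
Proof. by rewrite /eps => /andP[/negbTE -> /negbTE ->]; rewrite subrr. Qed.

Let lam_o_ge0 : 0 <= lam o.
Proof.
have h1 : 0 <= lam o - lam p by apply: lam_dom; rewrite // -val_eqE /= subn1; lia.
have h2 : 0 <= lam p - lam N.
  apply: lam_dom; first by rewrite /= subn1; move: n3; lia.
  by rewrite (inj_eq rev_ord_inj) -val_eqE.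
have := addr_ge0 h1 h2; rewrite lam_rev opprK addrA subrK -mulr2n.
by rewrite pmulrn_lge0.
Qed.

Let neg_false (m : nat) (x : F) : x = - m.+1%:R -> 0 <= x -> False.
Proof. by move=> ->; rewrite oppr_ge0 lern0. Qed.

(** The root vectors with first index [o] act as null rotations: they kill b_o and send b_N into the
    middle part and the middle part to the line of b_o. *)
Let Eo (z : 'I_n) : middle z -> [/\ E o z *m b o = 0, E o z *m b N = - b (rev_ord z) &
   forall k, middle k -> E o z *m b k = (k == z)%:R *: b o].
Proof.
move=> /andP[zo zN].
have oN : (o == N) = false by rewrite -val_eqE /= subn1; lia.
split=> [||k /andP[ko kN]]; rewrite root_eltE //.
- by rewrite eq_sym (negbTE zo) oN !scale0r subrr.
- by rewrite eq_sym (negbTE zN) eqxx scale0r scale1r sub0r.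
- by rewrite (negbTE kN) scale0r subr0.
Qed.

Let middle_rev z : middle z -> middle (rev_ord z).
Proof. by rewrite !middleE /=; have := ltn_ord z; lia. Qed.

(** When n >= 4 these coefficients can occur only in the weights 3 eps_1 + 2 eps_2, 3 eps_1, 2 eps_1
    + eps_2 and eps_1; [T4] covers the mirror weights 3 eps_1 - 2 eps_2 and 2 eps_1 - eps_2. *)
Hypotheses (Tqq : T (b N) (b N) (b N) (b q) (b q) = 0)
  (Tpq : T (b N) (b N) (b N) (b p) (b q) = 0)
  (Toq : T (b N) (b N) (b N) (b o) (b q) = 0)
  (Too : T (b N) (b N) (b N) (b o) (b o) = 0)
  (T4 : n = 4%N -> T (b N) (b N) (b N) (b p) (b p) = 0 /\ T (b N) (b N) (b N) (b o) (b p) = 0).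

(* Below, weights with a negative first coordinate are excluded by dominance. *)
Let lam_o_neg i j k l m : T (b i) (b j) (b k) (b l) (b m) != 0 -> forall r : nat,
  eps F o i + eps F o j + eps F o k + eps F o l + eps F o m = r.+1%:R -> False.
Proof.
move=> /(Twt o) lo r e; apply: (neg_false (m := r) _ lam_o_ge0).
by rewrite lo e.
Qed.

Let mid_cases k : middle k -> [\/ k = p, k = q | (p < k < q)%N].
Proof.
rewrite middleE => kk; have [->|kp] := eqVneq k p; first by constructor 1.
have [->|kq] := eqVneq k q; first by constructor 2.
constructor 3; move: kp kq; rewrite -!val_eqE valq /=; lia.
Qed.

Let mid_p : middle p. Proof. by rewrite middleE /=; lia. Qed.
Let mid_q : middle q. Proof. exact: middle_rev. Qed.

(* The null rotations of the middle part fix the lines of [b o] and [b N]. *)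
Let Ep (z : 'I_n) : (p < z < q)%N -> [/\ E p z *m b o = 0, E p z *m b N = 0, E p z *m b p = 0,
  E p z *m b q = - b (rev_ord z) & forall k : 'I_n, (p < k < q)%N -> E p z *m b k = (k == z)%:R *: b p].
Proof.
move=> /andP[pz zq]; have n4 : (4 < n)%N by move: pz zq; rewrite valq /=; lia.
have ne (i j : 'I_n) : (val i != val j) -> (i == j) = false by rewrite val_eqE => /negbTE.
split=> [||||k /andP[pk kq]]; rewrite root_eltE //.
- by rewrite !ne ?scale0r ?subrr //= ; move: pz zq; rewrite ?valq /=; lia.
- by rewrite !ne ?scale0r ?subrr //= ; move: pz zq; rewrite ?valq ?subn1 ?subn2 /=; lia.
- by rewrite !ne ?scale0r ?subrr //= ; move: pz zq; rewrite ?valq ?subn1 ?subn2 /=; lia.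
- by rewrite eqxx ne ?scale0r ?scale1r ?sub0r //= ; move: pz zq; rewrite ?valq ?subn1 ?subn2 /=; lia.
- by rewrite [k == q]ne ?scale0r ?subr0 //= ; move: pk kq; rewrite ?valq ?subn1 ?subn2 /=; lia.
Qed.

Let tri k : [\/ k = o, k = N | middle k].
Proof.
by rewrite /middle; case: eqVneq => [->|_]; [constructor 1|case: eqVneq => [->|_]; [constructor 2|constructor 3]].
Qed.

Let lin0 (f : V -> F) : (forall a x y, f (a *: x + y) = a * f x + f y) ->
  (forall k, f (b k) = 0) -> forall x, f x = 0.
Proof.
move=> fl f0 x; rewrite (witt_expand hP x).
have fz : f 0 = 0.
  have := fl 1 0 0; rewrite scale1r addr0 mul1r => /esym/eqP.
  by rewrite -subr_eq0 addrK => /eqP.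
elim: (index_enum _) => [|k r IH]; first by rewrite big_nil.
by rewrite big_cons fl f0 IH mulr0 addr0.
Qed.

Let bil0 x1 x2 x3 : (forall k l, T x1 x2 x3 (b k) (b l) = 0) -> forall y y', T x1 x2 x3 y y' = 0.
Proof.
move=> h y y'; apply: (lin0 (f := fun y => T x1 x2 x3 y y')) => [a x z|k].
  by rewrite /= TP4.
rewrite /= T45; apply: (lin0 (f := fun y => T x1 x2 x3 y _)) => [a x z|l].
  by rewrite /= TP4.
by rewrite /= T45.
Qed.

Let bsym0 x1 x2 x3 : (forall y, T x1 x2 x3 (b N) y = 0) -> T x1 x2 x3 (b o) (b o) = 0 ->
  (forall k, middle k -> T x1 x2 x3 (b o) (b k) = 0) ->
  (forall k l, middle k -> middle l -> T x1 x2 x3 (b k) (b l) = 0) ->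
  forall y y', T x1 x2 x3 y y' = 0.
Proof.
move=> hN hoo hok hkl; apply: bil0 => k l.
case: (tri k) => [->|->|mk]; first 1 last.
- by rewrite hN.
- by case: (tri l) => [->|->|ml]; [rewrite T45 hok|rewrite T45 hN|rewrite hkl].
- by case: (tri l) => [->|->|ml]; [|rewrite T45 hN|rewrite hok].
Qed.

Let k2 : (2 : F) != 0. Proof. by rewrite pnatr_eq0. Qed.
Let k3 : (3 : F) != 0. Proof. by rewrite pnatr_eq0. Qed.
Let k4 : (4 : F) != 0. Proof. by rewrite pnatr_eq0. Qed.

Let Tz := (T01 TP1, T02 TP1 T12, T03 TP1 T12 T23, T04 TP4, T05 TP4 T45,
  TN1 TP1, TN2 TP1 T12, TN3 TP1 T12 T23, TN4 TP4, TN5 TP4 T45,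
  TZ1 TP1, TZ2 TP1 T12, TZ3 TP1 T12 T23, TZ4 TP4, TZ5 TP4 T45).

(* An invariant bilinear form of the middle part is determined by its values
   on the two extreme vectors, and likewise for linear forms. *)
Let mid_linear x1 x2 x3 : (forall z : 'I_n, (p < z < q)%N ->
    [/\ E p z *m x1 = 0, E p z *m x2 = 0 & E p z *m x3 = 0]) ->
  T x1 x2 x3 (b o) (b p) = 0 -> T x1 x2 x3 (b o) (b q) = 0 ->
  forall k, middle k -> T x1 x2 x3 (b o) (b k) = 0.
Proof.
move=> fx hp hq k /mid_cases [->//|->//|pkq].
have rk : (p < rev_ord k < q)%N by move: pkq; rewrite valq /=; have := ltn_ord k; lia.
have [e1 e2 e3] := fx _ rk; have [Aoo _ _ Aq _] := Ep rk.
have := Tinv (proj1 (andP rk)) x1 x2 x3 (b o) (b q).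
by rewrite e1 e2 e3 Aoo Aq rev_ordK !Tz !add0r => /eqP; rewrite oppr_eq0 => /eqP.
Qed.

Let mid_bilinear x1 x2 x3 : (forall z : 'I_n, (p < z < q)%N ->
    [/\ E p z *m x1 = 0, E p z *m x2 = 0 & E p z *m x3 = 0]) ->
  T x1 x2 x3 (b p) (b p) = 0 -> T x1 x2 x3 (b p) (b q) = 0 ->
  T x1 x2 x3 (b q) (b q) = 0 ->
  forall k l, middle k -> middle l -> T x1 x2 x3 (b k) (b l) = 0.
Proof.
move=> fx hpp hpq hqq.
have revk (k : 'I_n) : (p < k < q)%N -> (p < rev_ord k < q)%N.
  by move=> pkq; move: pkq; rewrite valq /=; have := ltn_ord k; lia.
have ax (z : 'I_n) y y' : (p < z < q)%N ->
    T x1 x2 x3 (E p z *m y) y' + T x1 x2 x3 y (E p z *m y') = 0.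
  move=> pz; have [e1 e2 e3] := fx _ pz.
  by have := Tinv (proj1 (andP pz)) x1 x2 x3 y y'; rewrite e1 e2 e3 !Tz !add0r.
have hkq (k : 'I_n) : (p < k < q)%N -> T x1 x2 x3 (b k) (b q) = 0.
  move=> pk; have := ax _ (b q) (b q) (revk _ pk); have [_ _ _ -> _] := Ep (revk _ pk).
  rewrite rev_ordK !Tz (T45 _ _ _ (b k)) => h.
  by apply: (lin_solve _ k2); rewrite -[RHS]oppr0 -h; ring.
have hpk (k : 'I_n) : (p < k < q)%N -> T x1 x2 x3 (b p) (b k) = 0.
  move=> pk; have := ax _ (b q) (b p) (revk _ pk); have [_ _ -> -> _] := Ep (revk _ pk).
  by rewrite rev_ordK !Tz addr0 => /eqP; rewrite oppr_eq0 T45 => /eqP.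
have hkl (k l : 'I_n) : (p < k < q)%N -> (p < l < q)%N -> T x1 x2 x3 (b k) (b l) = 0.
  move=> pk pl; have := ax _ (b q) (b l) (revk _ pk); have [_ _ _ -> Al] := Ep (revk _ pk).
  rewrite rev_ordK (Al _ pl) !Tz [T _ _ _ (b q) (b p)]T45 hpq mulr0 addr0 => /eqP.
  by rewrite oppr_eq0 => /eqP.
move=> k l /mid_cases [->|->|pk] /mid_cases [->|->|pl] //.
- by rewrite hpk.
- by rewrite T45.
- by rewrite T45 hkq.
- by rewrite T45 hpk.
- by rewrite hkq.
- by rewrite hkl.
Qed.

Let fix_oN (i j k : 'I_n) : (i = o \/ i = N) -> (j = o \/ j = N) -> (k = o \/ k = N) ->
  forall z : 'I_n, (p < z < q)%N ->
  [/\ E p z *m b i = 0, E p z *m b j = 0 & E p z *m b k = 0].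
Proof.
move=> hi hj hk z /Ep [eo eN _ _ _].
by split; [case: hi|case: hj|case: hk] => ->.
Qed.

(** From n = 5 on there is an index z strictly between p and its reverse q, so lam_p >= lam_z >= -
    lam_p. For n = 4 there is none, which is why negative second coordinates appear there. *)
Let lam_p_ge0 : (4 < n)%N -> 0 <= lam p.
Proof.
move=> n4; pose z : 'I_n := Ordinal (leq_trans (isT : (2 < 5)%N) n4).
have h1 : 0 <= lam p - lam z by apply: lam_dom; rewrite // -val_eqE /= subn2; have := n4; lia.
have h2 : 0 <= lam z - lam q.
  apply: lam_dom; first by rewrite /= subn2; have := n4; lia.
  by rewrite (inj_eq rev_ord_inj) -val_eqE.
have := addr_ge0 h1 h2; rewrite lam_rev opprK addrA subrK -mulr2n.
by rewrite pmulrn_lge0.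
Qed.

Let eps_pp : (3 < n)%N -> eps F p p = 1.
Proof.
move=> n4; rewrite /eps eqxx -val_eqE /= subn2 (_ : (1 == n.-2)%N = false) ?subr0 //.
by move: n4; lia.
Qed.
Let eps_po : eps F p o = 0.
Proof.
rewrite /eps -!val_eqE /= subn2 (_ : (0 == n.-2)%N = false) ?subrr //.
by move: n3; lia.
Qed.
Let eps_pN : eps F p N = 0.
Proof. by rewrite eps_rev eps_po oppr0. Qed.

Let epsE := (eps_oo, eps_oN, eps_po, eps_pN, eps_rev, eps_om mid_p).

Let a0N y : T (b N) (b N) (b N) (b N) y = 0.
Proof.
by have := Tcyc (b N) (b N) (b N) (b N) y => h; apply: (lin_solve _ k4); rewrite -h; ring.
Qed.

Let a0 y y' : T (b N) (b N) (b N) y y' = 0.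
Proof.
have fx := @fix_oN N N N (or_intror erefl) (or_intror erefl) (or_intror erefl).
have n34 : n = 3%N \/ n = 4%N \/ (4 < n)%N by move: n3; lia.
(* In dimension 3 the middle part is one line, and [p], [q] are the same index. *)
have q3 : n = 3%N -> q = p.
  by move=> e; apply: val_inj; rewrite valq /= {1}e.
have hop : T (b N) (b N) (b N) (b o) (b p) = 0.
  case: n34 => [/q3 <- //|[/T4 [] //|n5]].
  apply/eqP/negPn/negP => /(Twt p); rewrite !epsE eps_pp ?(ltnW n5) // => e.
  by apply: (neg_false (m := 0) _ (lam_p_ge0 n5)); rewrite e; ring.
have hpp : T (b N) (b N) (b N) (b p) (b p) = 0.
  case: n34 => [/q3 e|[/T4 [] //|n5]]; first by rewrite -{2}e.
  apply/eqP/negPn/negP => /(Twt p); rewrite !epsE eps_pp ?(ltnW n5) // => e.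
  by apply: (neg_false (m := 1) _ (lam_p_ge0 n5)); rewrite e; ring.
by apply: bsym0 => //; [exact: mid_linear|exact: mid_bilinear].
Qed.

Let oN_sorts := (T12 (b N) (b o), (fun x => T23 x (b N) (b o))).

Let a1N y : T (b N) (b N) (b o) (b N) y = 0.
Proof.
have := Tcyc (b N) (b N) (b N) (b o) y; rewrite !oN_sorts a0 => h.
by apply: (lin_solve _ k3); rewrite -h; ring.
Qed.

Let n34 : n = 3%N \/ (3 < n)%N. Proof. by move: n3; lia. Qed.
Let q3 : n = 3%N -> q = p.
Proof. by move=> e; apply: val_inj; rewrite valq /= {1}e. Qed.

Let lam_oq : (3 < n)%N -> 0 <= lam o + lam p.
Proof.
move=> n4; rewrite -[lam p]opprK -lam_rev; apply: lam_dom; first by rewrite /= subn2; lia.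
by rewrite (inj_eq rev_ord_inj) -val_eqE.
Qed.
Let lam_op : (3 < n)%N -> 0 <= lam o - lam p.
Proof. by move=> n4; apply: lam_dom; rewrite // -val_eqE /= subn1; lia. Qed.

(** Here the weight would be zero, which dominance allows. But equality of the coordinates makes the
    lowering operator kill the vector as well, and invariance under raising and lowering together
    forces the coefficient to vanish. *)
Let a1_op3 : n = 3%N -> T (b N) (b N) (b o) (b o) (b p) = 0.
Proof.
move=> e; have qp := q3 e; apply/eqP/negPn/negP => T0.
have lo : lam o = 0 by rewrite (Twt o T0) !epsE; ring.
have lp : lam p = 0.
  by apply: (lin_solve _ k2); rewrite mulr_natl mulr2n -{2}qp lam_rev subrr.
have pN : p != N by rewrite -val_eqE /= subn1 e.
have := @Tlow o p isT pN (etrans lo (esym lp)) (b N) (b N) (b o) (b o) (b o).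
have oN : (o == N) = false by rewrite -val_eqE /= subn1 e.
have Npo : E p o *m b N = 0.
  by rewrite root_eltE // eq_sym oN qp eq_sym (negbTE pN) !scale0r subrr.
have opo : E p o *m b o = b p.
  by rewrite root_eltE // eqxx qp -[o == p]val_eqE scale1r scale0r subr0.
rewrite Npo opo !Tz !add0r [T _ _ _ (b p) (b o)]T45 => h.
have [Aoo AoN _] := Eo mid_p; have := @Tinv o p isT (b N) (b N) (b N) (b o) (b o).
rewrite Aoo AoN qp !Tz !addr0 (T12 (b N) (b p)) (T23 (b N) (b N) (b p)) => h'.
have hz : T (b N) (b N) (b p) (b o) (b o) = 0.
  by apply: (lin_solve _ k3); rewrite -[RHS]oppr0 -h'; ring.
rewrite hz add0r in h; case/eqP: T0.
by apply: (lin_solve _ k2); rewrite -h; ring.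
Qed.

Let a1_pp : (3 < n)%N -> T (b N) (b N) (b o) (b p) (b p) = 0.
Proof.
move=> n4; apply/eqP/negPn/negP => T0; have lo := Twt o T0; have lp := Twt p T0.
apply: (neg_false (m := 0) _ (lam_oq n4)); rewrite lo lp !epsE eps_pp //; ring.
Qed.

Let a1_qq : (3 < n)%N -> T (b N) (b N) (b o) (b q) (b q) = 0.
Proof.
move=> n4; apply/eqP/negPn/negP => T0; have lo := Twt o T0; have lp := Twt p T0.
apply: (neg_false (m := 0) _ (lam_op n4)); rewrite lo lp !epsE eps_pp //; ring.
Qed.

Let a1_relation e (d : F) (A : V -> V) : invariant_under T A -> A (b o) = 0 ->
  A (b N) = - e -> A e = d *: b o -> d != 0 -> T (b N) (b N) (b o) e e = 0.
Proof.
move=> iA Ao AN Ae d0; apply: (lin_solve _ k3).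
by rewrite (null_rotation_relation TP1 TP4 T12 T23 T45 Tcyc iA Ao AN Ae d0) a0 mulr0 oppr0.
Qed.

(** The weight of this coefficient is eps_1, which is dominant, so the null rotation relation is
    used in place of dominance; its right side vanishes by [a0]. *)
Let a1_pq : T (b N) (b N) (b o) (b p) (b q) = 0.
Proof.
have [Po PN Pm] := Eo mid_p; have [Qo QN Qm] := Eo mid_q.
have op : (o < p)%N by []; have oq : (o < q)%N by rewrite /= subn2; move: n3; lia.
case: n34 => [/q3 qp|n4].
  rewrite qp; apply: (a1_relation (Tinv op) (d := 1)); rewrite ?oner_neq0 ?Po ?PN ?qp //.
  by rewrite Pm // eqxx.
have pq : (p == q) = false by rewrite -val_eqE /= subn2; apply/negP => /eqP; move: n4; lia.
(* The vector b_p + b_q has squared length 2. Its two pure terms vanish by dominance, so the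
   relation isolates the mixed one. *)
have := a1_relation (e := b p + b q) (d := 2) (invariant_underD TP1 TP4 T12 T23 T45 (Tinv op) (Tinv oq)).
rewrite /= Po Qo PN QN rev_ordK addr0 !mulmxDr !Pm ?Qm // !eqxx [q == p]eq_sym pq.
rewrite !scale1r !scale0r addr0 add0r -opprD [b q + b p]addrC scaler_nat mulr2n.
move=> /(_ erefl erefl erefl k2).
rewrite TD4 // !(TD5 TP4 T45) a1_pp // a1_qq // add0r addr0 [T _ _ _ (b q) _]T45 => h.
by apply: (lin_solve _ k2); rewrite -h; ring.
Qed.

Let a1 y y' : T (b N) (b N) (b o) y y' = 0.
Proof.
have fx := @fix_oN N N o (or_intror erefl) (or_intror erefl) (or_introl erefl).
apply: bsym0 => //.
- apply/eqP/negPn/negP => /lam_o_neg /(_ 0); apply; rewrite !epsE; ring.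
- apply: mid_linear => //.
    case: n34 => [/a1_op3 //|n4]; apply/eqP/negPn/negP => T0.
    have lo := Twt o T0; have lp := Twt p T0.
    apply: (neg_false (m := 0) _ (lam_oq n4)); rewrite lo lp !epsE eps_pp //; ring.
  case: n34 => [/[dup] e /q3 ->|n4]; first exact: a1_op3.
  apply/eqP/negPn/negP => T0; have lo := Twt o T0; have lp := Twt p T0.
  apply: (neg_false (m := 0) _ (lam_op n4)); rewrite lo lp !epsE eps_pp //; ring.
- apply: mid_bilinear => //; first by case: n34 => [/q3 e|/a1_pp //]; rewrite -{2}e a1_pq.
  by case: n34 => [/q3 e|/a1_qq //]; rewrite {1}e a1_pq.
Qed.

(** Entries containing b_N follow from the cyclic relation and [a1]; the others would have a weight
    with negative first coordinate. *)
Let a2 y y' : T (b N) (b o) (b o) y y' = 0.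
Proof.
apply: bsym0 => [{}y||k mk|k l mk ml].
- have := Tcyc (b N) (b N) (b o) (b o) y; rewrite !oN_sorts !a1 => h.
  by apply: (lin_solve _ k2); rewrite -h; ring.
- apply/eqP/negPn/negP => /lam_o_neg /(_ 2); apply; rewrite !epsE; ring.
- apply/eqP/negPn/negP => /lam_o_neg /(_ 1); apply; rewrite !epsE !eps_om //; ring.
- apply/eqP/negPn/negP => /lam_o_neg /(_ 0); apply; rewrite !epsE !eps_om //; ring.
Qed.

Let a3 y y' : T (b o) (b o) (b o) y y' = 0.
Proof.
apply: bsym0 => [{}y||k mk|k l mk ml].
- have := Tcyc (b N) (b o) (b o) (b o) y; rewrite !oN_sorts !a2 => h.
  by rewrite -h; ring.
- apply/eqP/negPn/negP => /lam_o_neg /(_ 4); apply; rewrite !epsE; ring.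
- apply/eqP/negPn/negP => /lam_o_neg /(_ 3); apply; rewrite !epsE !eps_om //; ring.
- apply/eqP/negPn/negP => /lam_o_neg /(_ 2); apply; rewrite !epsE !eps_om //; ring.
Qed.

(** The facts [a0] to [a3] say that T vanishes when its first three arguments are b_o or b_N. Null
    rotations spread this to the middle vectors, and multilinearity to all arguments. *)
Theorem singular_form_eq0 x1 x2 x3 y y' : T x1 x2 x3 y y' = 0.
Proof.
pose mid z := exists2 k, middle k & z = b k.
have ok0 k : middle k -> wedge g (b o) (b k) = E o (rev_ord k) by rewrite /root_elt rev_ordK.
have iA z : mid z -> invariant_under T (fun x => wedge g (b o) z *m x).
  move=> [k mk ->]; rewrite ok0 //; apply: Tinv => /=.
  by have := middle_rev mk; rewrite middleE /= => /andP[].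
have Ao z : mid z -> wedge g (b o) z *m b o = 0.
  by move=> [k mk ->]; rewrite ok0 //; have [-> _ _] := Eo (middle_rev mk).
have AN z : mid z -> wedge g (b o) z *m b N = - z.
  by move=> [k mk ->]; rewrite ok0 //; have [_ -> _] := Eo (middle_rev mk); rewrite rev_ordK.
have Az z z' : mid z -> mid z' -> wedge g (b o) z *m z' = dot g z z' *: b o.
  move=> [k mk ->] [l ml ->]; rewrite ok0 //; have [_ _ ->] := Eo (middle_rev mk) => //.
  by rewrite dot_witt.
have key i j k : T (b i) (b j) (b k) y y' = 0.
  have Pk l : [\/ b l = b o, b l = b N | mid (b l)].
    by case: (tri l) => [->|->|ml]; [constructor 1|constructor 2|constructor 3; exists l].
  exact: (null_rotation_propagation TP1 T12 T23 (mid := mid)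
    (A := fun z x => wedge g (b o) z *m x) (d := dot g) iA Ao AN Az a0 a1 a2 a3 _ _ (Pk i) (Pk j) (Pk k)).
apply: (lin0 (f := fun x => T x x2 x3 y y')) => [a x z|k /=]; first by rewrite TP1.
rewrite T12; apply: (lin0 (f := fun x => T x (b k) x3 y y')) => [a x z|l /=]; first by rewrite TP1.
rewrite T23 T12; apply: (lin0 (f := fun x => T x (b l) (b k) y y')) => [a x z|m /=]; first by rewrite TP1.
exact: key.
Qed.

End Classification.

(** * The symmetric form attached to an element of the module *)

Section NablaForm.
Variables (F : numFieldType) (n : nat) (g : 'M[F]_n).
Hypotheses (gT : g^T = g) (gU : g \in unitmx).
Local Notation V := 'cV[F]_n.
Implicit Types (x y X Y Z U W : V) (u v : nabla_rep g).

Definition nab5 u X Y Z U W : F := dot g W (nab u X Y Z *m U).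

Lemma nab5P u a v X Y Z U W :
  nab5 (a *: u + v) X Y Z U W = a * nab5 u X Y Z U W + nab5 v X Y Z U W.
Proof. by rewrite /nab5 nabP mulmxDl -scalemxAl dotPr. Qed.
Lemma nab5P1 u a X X' Y Z U W :
  nab5 u (a *: X + X') Y Z U W = a * nab5 u X Y Z U W + nab5 u X' Y Z U W.
Proof. by rewrite /nab5 nabP1 mulmxDl -scalemxAl dotPr. Qed.
Lemma nab5P2 u a X X' Y Z U W :
  nab5 u Y (a *: X + X') Z U W = a * nab5 u Y X Z U W + nab5 u Y X' Z U W.
Proof. by rewrite /nab5 nabP2 mulmxDl -scalemxAl dotPr. Qed.
Lemma nab5P3 u a X X' Y Z U W :
  nab5 u Y Z (a *: X + X') U W = a * nab5 u Y Z X U W + nab5 u Y Z X' U W.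
Proof. by rewrite /nab5 nabP3 mulmxDl -scalemxAl dotPr. Qed.
Lemma nab5P4 u a X X' Y Z U W :
  nab5 u Y Z U (a *: X + X') W = a * nab5 u Y Z U X W + nab5 u Y Z U X' W.
Proof. by rewrite /nab5 mulmxDr -scalemxAr dotPr. Qed.
Lemma nab5P5 u a X X' Y Z U W :
  nab5 u Y Z U W (a *: X + X') = a * nab5 u Y Z U W X + nab5 u Y Z U W X'.
Proof. by rewrite /nab5 dotPl. Qed.
Lemma nab5C u X Y Z U W : nab5 u X Z Y U W = - nab5 u X Y Z U W.
Proof. by rewrite /nab5 nabC mulNmx dotNr. Qed.
Lemma nab5D u X Y Z U W : nab5 u X Y Z W U = - nab5 u X Y Z U W.
Proof. by rewrite /nab5 -so_dot ?nab_so // dotC. Qed.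
Lemma nab5B u X Y Z U W : nab5 u X Y Z U W + nab5 u X Z U Y W + nab5 u X U Y Z W = 0.
Proof. by rewrite /nab5 -!dotDr nab_bianchi1 dot0r. Qed.
Lemma nab5B2 u X Y Z U W : nab5 u X Y Z U W + nab5 u Y Z X U W + nab5 u Z X Y U W = 0.
Proof. by rewrite /nab5 -!dotDr -!mulmxDl nab_bianchi2 mul0mx dot0r. Qed.

Lemma nab5_act u A X Y Z U W : A \in so g ->
  nab5 (rep_act (nabla_rep g) A u) X Y Z U W =
  - (nab5 u (A *m X) Y Z U W + nab5 u X (A *m Y) Z U W + nab5 u X Y (A *m Z) U W
     + nab5 u X Y Z (A *m U) W + nab5 u X Y Z U (A *m W)).
Proof.
move=> hA; rewrite /nab5 nab_act // /ad_fun !mulmxBl -!mulmxA !dotDr !dotNr so_dot //.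
ring.
Qed.

Definition nab_sym u := sym_form (nab5 u).

Lemma nab_sym_act u A x1 x2 x3 y1 y2 : A \in so g ->
  nab_sym (rep_act (nabla_rep g) A u) x1 x2 x3 y1 y2 =
  - (nab_sym u (A *m x1) x2 x3 y1 y2 + nab_sym u x1 (A *m x2) x3 y1 y2
     + nab_sym u x1 x2 (A *m x3) y1 y2 + nab_sym u x1 x2 x3 (A *m y1) y2
     + nab_sym u x1 x2 x3 y1 (A *m y2)).
Proof. by move=> hA; rewrite /nab_sym /sym_form !nab5_act //; ring. Qed.

Lemma nab_symP u a v x1 x2 x3 y1 y2 : nab_sym (a *: u + v) x1 x2 x3 y1 y2 =
  a * nab_sym u x1 x2 x3 y1 y2 + nab_sym v x1 x2 x3 y1 y2.
Proof. by rewrite /nab_sym /sym_form !nab5P; ring. Qed.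

Lemma nab_sym0 x1 x2 x3 y1 y2 : nab_sym 0 x1 x2 x3 y1 y2 = 0.
Proof.
have := nab_symP 0 1 0 x1 x2 x3 y1 y2; rewrite scale1r addr0 mul1r => /esym/eqP.
by rewrite -subr_eq0 addrK => /eqP.
Qed.

Lemma nab_symP1 u a x x' x2 x3 y1 y2 :
  nab_sym u (a *: x + x') x2 x3 y1 y2 = a * nab_sym u x x2 x3 y1 y2 + nab_sym u x' x2 x3 y1 y2.
Proof. by rewrite /nab_sym /sym_form !nab5P1 !nab5P2 !nab5P5; ring. Qed.

Lemma nab_symP4 u a y y' x1 x2 x3 y2 :
  nab_sym u x1 x2 x3 (a *: y + y') y2 = a * nab_sym u x1 x2 x3 y y2 + nab_sym u x1 x2 x3 y' y2.
Proof. by rewrite /nab_sym /sym_form !nab5P3 !nab5P4; ring. Qed.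

Lemma nab_sym_inj u : (forall x1 x2 x3 y1 y2, nab_sym u x1 x2 x3 y1 y2 = 0) -> u = 0.
Proof.
move=> h; have s0 := sym_form_eq0 (@nab5P2 u) (@nab5P3 u) (@nab5P5 u) (@nab5C u) (@nab5D u)
  (@nab5B u) (@nab5B2 u) h.
apply: nab_inj => X Y Z; have -> : nab (0 : nabla_rep g) X Y Z = 0.
  by rewrite /nab linear0 !zero_lfunE.
apply: mulmx_ext => U; rewrite mul0mx; apply: (dot_nondeg gU) => W.
by rewrite dotC //; apply: s0.
Qed.

End NablaForm.

(** * Singular vectors are detected by a few coefficients *)

Section SingularVectors.
Variables (C : numClosedFieldType) (n : nat) (g P : 'M[C]_n).
Hypothesis hP : is_witt_basis g P.
Hypothesis n3 : (3 <= n)%N.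
Local Notation b i := (col i P).
Local Notation o := (ord_fst n3).
Local Notation p := (ord_snd n3).
Local Notation q := (rev_ord p).
Local Notation N := (rev_ord o).

Let gT := metric_sym hP.
Let gU := metric_unit hP.

Let S12 u := sym_form12 (@nab5C _ _ g u) (@nab5D _ _ _ gT u) (@nab5B _ _ g u).
Let S23 u := sym_form23 (@nab5C _ _ g u) (@nab5D _ _ _ gT u) (@nab5B _ _ g u).
Let S45 u := sym_form45 (@nab5 _ _ g u).
Let Scyc u := sym_form_cycle (@nab5C _ _ g u) (@nab5D _ _ _ gT u) (@nab5B _ _ g u).

Lemma nab_sym_weight (u : nabla_rep g) lam k (i j l m r : 'I_n) : is_weight P u lam ->
  nab_sym u (b i) (b j) (b l) (b m) (b r) != 0 ->
  lam k = - (eps C k i + eps C k j + eps C k l + eps C k m + eps C k r).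
Proof.
move=> wu; set t := nab_sym _ _ _ _ _ _ => t0.
have := nab_sym_act u (b i) (b j) (b l) (b m) (b r) (root_elt_so hP k k).
rewrite wu -[_ *: u]addr0 nab_symP nab_sym0 addr0 !cartanE //.
rewrite (TZ1 (nab_symP1 u)) (TZ2 (nab_symP1 u) (S12 u)) (TZ3 (nab_symP1 u) (S12 u) (S23 u)).
rewrite (TZ4 (nab_symP4 u)) (TZ5 (nab_symP4 u) (S45 u)) -!mulrDl -/t -mulNr.
by move/(mulIf t0).
Qed.

Variable H : nabla_rep g -> nabla_rep g -> C.
Hypothesis hH : contravariant_form P H.

(** The squared norm of the lowered vector is proportional to lam_i - lam_j, here zero. *)
Lemma singular_low (u : nabla_rep g) lam (i j : 'I_n) : is_weight P u lam -> is_singular P u ->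
  (i < j)%N -> j != rev_ord i -> lam i = lam j -> rep_act (nabla_rep g) (root_elt g P j i) u = 0.
Proof.
move=> wu su ij nij e; apply: (form_def hH).
by rewrite (form_root hH) (singular_root_root hP wu su) // e subrr scale0r (cform0r hH).
Qed.

Lemma singular_eq0 (u : nabla_rep g) lam : is_weight P u lam -> is_singular P u ->
  nab_sym u (b N) (b N) (b N) (b q) (b q) = 0 ->
  nab_sym u (b N) (b N) (b N) (b p) (b q) = 0 ->
  nab_sym u (b N) (b N) (b N) (b o) (b q) = 0 ->
  nab_sym u (b N) (b N) (b N) (b o) (b o) = 0 ->
  (n = 4%N -> nab_sym u (b N) (b N) (b N) (b p) (b p) = 0 /\
              nab_sym u (b N) (b N) (b N) (b o) (b p) = 0) ->
  u = 0.
Proof.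
move=> wu su hqq hpq hoq hoo h4; have [->//|u0] := eqVneq u 0.
have inv_of A : A \in so g -> rep_act (nabla_rep g) A u = 0 ->
    invariant_under (nab_sym u) (fun x => A *m x).
  move=> hA Au x1 x2 x3 y1 y2; have := nab_sym_act u x1 x2 x3 y1 y2 hA.
  by rewrite Au nab_sym0 => /esym/eqP; rewrite oppr_eq0 => /eqP.
have lr i : lam (rev_ord i) = - lam i := is_weight_rev hP i u0 wu.
apply: (nab_sym_inj gT gU).
apply: (singular_form_eq0 hP (nab_symP1 u) (nab_symP4 u) (S12 u) (S23 u) (S45 u) (Scyc u)
  (lam := lam) _ _ lr _ _ hqq hpq hoq hoo h4).
- by move=> i j ij; apply: inv_of; [apply: root_elt_so|apply: su].
- by move=> k i j l m r; apply: nab_sym_weight.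
- by move=> i j ij nij; apply: (singular_dominant hP hH u0 wu su).
- move=> i j ij nij e; apply: inv_of; first exact: root_elt_so.
  exact: singular_low wu su ij nij e.
Qed.

End SingularVectors.

(** * Elements built from a vector and an algebraic curvature tensor *)

Section CurvatureExtension.
Variables (F : numFieldType) (n : nat) (g : 'M[F]_n).
Hypotheses (gT : g^T = g) (gU : g \in unitmx).
Local Notation V := 'cV[F]_n.
Local Notation d := (dot g).
Local Notation wg := (wedge g).
Implicit Types (e f X Y Z U W : V) (R : V -> V -> 'M[F]_n).

Lemma mat_dot_ext (A B : 'M[F]_n) : (forall U W, d W (A *m U) = d W (B *m U)) -> A = B.
Proof.
move=> h; apply: mulmx_ext => U; apply/eqP; rewrite -subr_eq0; apply/eqP.
by apply: (dot_nondeg gU) => W; rewrite dotC // dotDr dotNr h subrr.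
Qed.

Lemma vec_dot_ext X Y : (forall W, d W X = d W Y) -> X = Y.
Proof.
move=> h; apply/eqP; rewrite -subr_eq0; apply/eqP.
by apply: (dot_nondeg gU) => W; rewrite dotC // dotDr dotNr h subrr.
Qed.

Record algebraic_curvature R : Prop := AlgebraicCurvature {
  curv_l : forall a X X' Y, R (a *: X + X') Y = a *: R X Y + R X' Y;
  curv_r : forall a X X' Y, R Y (a *: X + X') = a *: R Y X + R Y X';
  curv_so : forall X Y, R X Y \in so g;
  curv_xx : forall X, R X X = 0;
  curv_bianchi : forall X Y Z, R X Y *m Z + R Y Z *m X + R Z X *m Y = 0 }.

Lemma curv_skew R X Y : algebraic_curvature R -> R Y X = - R X Y.
Proof.
move=> hR; apply/eqP; rewrite -addr_eq0; apply/eqP; have := curv_xx hR (1 *: X + Y).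
by rewrite (curv_l hR) !(curv_r hR) !(curv_xx hR) !scale1r add0r addr0 addrC.
Qed.

(* The GL-equivariant projection of [e (x) R] onto the solutions of the second
   Bianchi identity. *)
Definition nabla_ext e R Z X Y : 'M[F]_n :=
  (2 * d e Z) *: R X Y + d e X *: R Z Y + d e Y *: R X Z + wg (R X Y *m Z) e.

Let dlin := (dotDl, dotDr, dotZl, dotZr, dotNl, dotNr).
Let mlin := (mulmxDl, mulmxDr, mulmxBl, mulmxBr, mulmxN, mulNmx).

Lemma nabla_ext_exists e R : algebraic_curvature R ->
  exists u : nabla_rep g, forall Z X Y, nab u Z X Y = nabla_ext e R Z X Y.
Proof.
move=> hR; have sk X Y U W : d W (R X Y *m U) = - d U (R X Y *m W).
  by rewrite -so_dot ?curv_so // dotC.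
apply: nab_make => [a X X' Y Z|a X X' Z Y|a X X' Z Y|X Y Z|X Y|Z X Y U|Z X Y]; rewrite /nabla_ext.
- rewrite !dlin !(curv_l hR) !(curv_r hR) mulmxDr -scalemxAr wedgePl.
  apply: mat_dot_ext => U W; rewrite !(mlin, scalerDr) -!scalemxAl !dlin; ring.
- rewrite !dlin !(curv_l hR) mulmxDl -scalemxAl wedgePl.
  apply: mat_dot_ext => U W; rewrite !(mlin, scalerDr) -!scalemxAl !dlin; ring.
- rewrite !dlin !(curv_r hR) mulmxDl -scalemxAl wedgePl.
  apply: mat_dot_ext => U W; rewrite !(mlin, scalerDr) -!scalemxAl !dlin; ring.
- by rewrite !rpredD ?rpredZ ?(curv_so hR) ?wedge_so.
- rewrite (curv_xx hR) mul0mx scaler0 wedge0l addr0 add0r (curv_skew X Y hR).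
  by rewrite scalerN ?addNr ?subrr.
- apply: vec_dot_ext => W; rewrite dot0r !mlin -!scalemxAl !wedgeE !dlin.
  have b1 := congr1 (d W) (curv_bianchi hR X Y U).
  have b2 := congr1 (d W) (curv_bianchi hR Z X Y).
  have b3 := congr1 (d W) (curv_bianchi hR Z Y U).
  have b4 := congr1 (d W) (curv_bianchi hR Z U X).
  have b5 := congr1 (d Z) (curv_bianchi hR X Y U).
  rewrite !dotDr !dot0r in b1 b2 b3 b4 b5.
  rewrite (dotC gT (R X Y *m Z)) (dotC gT (R Y U *m Z)) (dotC gT (R U X *m Z)) (sk X Y Z U) (sk Y U Z X) (sk U X Z Y) (dotC gT W e).
  (* The expression splits into five first Bianchi sums of [R], with coefficients the pairings of e
     with Z, X, Y, U and W. *)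
  set l := _ + _; have -> : l = 2 * d e Z * (d W (R X Y *m U) + d W (R Y U *m X) + d W (R U X *m Y))
    + d e X * (d W (R Z Y *m U) + d W (R Y U *m Z) + d W (R U Z *m Y))
    + d e Y * (d W (R Z U *m X) + d W (R U X *m Z) + d W (R X Z *m U))
    + d e U * (d W (R Z X *m Y) + d W (R X Y *m Z) + d W (R Y Z *m X))
    + d e W * (d Z (R X Y *m U) + d Z (R Y U *m X) + d Z (R U X *m Y)) by rewrite /l; ring.
  by rewrite b1 b2 b3 b4 b5 !mulr0 !addr0.
- have b := congr1 (fun v => wg v e) (curv_bianchi hR X Y Z).
  rewrite /= !wedgeDl wedge0l in b.
  rewrite (curv_skew X Y hR) (curv_skew Y Z hR) (curv_skew Z X hR).
  apply: mat_dot_ext => U W; have bUW := congr1 (fun A => d W (A *m U)) b.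
  rewrite /= !mlin !dotDr mul0mx dot0r in bUW.
  rewrite !(mlin, scalerN) -!scalemxAl !dlin mul0mx dot0r -[RHS]bUW; ring.
Qed.

Definition curv_act A R X Y : 'M[F]_n := ad_fun A (R X Y) - R (A *m X) Y - R X (A *m Y).

(** Equivariance in the form of a Leibniz rule, which reduces the action on the extension to the
    actions on e and on R. *)
Lemma nabla_ext_act e R A Z X Y : algebraic_curvature R -> A \in so g ->
  ad_fun A (nabla_ext e R Z X Y) - nabla_ext e R Z X (A *m Y) - nabla_ext e R Z (A *m X) Y
  - nabla_ext e R (A *m Z) X Y =
  nabla_ext (A *m e) R Z X Y + nabla_ext e (curv_act A R) Z X Y.
Proof.
move=> hR hA; rewrite /nabla_ext /curv_act; apply: mat_dot_ext => U W.
have dA X' Y' : d X' (A *m Y') = - d (A *m X') Y' by rewrite so_dot ?opprK.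
rewrite /ad_fun !(mlin, scalerDr, scalerN) -?scalemxAr -?scalemxAl -?mulmxA.
rewrite !wedgeE !(mlin, dlin, wedgeE) -?scalemxAr -?scalemxAl -?mulmxA !dlin ?dA ?dlin.
ring.
Qed.

(* The two basic curvature tensors: [sq_curv] is the square of the 2-form [e ^ f],
   [kn_curv H] the Kulkarni-Nomizu product of the metric with the self-adjoint [H]. *)
Definition sq_curv e f X Y : 'M[F]_n := (d e X * d f Y - d f X * d e Y) *: wg e f.

Definition kn_curv (H : V -> V) X Y : 'M[F]_n := wg (H X) Y + wg X (H Y).

Definition sym_pair e f X : V := d e X *: f + d f X *: e.

Lemma sq_curvP e f : algebraic_curvature (sq_curv e f).
Proof.
rewrite /sq_curv; split=> [a X X' Y|a X X' Y|X Y|X|X Y Z].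
- by rewrite !dlin scalerA -scalerDl; congr (_ *: _); ring.
- by rewrite !dlin scalerA -scalerDl; congr (_ *: _); ring.
- by rewrite rpredZ ?wedge_so.
- by rewrite mulrC subrr scale0r.
- apply: vec_dot_ext => W; rewrite -!scalemxAl !wedgeE !dlin dot0r; ring.
Qed.

Lemma kn_curvP H : (forall a X X', H (a *: X + X') = a *: H X + H X') ->
  (forall X Y, d (H X) Y = d X (H Y)) -> algebraic_curvature (kn_curv H).
Proof.
move=> Hl Hs; rewrite /kn_curv; split=> [a X X' Y|a X X' Y|X Y|X|X Y Z].
- by rewrite Hl !(wedgePl, wedgePr) scalerDr addrACA.
- by rewrite Hl !(wedgePl, wedgePr) scalerDr addrACA.
- by rewrite rpredD ?wedge_so.
- by rewrite wedgeC addNr.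
- apply: vec_dot_ext => W; rewrite !mlin !wedgeE !dlin dot0r !Hs.
  rewrite (dotC gT Z Y) (dotC gT X Z) (dotC gT Y X).
  rewrite -(Hs Y X) -(Hs Z Y) -(Hs X Z) (dotC gT (H Y)) (dotC gT (H Z)) (dotC gT (H X)).
  ring.
Qed.

Lemma sym_pair_curvP e f : algebraic_curvature (kn_curv (sym_pair e f)).
Proof.
apply: kn_curvP => [a X X'|X Y]; rewrite /sym_pair.
  by apply: vec_dot_ext => W; rewrite !dlin; ring.
by rewrite !dlin (dotC gT X f) (dotC gT X e); ring.
Qed.

Lemma id_curvP : algebraic_curvature wg.
Proof.
split=> [a X X' Y|a X X' Y|X Y|X|X Y Z]; rewrite ?wedgePl ?wedgePr ?wedge_so ?wedgexx //.
apply: vec_dot_ext => W; rewrite !wedgeE !dlin dot0r.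
by rewrite (dotC gT Z Y) (dotC gT X Z) (dotC gT Y X); ring.
Qed.

Lemma sq_curv_act A e f X Y : A \in so g -> curv_act A (sq_curv e f) X Y =
  (d (A *m e) X * d f Y - d f X * d (A *m e) Y + (d e X * d (A *m f) Y - d (A *m f) X * d e Y))
    *: wg e f
  + (d e X * d f Y - d f X * d e Y) *: (wg (A *m e) f + wg e (A *m f)).
Proof.
move=> hA; have dA X' Y' : d X' (A *m Y') = - d (A *m X') Y' by rewrite so_dot ?opprK.
have adZ a B : ad_fun A (a *: B) = a *: ad_fun A B by rewrite /ad_fun -scalemxAl -scalemxAr scalerBr.
rewrite /curv_act /sq_curv adZ ad_wedge // !dA.
by apply: mat_dot_ext => U W; rewrite !(mlin, scalerDr) -!scalemxAl !dlin; ring.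
Qed.

Lemma kn_curv_act A H X Y : A \in so g ->
  curv_act A (kn_curv H) X Y = kn_curv (fun X => A *m H X - H (A *m X)) X Y.
Proof.
move=> hA; rewrite /curv_act /kn_curv.
have adD B B' : ad_fun A (B + B') = ad_fun A B + ad_fun A B'.
  by rewrite /ad_fun mulmxDl mulmxDr opprD addrACA.
rewrite adD !ad_wedge // !(wedgeDl, wedgeDr, wedgeNl, wedgeNr).
by apply: mat_dot_ext => U W; rewrite !mlin !dlin; ring.
Qed.

Lemma sym_pair_act A e f X : A \in so g ->
  A *m sym_pair e f X - sym_pair e f (A *m X) = sym_pair (A *m e) f X + sym_pair e (A *m f) X.
Proof.
move=> hA; have dA X' Y' : d X' (A *m Y') = - d (A *m X') Y' by rewrite so_dot ?opprK.
apply: vec_dot_ext => W; rewrite /sym_pair !mulmxDr -!scalemxAr !dlin !dA; ring.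
Qed.

Lemma id_curv_act A X Y : A \in so g -> curv_act A wg X Y = 0.
Proof. by move=> hA; rewrite /curv_act ad_wedge // addrAC addrK subrr. Qed.

End CurvatureExtension.

(** * Candidate highest weight vectors *)

Section ExtensionVectors.
Variables (F : numFieldType) (n : nat) (g : 'M[F]_n).
Hypotheses (gT : g^T = g) (gU : g \in unitmx).
Local Notation V := 'cV[F]_n.
Local Notation d := (dot g).
Local Notation wg := (wedge g).
Local Notation rho := (rep_act (nabla_rep g)).
Implicit Types (e f x y X Y Z U W : V) (R : V -> V -> 'M[F]_n).

(** The default 0 is never met when [R] is an algebraic curvature tensor, by [nabla_ext_exists]. *)
Definition ext_vec e R : nabla_rep g :=
  xget 0 [set u : nabla_rep g | forall Z X Y, nab u Z X Y = nabla_ext g e R Z X Y].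

Lemma ext_vecE e R Z X Y : algebraic_curvature g R ->
  nab (ext_vec e R) Z X Y = nabla_ext g e R Z X Y.
Proof.
move=> hR; rewrite /ext_vec; case: xgetP => [u _ -> //|no].
by have [u hu] := nabla_ext_exists gT gU e hR; case: (no u).
Qed.

(** In these four names the digits are the degrees in e and in f; for e = b_o, f = b_p they are the
    first two coordinates of the weight. *)
Definition vec32 e f := ext_vec e (sq_curv g e f).
Definition vec30 e := ext_vec e (kn_curv g (sym_pair g e e)).
(** If A sends f to f plus a multiple of e, both terms change by the same multiple of the extension
    of e by the product with e squared; the difference is unaffected. *)
Definition vec21 e f :=
  ext_vec f (kn_curv g (sym_pair g e e)) - ext_vec e (kn_curv g (sym_pair g e f)).
Definition vec10 e := ext_vec e wg.

Let dlin := (dotDl, dotDr, dotZl, dotZr, dotNl, dotNr).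
Let scaleAl a (M : 'M[F]_n) X : (a *: M) *m X = a *: (M *m X).
Proof. by rewrite scalemxAl. Qed.
Let mlin := (mulmxDl, mulmxDr, mulmxBl, mulmxBr, mulmxN, mulNmx, scaleAl).
Let expand := (dlin, mlin).

Lemma ext_vec_act e R A Z X Y : algebraic_curvature g R -> A \in so g ->
  nab (rho A (ext_vec e R)) Z X Y =
  nabla_ext g (A *m e) R Z X Y + nabla_ext g e (curv_act A R) Z X Y.
Proof. by move=> hR hA; rewrite nab_act // !ext_vecE // nabla_ext_act. Qed.

Lemma nabZ a (u : nabla_rep g) Z X Y : nab (a *: u) Z X Y = a *: nab u Z X Y.
Proof.
have n0 : nab (0 : nabla_rep g) Z X Y = 0 by rewrite /nab linear0 !zero_lfunE.
by rewrite -[a *: u]addr0 nabP n0 addr0.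
Qed.

Lemma nabB (u v : nabla_rep g) Z X Y : nab (u - v) Z X Y = nab u Z X Y - nab v Z X Y.
Proof. by rewrite -scaleN1r addrC nabP scaleN1r addrC. Qed.

Let extPl a e e' R Z X Y :
  nabla_ext g (a *: e + e') R Z X Y = a *: nabla_ext g e R Z X Y + nabla_ext g e' R Z X Y.
Proof.
rewrite /nabla_ext wedgePr !dlin; apply: (mat_dot_ext gT gU) => U W.
by rewrite !expand; ring.
Qed.

Let extPr a e R R' Z X Y :
  nabla_ext g e (fun X Y => a *: R X Y + R' X Y) Z X Y =
  a *: nabla_ext g e R Z X Y + nabla_ext g e R' Z X Y.
Proof.
rewrite /nabla_ext mulmxDl -scalemxAl wedgePl; apply: (mat_dot_ext gT gU) => U W.
by rewrite !expand; ring.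
Qed.

Let extZl a e R Z X Y : nabla_ext g (a *: e) R Z X Y = a *: nabla_ext g e R Z X Y.
Proof.
rewrite /nabla_ext wedgeZr !dlin; apply: (mat_dot_ext gT gU) => U W.
by rewrite !expand; ring.
Qed.

Let extZr a e R Z X Y :
  nabla_ext g e (fun X Y => a *: R X Y) Z X Y = a *: nabla_ext g e R Z X Y.
Proof.
rewrite /nabla_ext -scalemxAl wedgeZl; apply: (mat_dot_ext gT gU) => U W.
by rewrite !expand; ring.
Qed.

Let kn_linear a (H H' : V -> V) X Y :
  kn_curv g (fun X => a *: H X + H' X) X Y = a *: kn_curv g H X Y + kn_curv g H' X Y.
Proof. by rewrite /kn_curv wedgePl wedgePr scalerDr addrACA. Qed.

Let sym_pairC e f : sym_pair g e f = sym_pair g f e.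
Proof. by apply/funext => X; rewrite /sym_pair addrC. Qed.

Let sym_pairPr a e f f' : sym_pair g e (a *: f + f') =
  fun X => a *: sym_pair g e f X + sym_pair g e f' X.
Proof.
apply/funext => X; rewrite /sym_pair dotPl scalerDl !scalerDr !scalerA addrACA.
by rewrite [d e X * a]mulrC.
Qed.

Let pairPr a e f f' X Y : kn_curv g (sym_pair g e (a *: f + f')) X Y =
  a *: kn_curv g (sym_pair g e f) X Y + kn_curv g (sym_pair g e f') X Y.
Proof. by rewrite sym_pairPr kn_linear. Qed.

Let pairZr a e f X Y :
  kn_curv g (sym_pair g e (a *: f)) X Y = a *: kn_curv g (sym_pair g e f) X Y.
Proof.
rewrite -[a *: f]addr0 pairPr [X in _ + X](_ : _ = 0) ?addr0 //.
have -> : sym_pair g e 0 = fun=> 0.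
  by apply/funext => X'; rewrite /sym_pair dot0l scale0r scaler0 addr0.
by rewrite /kn_curv wedge0l wedge0r addr0.
Qed.

Let pairZl a e f X Y :
  kn_curv g (sym_pair g (a *: e) f) X Y = a *: kn_curv g (sym_pair g e f) X Y.
Proof. by rewrite sym_pairC pairZr sym_pairC. Qed.

Section Action.
Variables (A : 'M[F]_n) (e f : V) (a b c : F).
(** A preserves the flag spanned by e and then f. This covers at once the Cartan elements (c = 0)
    and the strictly upper triangular elements (a = b = 0). *)
Hypotheses (hA : A \in so g) (Ae : A *m e = a *: e) (Af : A *m f = b *: f + c *: e).

Lemma vec32_act : rho A (vec32 e f) = (3 * a + 2 * b) *: vec32 e f.
Proof.
have hR := sq_curvP gT gU e f; apply: nab_inj => Z X Y.
rewrite nabZ (ext_vec_act e Z X Y hR hA) (ext_vecE e Z X Y hR) Ae.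
have -> : curv_act A (sq_curv g e f) = fun X Y => (2 * (a + b)) *: sq_curv g e f X Y.
  apply/funext => X'; apply/funext => Y'; rewrite sq_curv_act // Ae Af /sq_curv.
  rewrite !(wedgeDr, wedgeZr, wedgeZl, wedgexx) scaler0 addr0 !dlin -scalerDl !scalerA -scalerDl.
  by congr (_ *: _); ring.
by rewrite extZl extZr -scalerDl; congr (_ *: _); ring.
Qed.

Let act_pair e1 e2 X Y : curv_act A (kn_curv g (sym_pair g e1 e2)) X Y =
  kn_curv g (sym_pair g (A *m e1) e2) X Y + kn_curv g (sym_pair g e1 (A *m e2)) X Y.
Proof.
rewrite kn_curv_act //.
have -> : (fun X => A *m sym_pair g e1 e2 X - sym_pair g e1 e2 (A *m X)) =
    fun X => 1 *: sym_pair g (A *m e1) e2 X + sym_pair g e1 (A *m e2) X.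
  by apply/funext => X'; rewrite scale1r sym_pair_act.
by rewrite kn_linear scale1r.
Qed.

Let act_pair_ee : curv_act A (kn_curv g (sym_pair g e e)) =
  fun X Y => (2 * a) *: kn_curv g (sym_pair g e e) X Y.
Proof.
apply/funext => X; apply/funext => Y; rewrite act_pair Ae pairZl pairZr -scalerDl.
by congr (_ *: _); ring.
Qed.

Lemma vec30_act : rho A (vec30 e) = (3 * a) *: vec30 e.
Proof.
have hR := sym_pair_curvP gT gU e e; apply: nab_inj => Z X Y.
rewrite nabZ (ext_vec_act e Z X Y hR hA) (ext_vecE e Z X Y hR) act_pair_ee Ae extZl extZr -scalerDl.
by congr (_ *: _); ring.
Qed.

Lemma vec21_act : rho A (vec21 e f) = (2 * a + b) *: vec21 e f.
Proof.
have hR := sym_pair_curvP gT gU e e; have hR' := sym_pair_curvP gT gU e f.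
apply: nab_inj => Z X Y; rewrite nabZ /vec21 rep_act_subr !nabB.
set u := ext_vec f (kn_curv g (sym_pair g e e)); set v := ext_vec e (kn_curv g (sym_pair g e f)).
have Eu : nab (rho A u) Z X Y = _ := ext_vec_act f Z X Y hR hA.
have Ev : nab (rho A v) Z X Y = _ := ext_vec_act e Z X Y hR' hA.
have Fu : nab u Z X Y = _ := ext_vecE f Z X Y hR.
have Fv : nab v Z X Y = _ := ext_vecE e Z X Y hR'.
clearbody u v; rewrite Eu Ev Fu Fv.
have -> : curv_act A (kn_curv g (sym_pair g e f)) =
    fun X Y => (a + b) *: kn_curv g (sym_pair g e f) X Y + c *: kn_curv g (sym_pair g e e) X Y.
  apply/funext => X'; apply/funext => Y'; rewrite act_pair Ae Af pairZl pairPr pairZr.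
  by rewrite addrA -scalerDl.
rewrite act_pair_ee Ae Af extPl !extZl extPr !extZr.
move: (nabla_ext g f (kn_curv g (sym_pair g e e)) Z X Y) => K.
move: (nabla_ext g e (kn_curv g (sym_pair g e f)) Z X Y) => K'.
move: (nabla_ext g e (kn_curv g (sym_pair g e e)) Z X Y) => L.
by apply/matrixP => i j; rewrite !mxE; ring.
Qed.

Lemma vec10_act : rho A (vec10 e) = a *: vec10 e.
Proof.
have hR := id_curvP gT gU; apply: nab_inj => Z X Y.
rewrite nabZ (ext_vec_act e Z X Y hR hA) (ext_vecE e Z X Y hR).
have -> : curv_act A wg = fun X Y => 0 *: wg X Y.
  by apply/funext => X'; apply/funext => Y'; rewrite id_curv_act // scale0r.
by rewrite extZr Ae extZl scale0r addr0.
Qed.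

End Action.

Lemma ext_vec_sym e R x y y' : algebraic_curvature g R ->
  nab_sym (ext_vec e R) x x x y y' =
  12 * d e x * (d x (R x y *m y') + d x (R x y' *m y)).
Proof.
move=> hR; have sk X Y U W : d W (R X Y *m U) = - d U (R X Y *m W).
  by rewrite -so_dot ?(curv_so hR) // dotC.
have sk0 X Y U : d U (R X Y *m U) = 0.
  apply: (lin_solve (k := 2)); last by rewrite pnatr_eq0.
  by rewrite mulr_natl mulr2n {2}sk subrr.
(* The factor 4 is 2 + 1 from the first two terms of [nabla_ext] plus 1 from the wedge term; three
   cyclic terms then make 12. *)
have sE z z' : nab5 (ext_vec e R) x x z z' x = 4 * d e x * d x (R x z *m z').
  rewrite /nab5 ext_vecE // /nabla_ext (curv_xx hR) scaler0 addr0.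
  rewrite !expand wedgeE !dlin sk0 mulr0 sub0r (dotC gT (R x z *m x)).
  by rewrite (sk x z x z') (dotC gT x e); ring.
by rewrite /nab_sym /sym_form !sE; ring.
Qed.

Lemma nab_sym_B (u v : nabla_rep g) x1 x2 x3 y1 y2 :
  nab_sym (u - v) x1 x2 x3 y1 y2 = nab_sym u x1 x2 x3 y1 y2 - nab_sym v x1 x2 x3 y1 y2.
Proof. by rewrite -scaleN1r addrC nab_symP mulN1r addrC. Qed.

End ExtensionVectors.

(** * Complexification of the module *)

Section Complexification.
Variables (R : realType) (n : nat).
Local Notation C := R[i].
Local Notation toC := (map_mx (real_complex R)).
Local Notation ii := ('i%C : C).
Local Notation V := 'cV[R]_n.
Local Notation VC := 'cV[C]_n.

Definition re_mx m k (A : 'M[C]_(m, k)) : 'M[R]_(m, k) := map_mx (@complex.Re R) A.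
Definition im_mx m k (A : 'M[C]_(m, k)) : 'M[R]_(m, k) := map_mx (@complex.Im R) A.

Lemma re_mxP m k a (A B : 'M[C]_(m, k)) :
  re_mx ((real_complex R a) *: A + B) = a *: re_mx A + re_mx B.
Proof.
apply/matrixP => i j; rewrite !mxE; case: (A i j) => x y; case: (B i j) => z t /=.
by rewrite mul0r subr0.
Qed.

Lemma im_mxP m k a (A B : 'M[C]_(m, k)) :
  im_mx ((real_complex R a) *: A + B) = a *: im_mx A + im_mx B.
Proof.
apply/matrixP => i j; rewrite !mxE; case: (A i j) => x y; case: (B i j) => z t /=.
by rewrite mul0r addr0.
Qed.

Lemma re_mxK m k (A : 'M[R]_(m, k)) : re_mx (toC A) = A.
Proof. by apply/matrixP => i j; rewrite !mxE. Qed.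

Lemma mx_re_im m k (A : 'M[C]_(m, k)) : A = toC (re_mx A) + ii *: toC (im_mx A).
Proof. by apply/matrixP => i j; rewrite !mxE -complexE. Qed.

Lemma mx_re_im_inj m k (A A' B B' : 'M[R]_(m, k)) :
  toC A + ii *: toC B = toC A' + ii *: toC B' -> A = A' /\ B = B'.
Proof.
have rE (D D' : 'M[R]_(m, k)) : re_mx (toC D + ii *: toC D') = D.
  by apply/matrixP => i j; rewrite !mxE /=; ring.
have iE (D D' : 'M[R]_(m, k)) : im_mx (toC D + ii *: toC D') = D'.
  by apply/matrixP => i j; rewrite !mxE /=; ring.
move=> E; split; first by rewrite -(rE A B) E rE.
by rewrite -(iE A B) E iE.
Qed.

Lemma re_mxM m k l (A : 'M[C]_(m, k)) (B : 'M[R]_(k, l)) : re_mx (A *m toC B) = re_mx A *m B.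
Proof.
apply/matrixP => i j; rewrite !mxE raddf_sum /=; apply: eq_bigr => r _.
by rewrite !mxE; case: (A i r) => x y /=; rewrite mulr0 subr0.
Qed.

Lemma im_mxM m k l (A : 'M[C]_(m, k)) (B : 'M[R]_(k, l)) : im_mx (A *m toC B) = im_mx A *m B.
Proof.
apply/matrixP => i j; rewrite !mxE raddf_sum /=; apply: eq_bigr => r _.
by rewrite !mxE; case: (A i r) => x y /=; rewrite mulr0 add0r.
Qed.

Lemma toC_linear m k a (A B : 'M[R]_(m, k)) :
  toC (a *: A + B) = real_complex R a *: toC A + toC B.
Proof. by rewrite map_mxD map_mxZ. Qed.

Lemma real_vanish (E : lmodType C) (f : VC -> E) :
  (forall a X X', f (a *: X + X') = a *: f X + f X') ->
  (forall X : V, f (toC X) = 0) -> forall X, f X = 0.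
Proof. by move=> fl f0 X; rewrite [X]mx_re_im addrC fl !f0 scaler0 addr0. Qed.

Variable g : 'M[R]_n.
Local Notation gC := (toC g).

Lemma so_toC A : (toC A \in so gC) <-> (A \in so g).
Proof.
have E : (toC A)^T *m gC + gC *m toC A = toC (A^T *m g + g *m A).
  by rewrite map_mxD !map_mxM matrix.map_trmx.
split=> /mem_so h; apply/mem_so; last by rewrite E h map_mx0.
have := h; rewrite E => h'.
by have := congr1 (@re_mx _ _) h'; rewrite re_mxK => ->; apply/matrixP => i j; rewrite !mxE.
Qed.

Lemma so_re_im A : A \in so gC -> re_mx A \in so g /\ im_mx A \in so g.
Proof.
move=> /mem_so h; have E (T U : 'M[R]_n) : (toC T + 'i%C *: toC U)^T *m gC + gC *m (toC T + 'i%C *: toC U) =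
    toC (T^T *m g + g *m T) + 'i%C *: toC (U^T *m g + g *m U).
  rewrite linearD linearZ /= mulmxDl mulmxDr -scalemxAl -scalemxAr addrACA -scalerDr.
  by rewrite !map_mxD !map_mxM !matrix.map_trmx.
have e : toC ((re_mx A)^T *m g + g *m re_mx A) + 'i%C *: toC ((im_mx A)^T *m g + g *m im_mx A)
    = toC 0 + 'i%C *: toC 0.
  by rewrite -E -mx_re_im h !map_mx0 scaler0 addr0.
by have [h1 h2] := mx_re_im_inj e; split; apply/mem_so.
Qed.

Let lc (G : 'I_n -> 'M[C]_n) (X : VC) : 'M[C]_n := \sum_i X i 0 *: G i.

Let lcP G a X X' : lc G (a *: X + X') = a *: lc G X + lc G X'.
Proof.
rewrite /lc scaler_sumr -big_split; apply: eq_bigr => i _ /=.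
by rewrite !mxE scalerDl scalerA.
Qed.

Let lc_lin G G1 G2 a X : (forall i, G i = a *: G1 i + G2 i) ->
  lc G X = a *: lc G1 X + lc G2 X.
Proof.
move=> E; rewrite /lc scaler_sumr -big_split; apply: eq_bigr => i _ /=.
by rewrite E scalerDr !scalerA mulrC.
Qed.

Let lc_real (f : V -> 'M[R]_n) X : (forall a X X', f (a *: X + X') = a *: f X + f X') ->
  lc (fun i => toC (f (delta_mx i 0))) (toC X) = toC (f X).
Proof.
move=> fl; rewrite /lc {2}[X]col_sum_delta.
elim: (index_enum _) => [|i r IH]; last by rewrite !big_cons IH fl toC_linear !mxE.
rewrite !big_nil; have := fl 1 0 0; rewrite !scale1r !addr0 => /esym/eqP.
by rewrite -subr_eq0 addrK => /eqP ->; rewrite map_mx0.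
Qed.

(** The complex trilinear extension is written through the values on the standard basis. Each
    defining identity is linear in every argument, so it can be checked on real vectors. *)
Lemma complexify_exists (u : nabla_rep g) : exists w : nabla_rep gC,
  forall X Y Z, nab w (toC X) (toC Y) (toC Z) = toC (nab u X Y Z).
Proof.
pose s X Y Z := lc (fun i => lc (fun j => lc (fun k =>
  toC (nab u (delta_mx i 0) (delta_mx j 0) (delta_mx k 0))) Z) Y) X.
have s1 a X X' Y Z : s (a *: X + X') Y Z = a *: s X Y Z + s X' Y Z by rewrite /s lcP.
have s2 a X X' Y Z : s Y (a *: X + X') Z = a *: s Y X Z + s Y X' Z.
  by apply: lc_lin => i; rewrite lcP.
have s3 a X X' Y Z : s Y Z (a *: X + X') = a *: s Y Z X + s Y Z X'.
  by apply: lc_lin => i; apply: lc_lin => j; rewrite lcP.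
have sE X Y Z : s (toC X) (toC Y) (toC Z) = toC (nab u X Y Z).
  rewrite -(lc_real (f := fun X => nab u X Y Z)) => [|a ? ?]; last by rewrite nabP1.
  apply: eq_bigr => i _; congr (_ *: _).
  rewrite -(lc_real (f := fun Y => nab u _ Y Z)) => [|a ? ?]; last by rewrite nabP2.
  apply: eq_bigr => j _; congr (_ *: _).
  by rewrite -(lc_real (f := fun Z => nab u _ _ Z)) => [|a ? ?]; last by rewrite nabP3.
have sso X Y Z : s X Y Z \in so gC.
  apply/mem_so; pose f (A : 'M[C]_n) := A^T *m gC + gC *m A.
  have fl a A B : f (a *: A + B) = a *: f A + f B.
    by rewrite /f linearP mulmxDl mulmxDr -scalemxAl -scalemxAr addrACA -scalerDr.
  apply: (real_vanish (f := fun X => f (s X Y Z))) => [a ? ?|{}X]; first by rewrite s1 fl.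
  apply: (real_vanish (f := fun Y => f (s _ Y Z))) => [a ? ?|{}Y]; first by rewrite s2 fl.
  apply: (real_vanish (f := fun Z => f (s _ _ Z))) => [a ? ?|{}Z]; first by rewrite s3 fl.
  by rewrite sE; apply/mem_so/so_toC; apply: nab_so.
have sC X Y Z : s X Y Z + s X Z Y = 0.
  apply: (real_vanish (f := fun X => s X Y Z + s X Z Y)) => [a ? ?|{}X].
    by rewrite !s1 addrACA scalerDr.
  apply: (real_vanish (f := fun Y => s _ Y Z + s _ Z Y)) => [a ? ?|{}Y].
    by rewrite s2 s3 addrACA scalerDr.
  apply: (real_vanish (f := fun Z => s _ _ Z + s _ Z _)) => [a ? ?|{}Z].
    by rewrite s2 s3 addrACA scalerDr.
  by rewrite !sE -map_mxD nabC addNr map_mx0.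
suff [w hw] : exists w : nabla_rep gC, forall X Y Z, nab w X Y Z = s X Y Z.
  by exists w => X Y Z; rewrite hw sE.
apply: (@nab_make _ _ _ s) => // [X Y|X Y Z W|X Y Z].
- have := sC X Y Y; rewrite -mulr2n -scaler_nat => /eqP.
  by rewrite scaler_eq0 pnatr_eq0 => /eqP.
- apply: (real_vanish (f := fun X => s X Y Z *m W + s X Z W *m Y + s X W Y *m Z)) => [a ? ?|{}X].
    by rewrite !s1 !mulmxDl -!scalemxAl scaler_sum3.
  apply: (real_vanish (f := fun Y => s _ Y Z *m W + s _ Z W *m Y + s _ W Y *m Z)) => [a ? ?|{}Y].
    by rewrite s2 s3 !mulmxDl mulmxDr -!scalemxAl -scalemxAr scaler_sum3.
  apply: (real_vanish (f := fun Z => s _ _ Z *m W + s _ Z W *m _ + s _ W _ *m Z)) => [a ? ?|{}Z].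
    by rewrite s2 s3 !mulmxDl mulmxDr -!scalemxAl -scalemxAr scaler_sum3.
  apply: (real_vanish (f := fun W => s _ _ _ *m W + s _ _ W *m _ + s _ W _ *m _)) => [a ? ?|{}W].
    by rewrite s2 s3 !mulmxDl mulmxDr -!scalemxAl -scalemxAr scaler_sum3.
  by rewrite !sE -!map_mxM -!map_mxD nab_bianchi1 map_mx0.
- apply: (real_vanish (f := fun X => s X Y Z + s Y Z X + s Z X Y)) => [a ? ?|{}X].
    by rewrite s1 s2 s3 scaler_sum3.
  apply: (real_vanish (f := fun Y => s _ Y Z + s Y Z _ + s Z _ Y)) => [a ? ?|{}Y].
    by rewrite s1 s2 s3 scaler_sum3.
  apply: (real_vanish (f := fun Z => s _ _ Z + s _ Z _ + s Z _ _)) => [a ? ?|{}Z].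
    by rewrite s1 s2 s3 scaler_sum3.
  by rewrite !sE -!map_mxD nab_bianchi2 map_mx0.
Qed.

Definition complexify (u : nabla_rep g) : nabla_rep gC :=
  xget 0 [set w : nabla_rep gC |
    forall X Y Z, nab w (toC X) (toC Y) (toC Z) = toC (nab u X Y Z)].

Lemma complexifyE u X Y Z :
  nab (complexify u) (toC X) (toC Y) (toC Z) = toC (nab u X Y Z).
Proof.
rewrite /complexify; case: xgetP => [w _ -> //|no].
by have [w hw] := complexify_exists u; case: (no w).
Qed.

Lemma nab_real_ext (w w' : nabla_rep gC) :
  (forall X Y Z : V, nab w (toC X) (toC Y) (toC Z) = nab w' (toC X) (toC Y) (toC Z)) -> w = w'.
Proof.
move=> E; apply: nab_inj => X Y Z; apply/eqP; rewrite -subr_eq0; apply/eqP.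
have lin (a : C) (A B A' B' : 'M[C]_n) : a *: A + B - (a *: A' + B') = a *: (A - A') + (B - B').
  by rewrite scalerBr opprD addrACA.
apply: (real_vanish (f := fun X => nab w X Y Z - nab w' X Y Z)) => [a ? ?|{}X].
  by rewrite !nabP1 lin.
apply: (real_vanish (f := fun Y => nab w _ Y Z - nab w' _ Y Z)) => [a ? ?|{}Y].
  by rewrite !nabP2 lin.
apply: (real_vanish (f := fun Z => nab w _ _ Z - nab w' _ _ Z)) => [a ? ?|{}Z].
  by rewrite !nabP3 lin.
by rewrite E subrr.
Qed.

Lemma complexify_intertwiner : real_intertwiner complexify.
Proof.
split=> [a u v|A hA u]; apply: nab_real_ext => X Y Z.
  by rewrite nabP !complexifyE nabP toC_linear.
rewrite complexifyE (nab_act _ _ _ _ hA) (nab_act _ _ _ _ (proj2 (so_toC A) hA)).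
by rewrite -!map_mxM !complexifyE /ad_fun !map_mxB !map_mxM.
Qed.

(** The inverse takes real and imaginary parts of the restriction to real vectors; all defining
    identities have real coefficients, so both parts are elements of the real module. *)
Lemma complexify_bijective :
  bijective (fun x : nabla_rep g * nabla_rep g => complexify x.1 + 'i%C *: complexify x.2).
Proof.
have iE (u v : nabla_rep g) X Y Z : nab (complexify u + 'i%C *: complexify v) (toC X) (toC Y) (toC Z)
    = toC (nab u X Y Z) + 'i%C *: toC (nab v X Y Z).
  by rewrite addrC nabP !complexifyE addrC.
have re_im_exist (w : nabla_rep gC) : exists x : nabla_rep g * nabla_rep g,
    complexify x.1 + 'i%C *: complexify x.2 = w.
  have toCP (a : R) (X X' : V) : toC (a *: X + X') = real_complex R a *: toC X + toC X'.
    exact: toC_linear.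
  have [u hu] : exists u : nabla_rep g, forall X Y Z,
      nab u X Y Z = re_mx (nab w (toC X) (toC Y) (toC Z)).
    apply: nab_make => [a ????|a ????|a ????|X Y Z|X Y|X Y Z W|X Y Z].
    - by rewrite toCP nabP1 re_mxP.
    - by rewrite toCP nabP2 re_mxP.
    - by rewrite toCP nabP3 re_mxP.
    - by have [] := so_re_im (nab_so w (toC X) (toC Y) (toC Z)).
    - by rewrite nabxx; apply/matrixP => i j; rewrite !mxE.
    - rewrite -!re_mxM -[LHS]scale1r !scalerDr.
      have := congr1 (@re_mx _ _) (nab_bianchi1 w (toC X) (toC Y) (toC Z) (toC W)).
      rewrite [re_mx 0](_ : _ = 0); last by apply/matrixP => i j; rewrite !mxE.
      by move=> <-; apply/matrixP => i j; rewrite !(mxE, mul1r) !raddfD.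
    - have := congr1 (@re_mx _ _) (nab_bianchi2 w (toC X) (toC Y) (toC Z)).
      rewrite [re_mx 0](_ : _ = 0); last by apply/matrixP => i j; rewrite !mxE.
      by move=> <-; apply/matrixP => i j; rewrite !mxE !raddfD.
  have [v hv] : exists u : nabla_rep g, forall X Y Z,
      nab u X Y Z = im_mx (nab w (toC X) (toC Y) (toC Z)).
    apply: nab_make => [a ????|a ????|a ????|X Y Z|X Y|X Y Z W|X Y Z].
    - by rewrite toCP nabP1 im_mxP.
    - by rewrite toCP nabP2 im_mxP.
    - by rewrite toCP nabP3 im_mxP.
    - by have [] := so_re_im (nab_so w (toC X) (toC Y) (toC Z)).
    - by rewrite nabxx; apply/matrixP => i j; rewrite !mxE.
    - rewrite -!im_mxM.
      have := congr1 (@im_mx _ _) (nab_bianchi1 w (toC X) (toC Y) (toC Z) (toC W)).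
      rewrite [im_mx 0](_ : _ = 0); last by apply/matrixP => i j; rewrite !mxE.
      by move=> <-; apply/matrixP => i j; rewrite !mxE !raddfD.
    - have := congr1 (@im_mx _ _) (nab_bianchi2 w (toC X) (toC Y) (toC Z)).
      rewrite [im_mx 0](_ : _ = 0); last by apply/matrixP => i j; rewrite !mxE.
      by move=> <-; apply/matrixP => i j; rewrite !mxE !raddfD.
  exists (u, v); apply: nab_real_ext => X Y Z.
  by rewrite iE hu hv -mx_re_im.
have [h hK] := choice re_im_exist; exists h => [[u v]|w]; last exact: hK.
have := hK (complexify u + 'i%C *: complexify v); case: (h _) => u' v' /= E.
have EE X Y Z : nab u' X Y Z = nab u X Y Z /\ nab v' X Y Z = nab v X Y Z.
  by apply: mx_re_im_inj; rewrite -!iE E.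
by congr (_, _); apply: nab_inj => X Y Z; have [] := EE X Y Z.
Qed.

End Complexification.

(** * Irreducibility and eigenspaces of real forms *)

Section RealForms.
Variables (R : realType) (n : nat) (g : 'M[R]_n).
Local Notation C := R[i].
Local Notation toC := (map_mx (real_complex R)).
Local Notation gC := (toC g).
Variables (V : lie_rep (so g)) (W : lie_rep (so gC)) (f : V -> W).
Hypothesis hf : real_intertwiner f.
Hypothesis bf : bijective (fun x : V * V => f x.1 + 'i%C *: f x.2).

Let fP a u v : f (a *: u + v) = real_complex R a *: f u + f v.
Proof. exact: (proj1 hf). Qed.
Let f0 : f 0 = 0.
Proof.
have := fP 1 0 0; rewrite !scale1r addr0 => /esym/eqP.
by rewrite -subr_eq0 addrK => /eqP.
Qed.
Let fD u v : f (u + v) = f u + f v.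
Proof. by rewrite -[u]scale1r fP rmorph1 !scale1r. Qed.
Let fZ a u : f (a *: u) = real_complex R a *: f u.
Proof. by rewrite -[a *: u]addr0 fP f0 addr0. Qed.
Let fN u : f (- u) = - f u.
Proof. by rewrite -scaleN1r fZ rmorphN1 scaleN1r. Qed.
Let fsum (I : Type) (s : seq I) (u : I -> V) : f (\sum_(i <- s) u i) = \sum_(i <- s) f (u i).
Proof. by elim: s => [|i s IH]; rewrite ?big_nil ?f0 // !big_cons fD IH. Qed.

Let f_re_im w : exists u v, w = f u + 'i%C *: f v.
Proof. by have [h _ hK] := bf; exists (h w).1, (h w).2; rewrite hK. Qed.
Let f_inj u v u' v' : f u + 'i%C *: f v = f u' + 'i%C *: f v' -> u = u' /\ v = v'.
Proof.
have [h hK _] := bf => E; have e1 := hK (u, v); have e2 := hK (u', v').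
by rewrite /= E in e1; rewrite /= e1 in e2; case: e2.
Qed.
Let f_eq0 u v : f u + 'i%C *: f v = 0 -> u = 0 /\ v = 0.
Proof. by move=> E; apply: f_inj; rewrite E f0 scaler0 addr0. Qed.

Lemma real_form_inj u v : f u = f v -> u = v.
Proof. by move=> e; have [] : u = v /\ (0 : V) = 0 by apply: f_inj; rewrite e. Qed.

(** A stable real subspace U gives the stable complex subspace U + iU, which is zero or
    everything. *)
Lemma real_form_irreducible : rep_irreducible W -> rep_irreducible V.
Proof.
move=> [dW irr]; split.
  rewrite lt0n dimv_eq0; apply/negP => /eqP V0.
  have z (u : V) : u = 0 by apply/eqP; rewrite -memv0 -V0 memvf.
  have : (fullv : {vspace W}) = 0%VS.
    apply/eqP; rewrite -subv0; apply/subvP => w _; have [u [v ->]] := f_re_im w.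
    by rewrite (z u) (z v) f0 scaler0 addr0 mem0v.
  by move/eqP; rewrite -dimv_eq0; move: dW; rewrite lt0n => /negbTE ->.
move=> U stU.
pose UC : {vspace W} := subspace_of
  [set w : W | exists u v, [/\ u \in U, v \in U & w = f u + 'i%C *: f v]].
have memUC w : w \in UC <-> exists u v, [/\ u \in U, v \in U & w = f u + 'i%C *: f v].
  apply: mem_subspace_of => [|a w1 w2 [u1 [v1 [Uu1 Uv1 ->]]] [u2 [v2 [Uu2 Uv2 ->]]]].
    by exists 0, 0; rewrite mem0v f0 scaler0 addr0.
  exists (complex.Re a *: u1 - complex.Im a *: v1 + u2), (complex.Im a *: u1 + complex.Re a *: v1 + v2).
  split; [by rewrite rpredD ?rpredB ?rpredZ|by rewrite !rpredD ?rpredZ|].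
  rewrite {1}[a]complexE.
  rewrite !(fD, fN, fZ) !scalerDr !scalerDl !scalerA.
  have ii : 'i%C * 'i%C = -1 :> C by rewrite -expr2 sqr_i.
  have -> : 'i%C * real_complex R (complex.Im a) * 'i%C = - real_complex R (complex.Im a).
    by rewrite mulrAC ii mulN1r.
  rewrite scaleNr [real_complex R (complex.Re a) * 'i%C]mulrC.
  by rewrite [LHS](AC ((2*2)*2) ((1*4*5)*(2*3*6)))%AC.
have stUC : rep_stable UC.
  move=> A hA w /memUC [u [v [Uu Uv ->]]]; have [h1 h2] := so_re_im hA.
  have t1 := proj2 (so_toC _ _) h1; have t2 := proj2 (so_toC _ _) h2.
  have fA B x : B \in so g -> rep_act W (toC B) (f x) = f (rep_act V B x).
    by move=> hB; rewrite (proj2 hf).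
  apply/memUC; exists (rep_act V (re_mx A) u - rep_act V (im_mx A) v),
    (rep_act V (im_mx A) u + rep_act V (re_mx A) v).
  split; [by rewrite rpredB ?stU|by rewrite rpredD ?stU|].
  rewrite {1}[A]mx_re_im rep_actD ?rpredZ // rep_actZ // add_lfunE scale_lfunE.
  rewrite !linearD !linearZ /= !fA // !(fD, fN) !scalerDr !scalerA.
  have ii : 'i%C * 'i%C = -1 :> C by rewrite -expr2 sqr_i.
  by rewrite ii scaleN1r [LHS](AC (2*2) ((1*4)*(3*2)))%AC.
have [U0|Ufull] := irr UC stUC; [left|right].
  apply/eqP; rewrite -subv0; apply/subvP => u Uu.
  have : f u + 'i%C *: f 0 \in UC by apply/memUC; exists u, 0; rewrite mem0v.
  rewrite U0 => h; have /f_eq0 [-> _] : f u + 'i%C *: f 0 = 0 by apply/eqP; rewrite -memv0.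
  by rewrite mem0v.
apply/eqP; rewrite eqEsubv subvf; apply/subvP => u _.
have : f u + 'i%C *: f 0 \in UC by rewrite Ufull memvf.
by move/memUC => [u' [v' [Uu' _ e]]]; have [-> _] := f_inj e.
Qed.

Section Eigenspaces.
Variables (Zr : 'End(V)) (Zc : 'End(W)).
Hypothesis fZr : forall v, f (Zr v) = Zc (f v).
Local Notation Er c := (lker (Zr - c *: \1%VF)).
Local Notation Ec c := (lker (Zc - (real_complex R c) *: \1%VF)).

Let memEr c v : reflect (Zr v = c *: v) (v \in Er c).
Proof. by apply: (iffP eqlfunP); rewrite scale_lfunE id_lfunE. Qed.
Let memEc c w : reflect (Zc w = real_complex R c *: w) (w \in Ec c).
Proof. by apply: (iffP eqlfunP); rewrite scale_lfunE id_lfunE. Qed.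

Let f_Er c v : v \in Er c -> f v \in Ec c.
Proof. by move=> /memEr h; apply/memEc; rewrite -fZr h fZ. Qed.

Let Ec_split c w : w \in Ec c ->
  exists u v, [/\ u \in Er c, v \in Er c & w = f u + 'i%C *: f v].
Proof.
have [u [v wE]] := f_re_im w => /memEc h; exists u, v.
suff [h1 h2] : Zr u = c *: u /\ Zr v = c *: v by split=> //; apply/memEr.
apply: f_inj; rewrite !fZr !fZ scalerA mulrC -scalerA -scalerDr -wE -h wE.
by rewrite linearD linearZ.
Qed.

(** As the operator is real and so is the eigenvalue, the real and imaginary parts of a complex
    eigenvector are eigenvectors. *)
Lemma real_form_eigenspace c (hLr : lie_closed (so g)) (hLc : lie_closed (so gC))
    (sr : rep_stable (Er c)) (sc : rep_stable (Ec c)) :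
  is_real_form (rep_sub sr hLr) (rep_sub sc hLc).
Proof.
pose F (v : rep_sub sr hLr) : rep_sub sc hLc := vsproj (Ec c) (f (vsval v)).
have FE v : vsval (F v) = f (vsval v) by rewrite /F vsprojK // f_Er // subvsP.
exists F.
  split=> [a u v|A hA v]; apply: val_inj.
    have e : vsval (a *: u + v) = a *: vsval u + vsval v by [].
    have e' : vsval (real_complex R a *: F u + F v) = real_complex R a *: vsval (F u) + vsval (F v) by [].
    by rewrite -[LHS]/(vsval _) -[RHS]/(vsval _) e' !FE e fP.
  rewrite -[LHS]/(vsval _) -[RHS]/(vsval _) FE sub_actE // (proj2 hf) // (sub_actE sc) ?FE //.
  exact/so_toC.
have key (w : rep_sub sc hLc) : exists x : rep_sub sr hLr * rep_sub sr hLr, F x.1 + 'i%C *: F x.2 = w.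
  have [u [v [Eu Ev wE]]] := Ec_split (subvsP w).
  exists (vsproj _ u, vsproj _ v); apply: val_inj.
  have e (x y : rep_sub sc hLc) : vsval (x + 'i%C *: y) = vsval x + 'i%C *: vsval y by [].
  by rewrite -[LHS]/(vsval _) e !FE !vsprojK.
have [h hK] := choice key; exists h => [[u v]|w]; last exact: hK.
have e0 (x y : rep_sub sc hLc) : vsval (x + 'i%C *: y) = vsval x + 'i%C *: vsval y by [].
have := congr1 vsval (hK (F u + 'i%C *: F v)); case: (h _) => u' v'.
rewrite !e0 !FE => e; have [e1 e2] := f_inj e.
by congr (_, _); apply: val_inj.
Qed.

Lemma real_form_eigenspace_sum (I : finType) (c : I -> R) :
  (\sum_i Ec (c i))%VS = fullv -> (\sum_i Er (c i))%VS = fullv.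
Proof.
move=> E; apply/eqP; rewrite eqEsubv subvf; apply/subvP => u _.
have : f u \in (\sum_i Ec (c i))%VS by rewrite E memvf.
move=> /memv_sumP [w Ew fu].
have ex i : exists y : V * V,
    [/\ y.1 \in Er (c i), y.2 \in Er (c i) & w i = f y.1 + 'i%C *: f y.2].
  by have [a [b hab]] := Ec_split (Ew i isT); exists (a, b).
have [x hx] := choice ex.
have : f u + 'i%C *: f 0 = f (\sum_i (x i).1) + 'i%C *: f (\sum_i (x i).2).
  rewrite f0 scaler0 addr0 fu !fsum scaler_sumr -big_split; apply: eq_bigr => i _.
  by have [_ _] := hx i.
move=> e; have [-> _] := f_inj e; apply: memv_sumr => i _.
by have [] := hx i.
Qed.
End Eigenspaces.


End RealForms.

(** * Classification of singular vectors by their coefficients *)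

Section ClassificationBySlots.
Variables (C : numClosedFieldType) (n : nat) (g P : 'M[C]_n).
Hypothesis hP : is_witt_basis g P.
Hypothesis n3 : (3 <= n)%N.
Local Notation b i := (col i P).
Local Notation o := (ord_fst n3).
Local Notation p := (ord_snd n3).
Local Notation q := (rev_ord p).
Local Notation N := (rev_ord o).

Definition slot (u : nabla_rep g) (l m : 'I_n) : C :=
  nab_sym u (b N) (b N) (b N) (b l) (b m).

Lemma slot_weight u lam l m k : is_weight P u lam -> slot u l m != 0 ->
  lam k = - (eps C k N + eps C k N + eps C k N + eps C k l + eps C k m).
Proof. exact: nab_sym_weight. Qed.

Variables (I : finType) (v : I -> nabla_rep g) (mu : I -> 'I_n -> C) (sl : I -> 'I_n * 'I_n).
Hypothesis v_weight : forall i, is_weight P (v i) (mu i).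
Hypothesis v_singular : forall i, is_singular P (v i).
Hypothesis v_slot : forall i, slot (v i) (sl i).1 (sl i).2 != 0.
Hypothesis mu_distinct : forall i j, i != j -> exists k, mu i k != mu j k.
Hypothesis sl_complete : forall u lam, is_weight P u lam -> is_singular P u ->
  (forall i, slot u (sl i).1 (sl i).2 = 0) -> u = 0.

(** A nonzero coefficient determines the weight. So u shares the weight of some [v i], and
    subtracting the right multiple kills coefficient i; the other coefficients vanish because they
    belong to other weights. *)
Lemma slot_classification u lam : u != 0 -> is_weight P u lam -> is_singular P u ->
  exists i a, u = a *: v i.
Proof.
move=> u0 wu su.
have [i ui] : exists i, slot u (sl i).1 (sl i).2 != 0.
  apply: contrapT => no; case/eqP: u0; apply: (sl_complete wu su) => i.
  by apply/eqP/negPn/negP => h; apply: no; exists i.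
pose a := slot u (sl i).1 (sl i).2 / slot (v i) (sl i).1 (sl i).2.
exists i, a; apply/eqP; rewrite -subr_eq0; apply/eqP.
have lamE : lam =1 mu i.
  by move=> k; rewrite (slot_weight k wu ui) (slot_weight k (v_weight i) (v_slot i)).
pose w := u - a *: v i.
have slB l m : slot w l m = slot u l m - a * slot (v i) l m.
  by rewrite /slot /w addrC -scaleNr nab_symP mulNr addrC.
have ww : is_weight P w lam.
  by move=> k; rewrite /w rep_act_subr rep_act_scaler wu v_weight lamE scalerBr !scalerA mulrC.
have sw : is_singular P w.
  by move=> k l kl; rewrite /w rep_act_subr rep_act_scaler su // v_singular // scaler0 subr0.
apply: (sl_complete ww sw) => j; have [<-|ij] := eqVneq i j.
  by rewrite slB /a divfK ?subrr // v_slot.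
apply/eqP/negPn/negP => h; have [k /eqP] := mu_distinct ij; case.
by rewrite -lamE (slot_weight k ww h) (slot_weight k (v_weight j) (v_slot j)).
Qed.

End ClassificationBySlots.

(** * The Casimir scalar of a weight supported on the first two coordinates *)

Section CasimirValue.
Variables (F : numFieldType) (n : nat).
Implicit Types i j k : 'I_n.

Lemma sum_eps i (h : 'I_n -> F) : \sum_k eps F k i * h k = h i - h (rev_ord i).
Proof.
rewrite /eps; under eq_bigr => k _ do rewrite mulrBl.
rewrite sumrB; congr (_ - _).
  rewrite (bigD1 i) //= eqxx mul1r big1 ?addr0 // => k /negbTE.
  by rewrite eq_sym => ->; rewrite mul0r.
rewrite (bigD1 (rev_ord i)) //= rev_ordK eqxx mul1r big1 ?addr0 // => k ki.
suff /negbTE -> : i != rev_ord k by rewrite mul0r.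
by apply: contra ki => /eqP ->; rewrite rev_ordK.
Qed.

Lemma two_rho_rev i : two_rho F (rev_ord i) = - two_rho F i.
Proof.
rewrite /two_rho rev_ordK (reindex_inj rev_ord_inj) /= -sumrN.
apply: eq_big => [j|j _]; first by rewrite -(inj_eq rev_ord_inj) rev_ordK.
rewrite opprB; congr (_%:R - _%:R); congr nat_of_bool;
  by have := ltn_ord i; have := ltn_ord j; lia.
Qed.

Lemma casimir_value (n3 : (3 <= n)%N) (l1 l2 : F)
    (mu := fun k => l1 * eps F k (ord_fst n3) + l2 * eps F k (ord_snd n3)) :
  \sum_k mu k ^+ 2 + \sum_k mu k * two_rho F k =
  2 * l1 ^+ 2 + 2 * l1 * (n%:R - 2) +
  (if (3 < n)%N then 2 * l2 ^+ 2 + 2 * l2 * (n%:R - 4) else 0).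
Proof.
set o := ord_fst n3; set p := ord_snd n3.
have lin (h : 'I_n -> F) : \sum_k mu k * h k =
    l1 * (h o - h (rev_ord o)) + l2 * (h p - h (rev_ord p)).
  rewrite -!sum_eps !mulr_sumr -big_split; apply: eq_bigr => k _ /=.
  by rewrite /mu mulrDl !mulrA.
have -> : \sum_k mu k ^+ 2 = \sum_k mu k * mu k by apply: eq_bigr => k _; rewrite expr2.
rewrite !lin !two_rho_rev {1 2 3 4}/mu !eps_rev_l -/o -/p.
have eoo : eps F o o = 1.
  by rewrite /eps eqxx -val_eqE /= subn1 (_ : (0 == n.-1)%N = false) ?subr0 //; lia.
have eop : eps F o p = 0.
  by rewrite /eps -!val_eqE /= subn1 (_ : (1 == n.-1)%N = false) ?subrr //; lia.
have epo : eps F p o = 0.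
  by rewrite /eps -!val_eqE /= subn2 (_ : (0 == n.-2)%N = false) ?subrr //; lia.
rewrite eoo eop epo (two_rhoE _ (i := o)); last by rewrite /= subn1; lia.
case: ifP => n4.
  have epp : eps F p p = 1.
    by rewrite /eps eqxx -val_eqE /= subn2 (_ : (1 == n.-2)%N = false) ?subr0 //; lia.
  by rewrite epp (two_rhoE _ (i := p)) /=; [ring|rewrite subn2; lia].
(* Only n = 3 is left: the second index is its own reverse and the second coordinate contributes
   nothing. *)
have pp : rev_ord p = p by apply: val_inj; rewrite /= subn2; move/negbT: n4; move: (n3); lia.
have epp : eps F p p = 0 by rewrite /eps pp subrr.
have tp : two_rho F p = 0.
  by apply: (lin_solve (k := 2)); rewrite ?pnatr_eq0 // mulr_natl mulr2n -{2}pp two_rho_rev subrr.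
by rewrite epp tp /=; ring.
Qed.

End CasimirValue.

(** The digits are the first two coordinates of the highest weight. The boolean negates the second
    one, by taking b_q in place of b_p; this is used for n = 4. *)
Inductive hw_kind := HW32 of bool | HW30 | HW21 of bool | HW10.

(** * The explicit highest weight vectors and their decisive coefficients *)

Section HighestVectors.
Variables (C : numClosedFieldType) (n : nat) (g P : 'M[C]_n).
Hypothesis hP : is_witt_basis g P.
Hypothesis n3 : (3 <= n)%N.
Local Notation b i := (col i P).
Local Notation o := (ord_fst n3).
Local Notation p := (ord_snd n3).
Local Notation q := (rev_ord p).
Local Notation N := (rev_ord o).
Local Notation rho := (rep_act (nabla_rep g)).
Local Notation d := (dot g).

Let gT := metric_sym hP.
Let gU := metric_unit hP.

Definition hw_l1 k : nat := match k with HW32 _ => 3 | HW30 => 3 | HW21 _ => 2 | HW10 => 1 end.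
Definition hw_l2 k : nat := match k with HW32 _ => 2 | HW30 => 0 | HW21 _ => 1 | HW10 => 0 end.
Definition hw_flip k : bool := match k with HW32 s => s | HW30 => false | HW21 s => s | HW10 => false end.
Definition hw_snd k : 'I_n := if hw_flip k then q else p.

Definition hw_vec k : nabla_rep g :=
  match k with
  | HW32 s => vec32 g (b o) (b (hw_snd k))
  | HW30 => vec30 g (b o)
  | HW21 s => vec21 g (b o) (b (hw_snd k))
  | HW10 => vec10 g (b o)
  end.

(** The pair (l,m) for which the coefficient at b_N, b_N, b_N, b_l, b_m has the weight of
    [hw_vec k]. *)
Definition hw_slot k : 'I_n * 'I_n :=
  match k with
  | HW32 s => (rev_ord (hw_snd k), rev_ord (hw_snd k))
  | HW30 => (p, q)
  | HW21 s => (o, rev_ord (hw_snd k))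
  | HW10 => (o, o)
  end.

Lemma hw_vec_act k A a bb c : A \in so g -> A *m b o = a *: b o ->
  A *m b (hw_snd k) = bb *: b (hw_snd k) + c *: b o ->
  rho A (hw_vec k) = ((hw_l1 k)%:R * a + (hw_l2 k)%:R * bb) *: hw_vec k.
Proof.
move=> hA Ao; case: k => [s||s|] Ar; rewrite /hw_l1 /hw_l2 ?mul0r ?addr0.
- exact: (vec32_act gT gU hA Ao Ar).
- exact: (vec30_act gT gU hA Ao).
- by rewrite mul1r; exact: (vec21_act gT gU hA Ao Ar).
- by rewrite mul1r; exact: (vec10_act gT gU hA Ao).
Qed.

Let oN : o != N.
Proof. by rewrite -val_eqE /= subn1; lia. Qed.
Let dE := (dot_witt hP).


Let expand := (dotDl, dotDr, dotZl, dotZr, dotNl, dotNr, mulmxDl, mulmxDr).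
Let scaleAl a (M : 'M[C]_n) (X : 'cV_n) : (a *: M) *m X = a *: (M *m X).
Proof. by rewrite scalemxAl. Qed.

Section SlotValues.
Variables (e f x : 'cV[C]_n).
Hypotheses (ee : d e e = 0) (ef : d e f = 0) (ex : d e x = 1) (fx : d f x = 0) (xx : d x x = 0).

Lemma vec32_slot (y y' : 'cV[C]_n) : nab_sym (vec32 g e f) x x x y y' = 24 * (d f y * d f y').
Proof.
rewrite /vec32 (ext_vec_sym gT gU); last exact: sq_curvP.
rewrite /sq_curv !scaleAl !wedgeE !expand (dotC gT x e) (dotC gT x f) !(ee, ef, ex, fx, xx); ring.
Qed.

Lemma kn_curv_slot H y y' : d x (kn_curv g H x y *m y') =
  d y y' * d x (H x) - d y' (H x) * d x y - d x y' * d x (H y).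
Proof.
by rewrite /kn_curv mulmxDl !wedgeE !expand xx mulr0 add0r (dotC gT (H x)).
Qed.

Lemma ext_kn_slot e' H y y' : algebraic_curvature g (kn_curv g H) ->
  nab_sym (ext_vec g e' (kn_curv g H)) x x x y y' = 12 * d e' x *
  (d y y' * d x (H x) - d y' (H x) * d x y - d x y' * d x (H y) +
   (d y' y * d x (H x) - d y (H x) * d x y' - d x y * d x (H y'))).
Proof. by move=> hH; rewrite (ext_vec_sym gT gU) // !kn_curv_slot. Qed.

Lemma sym_pair_dot e' f' y z : d z (sym_pair g e' f' y) = d e' y * d f' z + d f' y * d e' z.
Proof. by rewrite /sym_pair !expand !(dotC gT z). Qed.

Lemma vec30_slot (y y' : 'cV[C]_n) : nab_sym (vec30 g e) x x x y y' =
  48 * (d y y' - d e y * d x y' - d e y' * d x y).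
Proof.
rewrite /vec30 (ext_kn_slot e y y' (sym_pair_curvP gT gU e e)) !sym_pair_dot !(ee, ex, xx).
rewrite (dotC gT y' y).
by move: (d y y') (d e y) (d e y') (d x y) (d x y') => *; ring.
Qed.

Lemma vec21_slot (y y' : 'cV[C]_n) : nab_sym (vec21 g e f) x x x y y' =
  24 * (d f y * d x y' + d x y * d f y').
Proof.
pose ux := ext_vec g f (kn_curv g (sym_pair g e e)).
pose vx := ext_vec g e (kn_curv g (sym_pair g e f)).
apply: (etrans (nab_sym_B ux vx x x x y y')).
have e1 := ext_kn_slot f y y' (sym_pair_curvP gT gU e e).
have e2 := ext_kn_slot e y y' (sym_pair_curvP gT gU e f).
apply: (etrans (congr2 (fun s t : C => s - t) e1 e2)); clear e1 e2 ux vx.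
rewrite !sym_pair_dot.
rewrite !(ee, ex, fx, xx).
rewrite (dotC gT y' y).
by move: (d y y') (d e y) (d e y') (d x y) (d x y') (d f y) (d f y') => *; ring.
Qed.

Lemma vec10_slot (y y' : 'cV[C]_n) : nab_sym (vec10 g e) x x x y y' = - 24 * (d x y * d x y').
Proof.
rewrite /vec10 (ext_vec_sym gT gU); last exact: id_curvP.
rewrite !wedgeE !expand !(ee, ex, xx).
by move: (d y y') (d e y) (d e y') (d x y) (d x y') => *; ring.
Qed.
End SlotValues.

(** The four values are 24, 48, 24 and -24. Nonvanishing of the vectors themselves also follows from
    this. *)
Lemma slot_hw_vec k : slot P n3 (hw_vec k) (hw_slot k).1 (hw_slot k).2 != 0.
Proof.
have doN : d (b o) (b N) = 1 by rewrite dE eqxx.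
have dNo : d (b N) (b o) = 1 by rewrite dE rev_ordK eqxx.
have doo : d (b o) (b o) = 0 by rewrite dE (negbTE oN).
have dNN : d (b N) (b N) = 0 by rewrite dE rev_ordK eq_sym (negbTE oN).
have lp : (o != p) /\ (o != q) by split; rewrite -val_eqE /= ?subn2 //; move: (n3); lia.
have mid r : r = p \/ r = q -> [/\ d (b r) (b N) = 0, d (b r) (b o) = 0,
    d (b N) (b r) = 0, d (b o) (b r) = 0 & d (b r) (b (rev_ord r)) = 1].
  move=> hr; have [or Nr] : o != r /\ N != r.
    have [op oq] := lp; split; first by case: hr => ->.
    by rewrite -(inj_eq rev_ord_inj) rev_ordK; case: hr => ->; rewrite ?rev_ordK.
  rewrite ![d (b r) (b N)]dotC // ![d (b r) (b o)]dotC //.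
  rewrite !dE eqxx ![r == _]eq_sym rev_ordK (negbTE or) (negbTE Nr); split=> //.
have midr k' : hw_snd k' = p \/ hw_snd k' = q by rewrite /hw_snd; case: ifP; [right|left].
have nz m : (m.+1%:R : C) != 0 by rewrite pnatr_eq0.
rewrite /slot; case: k => [s||s|]; rewrite /hw_vec /hw_slot /fst /snd.
- have [rN ro Nr or rr] := mid _ (midr (HW32 s)).
  by rewrite vec32_slot // rr !mulr1.
- have [rN ro Nr or rr] := mid p (or_introl erefl).
  by rewrite vec30_slot // rr Nr or !mul0r mulr0 !subr0 mulr1.
- have [rN ro Nr or rr] := mid _ (midr (HW21 s)).
  by rewrite vec21_slot // rr ro dNo mul0r add0r !mulr1.
- by rewrite vec10_slot // dNo !mulr1 oppr_eq0.
Qed.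
End HighestVectors.

(** * Singularity and weights of the explicit vectors *)

Section HighestWeights.
Variables (C : numClosedFieldType) (n : nat) (g P : 'M[C]_n).
Hypothesis hP : is_witt_basis g P.
Hypothesis n3 : (3 <= n)%N.
Local Notation b i := (col i P).
Local Notation o := (ord_fst n3).
Local Notation p := (ord_snd n3).
Local Notation q := (rev_ord p).
Local Notation rho := (rep_act (nabla_rep g)).
Variable k : hw_kind.
Hypothesis k4 : hw_flip k -> n = 4%N.
Local Notation r := (hw_snd n3 k).
Local Notation v := (hw_vec g P n3 k).

Lemma so_crd_rev A i : A \in so g -> crd P A (rev_ord i) i = 0.
Proof.
move=> /(so_crd hP) h; apply: (lin_solve (k := 2)); last by rewrite pnatr_eq0.
by rewrite mulr_natl mulr2n {1}h addNr.
Qed.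

Lemma hw_vec_upper A : A \in so g ->
  (forall i j : 'I_n, (j <= i)%N -> crd P A i j = 0) -> rho A v = 0.
Proof.
move=> hA up.
have Ao : A *m b o = 0 *: b o.
  by rewrite (mul_col_witt hP) scale0r big1 // => l _; rewrite up ?scale0r.
have Ar : A *m b r = 0 *: b r + crd P A o r *: b o.
  rewrite (mul_col_witt hP) scale0r add0r (bigD1 o) //= big1 ?addr0 // => l lo.
  have [lr|lr] := leqP r l; first by rewrite up ?scale0r.
  (* For the second index p, only l = o lies above it. For q with n = 4, the remaining index is p =
     rev q, where the entry lies on the antidiagonal and vanishes. *)
  suff -> : l = rev_ord r by rewrite so_crd_rev ?scale0r.
  apply: val_inj; move: lo lr; rewrite -val_eqE /hw_snd /=; case: ifP => [/k4 n4|_] /=; lia.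
by rewrite (hw_vec_act hP hA Ao Ar) !mulr0 addr0 scale0r.
Qed.

Lemma hw_vec_diag A : A \in so g -> is_diag_mx (crd P A) ->
  rho A v = ((hw_l1 k)%:R * crd P A o o + (hw_l2 k)%:R * crd P A r r) *: v.
Proof.
move=> hA /is_diag_mxP dA.
have Ab i : A *m b i = crd P A i i *: b i.
  rewrite (mul_col_witt hP) (bigD1 i) //= big1 ?addr0 // => l li.
  by rewrite dA ?scale0r.
by apply: (hw_vec_act hP (c := 0) hA (Ab o)); rewrite Ab scale0r addr0.
Qed.

Lemma hw_vec_singular : is_singular P v.
Proof.
move=> i j ij; apply: hw_vec_upper => [|l m ml]; first exact: root_elt_so.
rewrite (crd_root_elt hP); case: (l =P i) => [li|_].
  rewrite (_ : m == j = false) ?andbF /=; last by apply/eqP => mj; move: ml; rewrite li mj; lia.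
  case: (m =P rev_ord i) => [mi|_]; last by rewrite subrr.
  case: (l =P rev_ord j) => [lj|_]; last by rewrite subrr.
  by exfalso; move: ml; rewrite mi lj /=; have := ltn_ord j; lia.
case: (m =P rev_ord i) => [mi|_] /=; last by rewrite subrr.
case: (l =P rev_ord j) => [lj|_]; last by rewrite subrr.
by exfalso; move: ml; rewrite mi lj /=; have := ltn_ord j; lia.
Qed.

Definition hw_mu (l : 'I_n) : C := (hw_l1 k)%:R * eps C l o + (hw_l2 k)%:R * eps C l r.

Lemma hw_vec_weight : is_weight P v hw_mu.
Proof.
move=> l; apply: (hw_vec_act hP (c := 0)); first exact: root_elt_so.
  exact: cartanE.
by rewrite cartanE // scale0r addr0.
Qed.

Definition hw_weight : 'rV[rat]_(n./2) :=
  \row_i if i == 0%N :> nat then (hw_l1 k)%:R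
         else if i == 1%N :> nat then (if hw_flip k then - (hw_l2 k)%:R else (hw_l2 k)%:R) else 0.

Lemma hw_weight_sum A : A \in so g ->
  \sum_i ratr (hw_weight 0 i) * crd P A (half_ord i) (half_ord i) =
  (hw_l1 k)%:R * crd P A o o + (hw_l2 k)%:R * crd P A r r.
Proof.
move=> hA; have n3' := n3.
have m0 : (0 < n./2)%N by case: (n) n3' => [|[|m]].
have -> : crd P A r r = (if hw_flip k then -1 else 1) * crd P A p p.
  rewrite /hw_snd; case: ifP => _; rewrite ?mul1r // mulN1r.
  by rewrite (proj2 (so_crd hP A)) // rev_ordK.
rewrite (bigD1 (Ordinal m0)) //= mxE /= ratr_nat.
rewrite (_ : half_ord _ = o); last exact: val_inj.
congr (_ + _); have [n4|n4] := leqP 4 n.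
  have m1 : (1 < n./2)%N by case: (n) n4 => [|[|[|[|m]]]].
  rewrite (bigD1 (Ordinal m1)) //= mxE /= (_ : half_ord _ = p); last exact: val_inj.
  rewrite big1 ?addr0 => [|i /andP[]]; last first.
    rewrite -!val_eqE /= => i0 i1; by rewrite mxE (negbTE i0) (negbTE i1) rmorph0 mul0r.
  by case: ifP => _; rewrite ?rmorphN /= ratr_nat ?mul1r // mulN1r mulrN mulNr.
(* For n = 3 the rank is 1, and the diagonal entry at the middle index is zero. *)
have pp : rev_ord p = p by apply: val_inj; rewrite /= subn2; lia.
have := so_crd_rev p hA; rewrite pp => ->; rewrite !mulr0 big1 // => i.
rewrite -val_eqE /= => i0; exfalso; have := ltn_ord i.
have : (n./2 <= 1)%N by case: (n) n4 => [|[|[|[|m]]]].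
by move: i0; lia.
Qed.

Lemma hw_vec_highest (U : {vspace nabla_rep g}) (stU : rep_stable U) (hL : lie_closed (so g)) :
  v != 0 -> v \in U -> is_highest_weight P (rep_sub stU hL) hw_weight.
Proof.
move=> v0 Uv; pose w : rep_sub stU hL := vsproj U v.
have wE : vsval w = v by rewrite vsprojK.
exists w; first by apply: contra v0 => /eqP w0; rewrite -wE w0.
split=> A hA h.
  apply: val_inj; apply: (etrans (sub_actE stU hA w)); rewrite wE hw_vec_upper // => i j ij.
  by rewrite crd_def h.
apply: val_inj; apply: (etrans (sub_actE stU hA w)).
rewrite wE hw_vec_diag ?crd_def // -crd_def.
have E := hw_weight_sum hA; rewrite crd_def in E; rewrite crd_def -E.
by rewrite -wE -linearZ.
Qed.

End HighestWeights.

(** The preimage of [U'] in the irreducible representation is stable and nonzero, hence everything,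
    so the two subspaces agree. *)
Lemma rep_embeds_irreducible (F : fieldType) (n : nat) (h : {vspace 'M[F]_n}) (A B V : lie_rep h)
    (U U' : {vspace V}) :
  rep_irreducible A -> rep_embeds A U -> rep_embeds B U' -> (U' <= U)%VS -> U' != 0%VS ->
  rep_embeds B U.
Proof.
move=> [_ irrA] [f [kf imf] fE] hB UU' U'0; have [f' [_ imf'] f'E] := hB.
suff -> : U = U' by [].
have E : (f @: (f @^-1: U'))%VS = U' by rewrite lpreimK ?imf.
have stU' : rep_stable (f @^-1: U')%VS.
  move=> M hM a; rewrite -!memv_preim fE // -imf' => /memv_imgP [b _ ->].
  by rewrite -f'E // memv_img ?memvf.
have [W0|Wfull] := irrA _ stU'; last by rewrite -E Wfull imf.
by rewrite -E W0 limg0 eqxx in U'0.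
Qed.

(** * The copy of the standard representation *)

Section Vec10Field.
Variables (F : numFieldType) (n : nat) (g : 'M[F]_n).
Hypotheses (gT : g^T = g) (gU : g \in unitmx).
Local Notation rho := (rep_act (nabla_rep g)).

Lemma vec10E (X Z U V : 'cV[F]_n) :
  nab (vec10 g X) Z U V = nabla_ext g X (wedge g) Z U V.
Proof. exact: (ext_vecE gT gU X Z U V (id_curvP gT gU)). Qed.

Lemma vec10_linear : linear (vec10 g).
Proof.
move=> a X Y; apply: nab_inj => Z U V; rewrite nabP !vec10E /nabla_ext !dotPl wedgePr.
move: (wedge g U V) (wedge g Z V) (wedge g U Z) (wedge g (_ *m _) X) (wedge g (_ *m _) Y) => A1 A2 A3 A4 A5.
by apply/matrixP => i j; rewrite !mxE; ring.
Qed.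

Definition std_hom : 'Hom('cV[F]_n, nabla_rep g) :=
  linfun (HB.pack (vec10 g) (GRing.isLinear.Build _ _ _ _ (vec10 g) vec10_linear)
    : {linear 'cV[F]_n -> nabla_rep g}).

Lemma std_homE X : std_hom X = vec10 g X.
Proof. by rewrite lfunE. Qed.

Lemma vec10_equivariant A X : A \in so g -> rho A (vec10 g X) = vec10 g (A *m X).
Proof.
move=> hA; have hR := id_curvP gT gU; apply: nab_inj => Z U V.
rewrite (ext_vec_act gT gU X Z U V hR hA) vec10E /nabla_ext !id_curv_act //.
by rewrite !mul0mx wedge0l !scaler0 !addr0.
Qed.

Lemma vec10_delta_eq0 X : (forall a, vec10 g (delta_mx a 0) = 0) -> vec10 g X = 0.
Proof.
move=> z; rewrite -std_homE; suff : X \in lker std_hom by rewrite memv_ker => /eqP.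
rewrite [X]col_sum_delta; apply: memv_suml => a _; apply: memvZ.
by rewrite memv_ker std_homE (z a) eqxx.
Qed.

(** The vectors X satisfying the eigenvalue equation form a stable subspace of the irreducible
    standard representation, and X0 is a nonzero one. *)
Lemma vec10_stable_eq (Z : 'End(nabla_rep g)) c (X0 : 'cV[F]_n) : (3 <= n)%N ->
  (forall A, A \in so g -> forall u, rho A (Z u) = Z (rho A u)) ->
  X0 != 0 -> Z (vec10 g X0) = c *: vec10 g X0 -> forall X, Z (vec10 g X) = c *: vec10 g X.
Proof.
move=> n3 ZC X00 ZX0; pose S : {vspace rep_std (so g)} := lker ((Z - c *: \1%VF) \o std_hom)%VF.
have memS X : X \in S <-> Z (vec10 g X) = c *: vec10 g X.
  rewrite memv_ker comp_lfunE add_lfunE opp_lfunE scale_lfunE id_lfunE std_homE subr_eq0.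
  by split=> /eqP.
have stS : rep_stable S.
  move=> A hA X /memS h; apply/memS; rewrite lfunE /= -vec10_equivariant // -ZC // h.
  exact: (rep_act_scaler (V := nabla_rep g) A c (vec10 g X)).
have [_ irr] := rep_std_irreducible gT gU n3.
have [S0|Sf] := irr S stS; last by move=> X; apply/memS; rewrite Sf memvf.
by have /memS := ZX0; rewrite S0 memv0 (negbTE X00).
Qed.

Lemma rep_embeds_vec10 (X0 : 'cV[F]_n) : (3 <= n)%N -> vec10 g X0 != 0 ->
  rep_embeds (rep_std (so g)) (limg std_hom).
Proof.
move=> n3 h; exists std_hom; last first.
  by move=> A hA X; rewrite !std_homE vec10_equivariant // lfunE.
split=> //; have [_ irr] := rep_std_irreducible gT gU n3.
have stK : rep_stable (V := rep_std (so g)) (lker std_hom).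
  move=> A hA X; rewrite !memv_ker !std_homE lfunE /= -vec10_equivariant // => /eqP ->.
  by rewrite linear0.
have [->//|Kf] := irr (lker std_hom) stK.
by have := memvf X0; rewrite -Kf memv_ker std_homE (negbTE h).
Qed.

End Vec10Field.

(** Applying the product of Z - c_j over j different from i0 to a vanishing sum leaves a nonzero
    multiple of the component at i0. *)
Lemma eigenspaces_directv (F : fieldType) (V : vectType F) (Z : 'End(V)) (I : finType) (c : I -> F) :
  injective c -> directv (\sum_i lker (Z - c i *: \1%VF))%VS.
Proof.
move=> c_inj; apply/directv_sum_independent => w Ew w0 i0 _.
have Zw i : Z (w i) = c i *: w i.
  by have /eqlfunP := Ew i isT; rewrite scale_lfunE id_lfunE.
pose T (s : seq I) := foldr (fun j f => (Z - c j *: \1%VF) \o f)%VF \1%VF s.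
have TE s i : T s (w i) = \prod_(j <- s) (c i - c j) *: w i.
  elim: s => [|j s IH]; first by rewrite big_nil scale1r id_lfunE.
  rewrite /= comp_lfunE IH big_cons linearZ /= add_lfunE opp_lfunE scale_lfunE id_lfunE /= Zw.
  by rewrite -scalerBl scalerA mulrC.
pose s := [seq j <- index_enum I | j != i0].
have := congr1 (T s) w0; rewrite linear_sum linear0 (bigD1 i0) //= big1 ?addr0.
  rewrite TE => /eqP; rewrite scaler_eq0 => /orP[|/eqP //].
  rewrite prodf_seq_eq0 => /hasP [j]; rewrite mem_filter => /andP[ji _] /=.
  by rewrite subr_eq0 => /eqP /c_inj e; rewrite e eqxx in ji.
move=> i ii0; rewrite TE; apply/eqP; rewrite scaler_eq0 prodf_seq_eq0.
apply/orP; left; apply/hasP; exists i; last by rewrite /= subrr.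
by rewrite mem_filter ii0 mem_index_enum.
Qed.

(** Subspaces of one ambient space are used so that the order and bracketing of the final sum can be
    fixed afterwards. The last clause identifies the summand of weight eps_1 with the standard
    representation itself. *)
Definition curvature_split (R : realType) (n : nat) (g : 'M[R]_n) (P : 'M[R[i]]_n)
    (I : finType) (K : I -> hw_kind) : Prop :=
  exists U : I -> {vspace nabla_rep g},
  [/\ directv (\sum_i U i)%VS, (\sum_i U i)%VS = fullv,
      forall i, exists2 V : lie_rep (so g),
        is_real_irrep P (hw_weight n (K i)) V & rep_embeds V (U i) &
      forall i, K i = HW10 -> rep_embeds (rep_std (so g)) (U i)].

(** * Decomposition over the reals into Casimir eigenspaces *)

Section Decomposition.
Variables (R : realType) (n : nat) (g : 'M[R]_n).
Local Notation C := R[i].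
Local Notation toC := (map_mx (real_complex R)).
Local Notation gC := (toC g).
Variable P : 'M[C]_n.
Hypothesis hP : is_witt_basis gC P.
Hypothesis n3 : (3 <= n)%N.

Lemma real_metric_sym : g^T = g.
Proof.
have := metric_sym hP; rewrite map_trmx => /matrixP h; apply/matrixP => i j.
by have := h i j; rewrite !mxE => /complexI.
Qed.

Lemma real_metric_unit : g \in unitmx.
Proof. by have := metric_unit hP; rewrite map_unitmx. Qed.
Let gT := real_metric_sym.
Let gU := real_metric_unit.

Lemma toC_wedge X Y : toC (wedge g X Y) = wedge gC (toC X) (toC Y).
Proof. by rewrite !wedge_def map_mxB !map_mxM !map_trmx. Qed.

Section Casimir.
Variables (tau : 'End('M[R]_n)) (tauC : 'End('M[C]_n)).
Hypothesis tau_so : forall A, A \in so g -> tau A \in so g.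
Hypothesis tau_ad : forall A B, A \in so g -> B \in so g ->
  tau (ad_fun A B) = ad_fun A (tau B).
Hypothesis tauC_so : forall A, A \in so gC -> tauC A \in so gC.
Hypothesis tauC_ad : forall A B, A \in so gC -> B \in so gC ->
  tauC (ad_fun A B) = ad_fun A (tauC B).
Hypothesis tauC_toC : forall A, A \in so g -> tauC (toC A) = toC (tau A).

Local Notation cmplx := (@complexify R n g).
Let cmplxP a u v : cmplx (a *: u + v) = real_complex R a *: cmplx u + cmplx v.
Proof. exact: (proj1 (complexify_intertwiner g)). Qed.
Let cmplx0 : cmplx 0 = 0.
Proof.
have := cmplxP 1 0 0; rewrite !scale1r addr0 => /esym/eqP.
by rewrite -subr_eq0 addrK => /eqP.
Qed.
Let cmplxD u v : cmplx (u + v) = cmplx u + cmplx v.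
Proof. by rewrite -[u]scale1r cmplxP rmorph1 !scale1r. Qed.
Let cmplxZ a u : cmplx (a *: u) = real_complex R a *: cmplx u.
Proof. by rewrite -[a *: u]addr0 cmplxP cmplx0 addr0. Qed.
Let cmplx_sum (I : Type) (s : seq I) (u : I -> nabla_rep g) :
  cmplx (\sum_(i <- s) u i) = \sum_(i <- s) cmplx (u i).
Proof. by elim: s => [|i s IH]; rewrite ?big_nil ?cmplx0 // !big_cons cmplxD IH. Qed.

(** Both Casimir elements are written in the same real basis, and [tauC] extends [tau]. *)
Lemma complexify_casimir u :
  cmplx (casimir tau (nabla_rep g) u) = casimir tauC (nabla_rep gC) (cmplx u).
Proof.
rewrite /casimir !sum_lfunE cmplx_sum; apply: eq_bigr => a _.
rewrite !sum_lfunE cmplx_sum; apply: eq_bigr => b _.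
have act := proj2 (complexify_intertwiner g).
pose w1 := wedge g (delta_mx a 0) (delta_mx b 0).
pose w2 := wedge g (invmx g *m delta_mx b 0) (invmx g *m delta_mx a 0).
have h1 : w1 \in so g by apply: wedge_so.
have h2 : w2 \in so g by apply: wedge_so.
have e1 : wedge gC (delta_mx a 0) (delta_mx b 0) = toC w1 by rewrite toC_wedge !map_delta_mx.
have e2 : tauC (wedge gC (invmx gC *m delta_mx b 0) (invmx gC *m delta_mx a 0)) = toC (tau w2).
  by rewrite -tauC_toC // toC_wedge !map_mxM !map_invmx !map_delta_mx.
rewrite e1 e2; clear e1 e2; rewrite -/w1 -/w2.
have E1 := comp_lfunE (rep_act (nabla_rep g) w1) (rep_act (nabla_rep g) (tau w2)) u.
have E2 := comp_lfunE (rep_act (nabla_rep gC) (toC w1)) (rep_act (nabla_rep gC) (toC (tau w2))) (cmplx u).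
apply: (etrans (congr1 cmplx E1)); apply: (etrans _ (esym E2)).
apply: (etrans (act _ h1 _)); congr (rep_act (nabla_rep gC) (toC w1) _).
exact: act (tau_so h2) u.
Qed.

Section Eigenspaces.
Variables (I : finType) (K : I -> hw_kind) (c : I -> R).
Hypothesis K4 : forall i, hw_flip (K i) -> n = 4%N.
Hypothesis K_complete : forall (u : nabla_rep gC) lam, is_weight P u lam -> is_singular P u ->
  (forall i, slot P n3 u (hw_slot n3 (K i)).1 (hw_slot n3 (K i)).2 = 0) -> u = 0.
Hypothesis K_distinct : forall i j, i != j ->
  exists l, hw_mu C n3 (K i) l != hw_mu C n3 (K j) l.
Hypothesis c_inj : injective c.
Local Notation v i := (hw_vec gC P n3 (K i)).
Local Notation Zr := (casimir tau (nabla_rep g)).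
Local Notation Zc := (casimir tauC (nabla_rep gC)).
Hypothesis casimir_v : forall i, Zc (v i) = real_complex R (c i) *: v i.

Let gTC := metric_sym hP.
Let gUC := metric_unit hP.

Let ZrC A : A \in so g -> forall w, rep_act (nabla_rep g) A (Zr w) = Zr (rep_act (nabla_rep g) A w).
Proof. by move=> hA w; apply: casimir_comm. Qed.
Let ZcC A : A \in so gC -> forall w, rep_act (nabla_rep gC) A (Zc w) = Zc (rep_act (nabla_rep gC) A w).
Proof. by move=> hA w; apply: casimir_comm. Qed.

Local Notation Er i := (lker (Zr - c i *: \1%VF)).
Local Notation Ec i := (lker (Zc - real_complex R (c i) *: \1%VF)).

Let v0 i : v i != 0.
Proof.
apply/eqP => e; have := slot_hw_vec hP n3 (K i).
by rewrite e /slot nab_sym0 eqxx.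
Qed.

Let cC_inj : injective (fun i => real_complex R (c i)).
Proof. by move=> i j /complexI /c_inj. Qed.

Let hH := nab_form_contravariant hP.

Let classification (u : nabla_rep gC) lam : u != 0 -> is_weight P u lam -> is_singular P u ->
  exists i a, u = a *: v i.
Proof.
apply: (slot_classification hP (n3 := n3) (mu := fun i => hw_mu C n3 (K i)) (sl := fun i => hw_slot n3 (K i))) => //.
- by move=> i; apply: hw_vec_weight.
- by move=> i; apply: hw_vec_singular => //; apply: K4.
- by move=> i; apply: slot_hw_vec.
Qed.

Let vE i : v i \in Ec i.
Proof. by apply/eqlfunP; rewrite scale_lfunE id_lfunE casimir_v. Qed.

(** The complex eigenspace is simple with highest weight vector [v i], and the real eigenspace is a
    real form of it, hence irreducible. *)
Lemma casimir_eigenspace_irrep i : exists2 V : lie_rep (so g),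
  is_real_irrep P (hw_weight n (K i)) V & rep_embeds V (Er i).
Proof.
have sr : rep_stable (Er i) by apply: rep_stable_eigenspace.
have sc : rep_stable (Ec i) by apply: rep_stable_eigenspace.
pose hr := so_lie_closed (g := g); pose hc := so_lie_closed (g := gC).
have rf : is_real_form (rep_sub sr hr) (rep_sub sc hc).
  apply: (real_form_eigenspace (f := cmplx)); first exact: complexify_intertwiner.
    exact: complexify_bijective.
  exact: complexify_casimir.
have irr : rep_irreducible (rep_sub sc hc).
  apply: rep_sub_irreducible => [|U' UE stU' U'0].
    by apply: contraNneq (v0 i) => E0; have := vE i; rewrite E0 memv0.
  exact: (eigenspace_simple hP hH ZcC v0 casimir_v cC_inj classification).
exists (rep_sub sr hr); last exact: rep_embeds_sub.
have [f hf bf] := rf.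
split; first exact: real_form_irreducible hf bf irr.
exists (rep_sub sc hc); split=> //; last by left.
by apply: hw_vec_highest => //; apply: K4.
Qed.

Lemma casimir_eigenspace_sum : (\sum_i Er i)%VS = fullv.
Proof.
apply: (real_form_eigenspace_sum (complexify_intertwiner g) (@complexify_bijective R n g) complexify_casimir).
exact: (eigenspace_sum hP hH ZcC casimir_v classification).
Qed.

Lemma casimir_eigenspace_direct : directv (\sum_i Er i)%VS.
Proof. exact: eigenspaces_directv. Qed.

Lemma complexify_vec10 X : cmplx (vec10 g X) = vec10 gC (toC X).
Proof.
apply: nab_real_ext => Z U V; rewrite complexifyE !vec10E //.
have dC Y Y' : dot gC (toC Y) (toC Y') = real_complex R (dot g Y Y').
  by rewrite !dotE matrix.map_trmx -!map_mxM [LHS]mxE.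
rewrite /nabla_ext !map_mxD !map_mxZ !toC_wedge map_mxM toC_wedge !dC.
by rewrite rmorphM rmorph_nat.
Qed.

(** Over the complex numbers the highest vector lies in the image of [vec10], so that whole image
    has the eigenvalue c_i. Injectivity of complexification brings this to the real image, which is
    a nonzero stable part of an irreducible eigenspace and so fills it. *)
Lemma casimir_eigenspace_std i : K i = HW10 -> rep_embeds (rep_std (so g)) (Er i).
Proof.
move=> Ki; have vi : v i = vec10 gC (col (ord_fst n3) P) by rewrite Ki.
have vZ X : Zc (vec10 gC X) = real_complex R (c i) *: vec10 gC X.
  apply: (vec10_stable_eq gTC gUC n3 ZcC (X0 := col (ord_fst n3) P)); last by rewrite -vi casimir_v.
  apply: contra (v0 i) => /eqP X0; rewrite vi X0.
  by rewrite -(std_homE gTC gUC) linear0.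
have rZ X : Zr (vec10 g X) = c i *: vec10 g X.
  have inj := real_form_inj (@complexify_bijective R n g).
  apply: (inj (Zr (vec10 g X)) (c i *: vec10 g X)).
  apply: (etrans (complexify_casimir (vec10 g X))).
  have eL := congr1 Zc (complexify_vec10 X); have eR := cmplxZ (c i) (vec10 g X).
  apply: (etrans eL); apply: (etrans (vZ (toC X))); apply: (etrans _ (esym eR)).
  by congr (_ *: _); apply: esym; apply: complexify_vec10.
have [X0 nz] : exists X, vec10 g X != 0.
  apply: contrapT => no.
  have z a : vec10 gC (delta_mx a 0) = 0.
    have e : vec10 g (delta_mx a 0) = 0.
      by apply/eqP/negPn/negP => h; apply: no; exists (delta_mx a 0).
    have E := complexify_vec10 (delta_mx a 0); rewrite map_delta_mx in E.
    exact: (etrans (esym E) (etrans (congr1 cmplx e) cmplx0)).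
  by have /eqP := v0 i; apply; apply: (etrans vi (vec10_delta_eq0 gTC gUC _ z)).
have [V irrV embV] := casimir_eigenspace_irrep i.
apply: (rep_embeds_irreducible (proj1 irrV) embV (rep_embeds_vec10 gT gU n3 nz)).
  apply/subvP => _ /memv_imgP [X _ ->]; rewrite std_homE.
  by apply/eqlfunP; rewrite scale_lfunE id_lfunE rZ.
apply: contra nz => /eqP E0; have : std_hom gT gU X0 \in limg (std_hom gT gU) by rewrite memv_img ?memvf.
by rewrite E0 memv0 std_homE.
Qed.

Lemma casimir_decomposition : curvature_split g P K.
Proof.
exists (fun i => Er i); split.
- exact: casimir_eigenspace_direct.
- exact: casimir_eigenspace_sum.
- exact: casimir_eigenspace_irrep.
- exact: casimir_eigenspace_std.
Qed.

End Eigenspaces.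
End Casimir.
End Decomposition.

(** * Sums of a direct family over intervals of indices *)

Section IntervalSums.
Variables (F : fieldType) (n : nat) (h : {vspace 'M[F]_n}) (V : lie_rep h).
Variables (m : nat) (U : 'I_m -> {vspace V}).

(** Intervals are half-open, so that adjacent ones concatenate and nested binary sums follow cut
    points. *)
Definition seg a b : {vspace V} := (\sum_(i < m | (a <= i < b)%N) U i)%VS.

Lemma seg1 (i : 'I_m) : seg i i.+1 = U i.
Proof.
rewrite /seg (eq_bigl (pred1 i)) ?big_pred1_eq // => j /=.
by rewrite -val_eqE /=; lia.
Qed.

Lemma seg_full : seg 0 m = (\sum_i U i)%VS.
Proof. by apply: eq_bigl => i; rewrite ltn_ord. Qed.

Lemma seg_cat a b c : (a <= b <= c)%N -> seg a c = (seg a b + seg b c)%VS.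
Proof.
move=> abc; rewrite /seg (bigID (fun i : 'I_m => (i < b)%N)) /=.
by congr (_ + _)%VS; apply: eq_bigl => i; lia.
Qed.

Hypothesis U_direct : directv (\sum_i U i)%VS.

Lemma seg_disjoint a b c : (seg a b :&: seg b c)%VS = 0%VS.
Proof.
apply/eqP; rewrite -subv0; apply/subvP => _ /memv_capP [/memv_sumP [u Uu ->] /memv_sumP [w Uw E]].
(* A common element of two adjacent intervals gives a vanishing sum over the whole family, to which
   directness applies. *)
pose z (i : 'I_m) := if (a <= i < b)%N then u i else if (b <= i < c)%N then - w i else 0.
have Uz i : true -> z i \in U i.
  by rewrite /z; case: ifP => [/Uu //|_]; case: ifP => [/Uw h' _|]; rewrite ?rpredN // mem0v.
have z0 : \sum_i z i = 0.
  rewrite (bigID (fun i : 'I_m => (a <= i < b)%N)) /=.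
  rewrite (eq_bigr u) => [|i ai]; last by rewrite /z ai.
  rewrite E [X in _ + X](bigID (fun i : 'I_m => (b <= i < c)%N)) /= [X in _ + (_ + X)]big1 ?addr0.
    rewrite [X in _ + X](eq_bigl (fun i : 'I_m => (b <= i < c)%N)) => [|i]; last by lia.
    rewrite -big_split big1 // => i bi /=; rewrite /z bi ifF; first by rewrite subrr.
    by lia.
  by move=> i /andP[/negbTE h1 /negbTE h2]; rewrite /z h1 h2.
have /directv_sum_independent /(_ z Uz z0) z1 := U_direct.
rewrite memv0 big1 // => i ai; have := z1 i isT; by rewrite /z ai.
Qed.

Lemma rep_embeds_seg (A B : lie_rep h) a b c : (a <= b <= c)%N ->
  rep_embeds A (seg a b) -> rep_embeds B (seg b c) -> rep_embeds (rep_sum A B) (seg a c).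
Proof. by move=> abc hA hB; rewrite (seg_cat abc); apply: rep_embeds_sum (seg_disjoint a b c) hA hB. Qed.

End IntervalSums.

(** * The weights for n >= 5 in terms of fundamental weights *)

Section Weights.
Variables (n : nat).

Lemma fund_weight1 : (5 <= n)%N -> fund_weight n 1 = \row_i (i == 0%N :> nat)%:R.
Proof.
move=> n5; apply/rowP => i; rewrite !mxE; have := odd_double_half n; rewrite -muln2 => e.
case: ifP => on.
  by rewrite ifT; [rewrite ltnS leqn0|rewrite on in e; lia].
by rewrite ifT; [rewrite ltnS leqn0|rewrite on in e; lia].
Qed.

Lemma pi2barE : (5 <= n)%N -> pi2bar n = \row_i (i < 2)%N%:R.
Proof.
move=> n5; have [->|n5'] := eqVneq n 5%N.
  by apply/rowP => -[[|[|//]] hi]; rewrite !mxE.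
have [->|n6] := eqVneq n 6%N.
  by apply/rowP => -[[|[|[|//]]] hi]; rewrite !mxE.
rewrite /pi2bar (negbTE n5') (negbTE n6); apply/rowP => i; rewrite !mxE.
have := odd_double_half n; rewrite -muln2 => e.
by case: ifP => on; rewrite ifT //; rewrite on in e; lia.
Qed.

Lemma hw_weight32 : (5 <= n)%N -> hw_weight n (HW32 false) = fund_weight n 1 + pi2bar n *+ 2.
Proof.
move=> n5; rewrite fund_weight1 // pi2barE //; apply/rowP => i.
by rewrite mxE [RHS]mxE 2!mxE mulr2n !mxE; case: i => -[|[|i]].
Qed.

Lemma hw_weight30 : (5 <= n)%N -> hw_weight n HW30 = fund_weight n 1 *+ 3.
Proof.
move=> n5; rewrite fund_weight1 //; apply/rowP => i.
by rewrite mulrS mulr2n !mxE; case: i => -[|[|i]].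
Qed.

Lemma hw_weight21 : (5 <= n)%N -> hw_weight n (HW21 false) = fund_weight n 1 + pi2bar n.
Proof.
move=> n5; rewrite fund_weight1 // pi2barE //; apply/rowP => i.
by rewrite !mxE; case: i => -[|[|i]].
Qed.

End Weights.

(** * Casimir values of the explicit vectors *)

Section CasimirKinds.
Variables (C : numClosedFieldType) (n : nat) (g P : 'M[C]_n).
Hypothesis hP : is_witt_basis g P.
Hypothesis n3 : (3 <= n)%N.
Local Notation o := (ord_fst n3).
Local Notation p := (ord_snd n3).

(** Kept as a natural number so that distinctness is arithmetic; n >= 3 and the test on n keep the
    truncated subtractions exact. *)
Definition hw_value k : nat :=
  (2 * hw_l1 k ^ 2 + 2 * hw_l1 k * (n - 2) +
   if 3 < n then 2 * hw_l2 k ^ 2 + 2 * hw_l2 k * (n - 4) else 0)%N.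

Lemma casimir_hw_vec k : hw_flip k = false ->
  casimir \1%VF (nabla_rep g) (hw_vec g P n3 k) = (hw_value k)%:R *: hw_vec g P n3 k.
Proof.
move=> k0; have gT := metric_sym hP; have gU := metric_unit hP.
have h1 A : A \in so g -> (\1%VF : 'End('M[C]_n)) A \in so g by rewrite id_lfunE.
rewrite (casimir_witt gT gU h1 hP).
under eq_bigr => i _ do under eq_bigr => j _ do rewrite id_lfunE.
have wt := hw_vec_weight hP n3 k.
have sg : is_singular P (hw_vec g P n3 k) by apply: hw_vec_singular; rewrite ?k0.
rewrite (casimir_weight hP wt sg); congr (_ *: _).
have muE l : hw_mu C n3 k l = (hw_l1 k)%:R * eps C l o + (hw_l2 k)%:R * eps C l p.
  by rewrite /hw_mu /hw_snd k0.
rewrite (funext muE); have E := casimir_value n3 (hw_l1 k)%:R (hw_l2 k)%:R; cbv zeta in E.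
rewrite E.
rewrite /hw_value; case: ifP => n4; rewrite !(natrD, natrM, natrX) ?natrB //.
  exact: ltnW n3.
exact: ltnW n3.
Qed.

Lemma hw_mu_fst k : hw_mu C n3 k o = (hw_l1 k)%:R.
Proof.
have n3' := n3; rewrite /hw_mu /eps /hw_snd eqxx -!val_eqE /= subn1 (_ : (0 == n.-1)%N = false); last by lia.
case: ifP => _ /=; rewrite ?subn2.
  have [-> ->] : (n.-2 == 0)%N = false /\ (n.-2 == n.-1)%N = false by clear -n3'; lia.
  by rewrite !subr0 mulr1 mulr0 addr0.
have -> : (1 == n.-1)%N = false by clear -n3'; lia.
by rewrite !subr0 mulr1 mulr0 addr0.
Qed.

Lemma hw_mu_snd k : (3 < n)%N ->
  hw_mu C n3 k p = if hw_flip k then - (hw_l2 k)%:R else (hw_l2 k)%:R.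
Proof.
move=> n4; have -> : hw_mu C n3 k p = (hw_l2 k)%:R * eps C p (hw_snd n3 k).
  rewrite /hw_mu {1}/eps -!val_eqE /= subn2.
  have -> : (0 == n.-2)%N = false by clear -n4; lia.
  by rewrite subrr mulr0 add0r.
have pp : (p == rev_ord p) = false.
  by apply/negP => /eqP /(congr1 val) /=; clear -n4; lia.
rewrite /hw_snd; case: ifP => _; rewrite ?eps_rev /eps eqxx pp subr0 ?mulrN mulr1 //.
Qed.

End CasimirKinds.

(** For n = 3 the second coordinate is absent, so [HW32] already stands for the weight 3 eps_1 and
    [HW30] would repeat it. *)
Definition kinds3 (i : 'I_3) : hw_kind := nth HW10 [:: HW32 false; HW21 false; HW10] i.
Definition kinds5 (i : 'I_4) : hw_kind := nth HW10 [:: HW32 false; HW30; HW21 false; HW10] i.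

(** * The cases n = 3 and n >= 5 *)

Section CasimirDecomposition.
Variables (R : realType) (n : nat) (g : 'M[R]_n).
Local Notation gC := (map_mx (real_complex R) g).
Variable P : 'M[R[i]]_n.
Hypothesis hP : is_witt_basis gC P.
Hypothesis n3 : (3 <= n)%N.

Lemma unflipped_split (I : finType) (K : I -> hw_kind) :
  (forall i, hw_flip (K i) = false) ->
  (forall (u : nabla_rep gC) lam, is_weight P u lam -> is_singular P u ->
    (forall i, slot P n3 u (hw_slot n3 (K i)).1 (hw_slot n3 (K i)).2 = 0) -> u = 0) ->
  (forall i j, i != j -> exists l, hw_mu R[i] n3 (K i) l != hw_mu R[i] n3 (K j) l) ->
  injective (fun i => hw_value n (K i)) ->
  curvature_split g P K.
Proof.
move=> K0 Kc Kd vi.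
apply: (@casimir_decomposition R n g P hP n3 \1%VF \1%VF _ _ _ _ _ I K
  (fun i => (hw_value n (K i))%:R)) => //.
- by move=> A; rewrite id_lfunE.
- by move=> A B _ _; rewrite !id_lfunE.
- by move=> A; rewrite id_lfunE.
- by move=> A B _ _; rewrite !id_lfunE.
- by move=> A _; rewrite !id_lfunE.
- by move=> i; rewrite K0.
- by move=> i j /eqP; rewrite eqr_nat => /eqP /vi.
- by move=> i; rewrite casimir_hw_vec // rmorph_nat.
Qed.

Lemma curvature_split3 : n = 3%N -> curvature_split g P kinds3.
Proof.
move=> n3'; apply: unflipped_split.
- by case=> -[|[|[|//]]].
- move=> u lam wu su sl.
  have e : rev_ord (ord_snd n3) = ord_snd n3 by apply: val_inj; rewrite /= n3'.
  have s1 := sl (inord 0); have s2 := sl (inord 1); have s3 := sl (inord 2).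
  rewrite /kinds3 !inordK //= /hw_snd /= in s1 s2 s3.
  have s12 : slot P n3 u (ord_snd n3) (rev_ord (ord_snd n3)) = 0 by move: s1; rewrite e.
  by apply: (singular_eq0 hP (nab_form_contravariant hP) wu su s1 s12 s2 s3) => e4; rewrite n3' in e4.
- move=> i j ij; exists (ord_fst n3); rewrite !hw_mu_fst eqr_nat.
  by case: i j ij => -[|[|[|//]]] hi [[|[|[|//]]] hj].
(* The values are 24, 12 and 4. *)
- move=> i j e; apply: val_inj; move: e; rewrite /hw_value n3'.
  by case: i j => -[|[|[|//]]] hi [[|[|[|//]]] hj].
Qed.

Lemma curvature_split5 : (5 <= n)%N -> curvature_split g P kinds5.
Proof.
move=> n5; have n4 : (3 < n)%N by apply: ltnW.
apply: unflipped_split.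
- by case=> -[|[|[|[|//]]]].
- move=> u lam wu su sl.
  have s1 := sl (inord 0); have s2 := sl (inord 1); have s3 := sl (inord 2); have s4 := sl (inord 3).
  rewrite /kinds5 !inordK //= /hw_snd /= in s1 s2 s3 s4.
  apply: (singular_eq0 hP (nab_form_contravariant hP) wu su s1 s2 s3 s4).
  by move=> e; rewrite e in n5.
(* Only [HW32] and [HW30] share a first coordinate; the second one separates them. *)
- move=> i j ij; have [e|ne] := eqVneq (hw_l1 (kinds5 i)) (hw_l1 (kinds5 j)).
    exists (ord_snd n3); rewrite !hw_mu_snd //.
    by case: i j ij e => -[|[|[|[|//]]]] hi [[|[|[|[|//]]]] hj] //=; rewrite eqr_nat.
  by exists (ord_fst n3); rewrite !hw_mu_fst eqr_nat.
(* The values are 10n - 2, 6n + 6, 6n - 6 and 2n - 2. *)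
- move=> i j e; apply: val_inj; move: e; rewrite /hw_value n4.
  by case: i j => -[|[|[|[|//]]]] hi [[|[|[|[|//]]]] hj] //=; lia.
Qed.

End CasimirDecomposition.

(** * Duality of skew matrices of size 4 *)

Section Hat.
Variable F : numFieldType.
Local Notation M4 := 'M[F]_4.

Definition ord4 (k : nat) : 'I_4 := inord k.

(* [hat M i j = M k l] whenever [(i, j, k, l)] is an even permutation of [(0, 1, 2, 3)]. *)
Definition hat_entry (M : M4) (i j : nat) : F :=
  let m k l := M (ord4 k) (ord4 l) in
  match i, j with
  | 0, 1 => m 2 3 | 1, 0 => m 3 2 | 0, 2 => m 3 1 | 2, 0 => m 1 3
  | 0, 3 => m 1 2 | 3, 0 => m 2 1 | 1, 2 => m 0 3 | 2, 1 => m 3 0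
  | 1, 3 => m 2 0 | 3, 1 => m 0 2 | 2, 3 => m 0 1 | 3, 2 => m 1 0
  | _, _ => 0
  end.

Definition hat (M : M4) : M4 := \matrix_(i, j) hat_entry M i j.

Lemma hat_linear : linear hat.
Proof.
by move=> a M N; apply/matrixP => -[[|[|[|[|//]]]] hi] [[|[|[|[|//]]]] hj]; rewrite !mxE /= ?mxE ?mulr0 ?addr0.
Qed.

Lemma ord4_val (i : 'I_4) : i = ord4 i.
Proof. by rewrite /ord4 inord_val. Qed.

Lemma sum4 (V : nmodType) (f : 'I_4 -> V) : \sum_i f i = f (ord4 0) + f (ord4 1) + f (ord4 2) + f (ord4 3).
Proof.
rewrite !big_ord_recl big_ord0 addr0 !addrA.
by congr (f _ + f _ + f _ + f _); apply: val_inj; rewrite /= inordK.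
Qed.

Lemma mx4P (A B : M4) :
  (forall i j : nat, (i < 4)%N -> (j < 4)%N -> A (ord4 i) (ord4 j) = B (ord4 i) (ord4 j)) -> A = B.
Proof. by move=> h; apply/matrixP => i j; rewrite (ord4_val i) (ord4_val j) h. Qed.

Lemma mul4E (A B : M4) i j : (A *m B) i j =
  A i (ord4 0) * B (ord4 0) j + A i (ord4 1) * B (ord4 1) j +
  A i (ord4 2) * B (ord4 2) j + A i (ord4 3) * B (ord4 3) j.
Proof. by rewrite mxE sum4. Qed.

Lemma add4E (A B : M4) i j : (A + B) i j = A i j + B i j.
Proof. by rewrite mxE. Qed.
Lemma opp4E (A : M4) i j : (- A) i j = - A i j.
Proof. by rewrite mxE. Qed.
Lemma scale4E a (A : M4) i j : (a *: A) i j = a * A i j.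
Proof. by rewrite mxE. Qed.
Lemma tr4E (A : M4) i j : A^T i j = A j i.
Proof. by rewrite mxE. Qed.

Lemma hatE (M : M4) i j : (i < 4)%N -> (j < 4)%N -> hat M (ord4 i) (ord4 j) = hat_entry M i j.
Proof. by move=> hi hj; rewrite mxE !inordK. Qed.

Lemma det4 (A : M4) (a := fun i j : nat => A (ord4 i) (ord4 j)) : \det A =
    a 0 0 * (a 1 1 * (a 2 2 * a 3 3 - a 2 3 * a 3 2) - a 1 2 * (a 2 1 * a 3 3 - a 2 3 * a 3 1) + a 1 3 * (a 2 1 * a 3 2 - a 2 2 * a 3 1))
  - a 0 1 * (a 1 0 * (a 2 2 * a 3 3 - a 2 3 * a 3 2) - a 1 2 * (a 2 0 * a 3 3 - a 2 3 * a 3 0) + a 1 3 * (a 2 0 * a 3 2 - a 2 2 * a 3 0))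
  + a 0 2 * (a 1 0 * (a 2 1 * a 3 3 - a 2 3 * a 3 1) - a 1 1 * (a 2 0 * a 3 3 - a 2 3 * a 3 0) + a 1 3 * (a 2 0 * a 3 1 - a 2 1 * a 3 0))
  - a 0 3 * (a 1 0 * (a 2 1 * a 3 2 - a 2 2 * a 3 1) - a 1 1 * (a 2 0 * a 3 2 - a 2 2 * a 3 0) + a 1 2 * (a 2 0 * a 3 1 - a 2 1 * a 3 0)).
Proof.
have aE i j : A i j = a i j by rewrite {1}(ord4_val i) {1}(ord4_val j).
rewrite (expand_det_row A ord0) !big_ord_recl big_ord0 /cofactor.
do 2![rewrite !(expand_det_row _ ord0) !big_ord_recl !big_ord0 /cofactor].
rewrite !det_mx11 !mxE !aE /= /bump /= !exprS !expr0; ring.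
Qed.

Lemma skew_diag (A : M4) i : A^T = - A -> A i i = 0.
Proof.
move=> /matrixP /(_ i i); rewrite !mxE => h.
by apply: (lin_solve (k := 2)); rewrite ?pnatr_eq0 // mulr_natl mulr2n {1}h addNr.
Qed.

Lemma mx4_skewP (A B : M4) : A^T = - A -> B^T = - B ->
  (forall i j : nat, (i < j < 4)%N -> A (ord4 i) (ord4 j) = B (ord4 i) (ord4 j)) -> A = B.
Proof.
move=> sA sB h; apply: mx4P => i j hi hj; case: (ltngtP i j) => [ij|ji|->].
- by rewrite h ?ij.
- have /matrixP /(_ (ord4 j) (ord4 i)) := sA; have /matrixP /(_ (ord4 j) (ord4 i)) := sB.
  by rewrite !mxE => -> ->; rewrite h ?ji.
- by rewrite !skew_diag.
Qed.

Lemma hat_skew (M : M4) : M^T = - M -> (hat M)^T = - hat M.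
Proof.
move=> skM; have sk i j : M (ord4 i) (ord4 j) = - M (ord4 j) (ord4 i).
  by have /matrixP /(_ (ord4 j) (ord4 i)) := skM; rewrite !mxE.
apply: mx4P => -[|[|[|[|//]]]] [|[|[|[|//]]]] _ _; rewrite !mxE !inordK //= ?oppr0 // -sk.
Qed.

Lemma skew_congr (M k : M4) : M^T = - M -> (k *m M *m k^T)^T = - (k *m M *m k^T).
Proof. by move=> e; rewrite !trmx_mul trmxK e mulNmx mulmxN mulmxA. Qed.

Section Skew.
Variable M : M4.
Hypothesis skM : M^T = - M.

Let diagM i : M i i = 0 := skew_diag i skM.
Let sk i j : M (ord4 i) (ord4 j) = - M (ord4 j) (ord4 i).
Proof. by have /matrixP /(_ (ord4 j) (ord4 i)) := skM; rewrite !mxE. Qed.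
Let sk10 := sk 1 0. Let sk20 := sk 2 0. Let sk30 := sk 3 0.
Let sk21 := sk 2 1. Let sk31 := sk 3 1. Let sk32 := sk 3 2.
Let skE := (sk10, sk20, sk30, sk21, sk31, sk32, diagM).


(** The infinitesimal form of [hat_congr], with k = 1 + t A^T to first order. *)
Lemma hat_derivation A :
  hat (A^T *m M + M *m A) = \tr A *: hat M - A *m hat M - hat M *m A^T.
Proof.
have trE : \tr A = A (ord4 0) (ord4 0) + A (ord4 1) (ord4 1) + A (ord4 2) (ord4 2) + A (ord4 3) (ord4 3).
  by rewrite /mxtrace sum4.
apply: mx4P => -[|[|[|[|//]]]] [|[|[|[|//]]]] hi hj.
all: rewrite hatE // /hat_entry !(add4E, opp4E, scale4E, mul4E, tr4E) !hatE // /hat_entry trE !skE; ring.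
Qed.

(** The dual is contraction with the volume form, so a change of basis multiplies it by the
    determinant. *)
Lemma hat_congr k :
  k^T *m hat (k *m M *m k^T) *m k = \det k *: hat M.
Proof.
apply: mx4_skewP => [||i j ij].
- by rewrite !trmx_mul trmxK hat_skew ?skew_congr // mulNmx mulmxN mulmxA.
- by rewrite linearZ /= hat_skew // scalerN.
rewrite scale4E det4; case/andP: ij => ij; case: j ij => [|[|[|[|//]]]]; case: i => [|[|[|//]]] // _ _.
all: rewrite !mul4E !tr4E !hatE // /hat_entry !mul4E !tr4E !skE; ring.
Qed.
End Skew.
End Hat.

HB.instance Definition _ (F : numFieldType) :=
  GRing.isLinear.Build F 'M[F]_4 'M[F]_4 _ (@hat F) (@hat_linear F).

Definition antidiag (F : nzRingType) : 'M[F]_4 := \matrix_(i, j) ((i + j).+1 == 4)%N%:R.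

(** * The Hodge star as an endomorphism of so(g) for n = 4 *)

Section Star.
Variables (F : numFieldType) (g : 'M[F]_4).
Hypotheses (gT : g^T = g) (gU : g \in unitmx).

(** The Hodge star up to scale: g A is the 2-form of A, [hat] its dual bivector, and the last g
    turns the bivector back into an endomorphism. *)
Definition star_fun (A : 'M[F]_4) : 'M[F]_4 := hat (g *m A) *m g.

Lemma star_linear : linear star_fun.
Proof.
by move=> a A B; rewrite /star_fun mulmxDr -scalemxAr hat_linear mulmxDl -scalemxAl.
Qed.

Definition star : 'End('M[F]_4) :=
  linfun (HB.pack star_fun (GRing.isLinear.Build _ _ _ _ star_fun star_linear)
    : {linear 'M[F]_4 -> 'M[F]_4}).

Lemma starE A : star A = hat (g *m A) *m g.
Proof. by rewrite lfunE. Qed.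

Lemma so_tr A : A \in so g -> A^T *m g = - (g *m A).
Proof. by move=> /mem_so /eqP; rewrite addr_eq0 => /eqP. Qed.

Lemma so_skew A : A \in so g -> (g *m A)^T = - (g *m A).
Proof. by move=> hA; rewrite trmx_mul gT so_tr. Qed.

Lemma so_trace A : A \in so g -> \tr A = 0.
Proof.
move=> hA; apply: (lin_solve (k := 2)); last by rewrite pnatr_eq0.
have : \tr A = - \tr A.
  rewrite -{1}mxtrace_tr -[A^T](mulmxK gU) so_tr // mulNmx raddfN /=.
  by rewrite mxtrace_mulC mulmxA mulVmx // mul1mx.
by rewrite mulr_natl mulr2n => {1}->; rewrite addNr.
Qed.

Lemma star_so A : A \in so g -> star A \in so g.
Proof.
move=> hA; apply/mem_so; rewrite starE trmx_mul gT hat_skew ?so_skew //.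
by rewrite mulmxN mulNmx mulmxA addNr.
Qed.

(** The derivation rule for [hat] loses its trace term because elements of so(g) are traceless. *)
Lemma star_ad A B : A \in so g -> B \in so g -> star (ad_fun A B) = ad_fun A (star B).
Proof.
move=> hA hB; rewrite !starE /ad_fun; set M := g *m B.
have sM : M^T = - M by apply: so_skew.
have gA : g *m A = - (A^T *m g) by rewrite so_tr // opprK.
have -> : g *m (A *m B - B *m A) = - (A^T *m M + M *m A).
  by rewrite mulmxBr !mulmxA gA mulNmx opprD.
rewrite linearN /= hat_derivation // so_trace // scale0r sub0r opprB opprK addrC mulmxDl.
rewrite mulmxA; congr (_ + _); rewrite -[hat M *m A^T *m g]mulmxA so_tr //.
by rewrite mulmxN mulmxA.
Qed.

Lemma twist_so a A : A \in so g -> (\1%VF + a *: star)%VF A \in so g.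
Proof.
by move=> hA; rewrite add_lfunE scale_lfunE id_lfunE rpredD ?rpredZ ?star_so.
Qed.

Lemma twist_ad a A B : A \in so g -> B \in so g ->
  (\1%VF + a *: star)%VF (ad_fun A B) = ad_fun A ((\1%VF + a *: star)%VF B).
Proof.
move=> hA hB; rewrite !(add_lfunE, scale_lfunE, id_lfunE) star_ad //.
by rewrite [RHS]linearD linearZ.
Qed.

Section Witt.
Variable P : 'M[F]_4.
Hypothesis hP : is_witt_basis g P.
Local Notation E i j := (root_elt g P (ord4 i) (ord4 j)).
Local Notation s := (\det P)^-1.

Local Notation J := (antidiag F).
Let JP : P^T *m g *m P = J := hP.
Let PU := witt_unit hP.
Let detP : \det P != 0. Proof. by have := PU; rewrite unitmxE unitfE. Qed.

Let JE i j : (i < 4)%N -> (j < 4)%N -> J (ord4 i) (ord4 j) = ((i + j)%N == 3%N)%:R.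
Proof. by move=> hi hj; rewrite mxE !inordK. Qed.

Lemma crd_star A : A \in so g -> crd P (star A) = s *: (hat (J *m crd P A) *m J).
Proof.
move=> hA; have sM := so_skew hA; have := hat_congr sM P^T; rewrite trmxK det_tr => E.
have -> : J *m crd P A = P^T *m (g *m A) *m P.
  by rewrite crd_def -JP !mulmxA mulmxK.
apply: (scalerI detP); rewrite scalerA mulfV // scale1r crd_def starE.
by rewrite !mulmxA scalemxAl scalemxAl scalemxAr -E -JP !mulmxA mulVmx // mul1mx.
Qed.

Lemma crd_inj A B : crd P A = crd P B -> A = B.
Proof. by move=> e; rewrite -(crdK hP A) e (crdK hP). Qed.

Lemma crdZ a A : crd P (a *: A) = a *: crd P A.
Proof. by rewrite !crd_def -scalemxAr -scalemxAl. Qed.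

Let crdE i j l k : (i < 4)%N -> (j < 4)%N -> (l < 4)%N -> (k < 4)%N ->
  crd P (E i j) (ord4 l) (ord4 k) =
  ((l == i) && (k == j))%N%:R - ((k + i == 3) && (l + j == 3))%N%:R.
Proof.
move=> hi hj hl hk; rewrite (crd_root_elt hP) -!val_eqE /= !inordK //.
by congr (_%:R - _%:R); congr nat_of_bool; congr (_ && _); lia.
Qed.

Let antidiag_mull (X : 'M[F]_4) k l : (k < 4)%N ->
  (J *m X) (ord4 k) (ord4 l) = X (ord4 (3 - k)) (ord4 l).
Proof. by case: k => [|[|[|[|//]]]] _; rewrite mul4E !JE //= ?mul0r ?mul1r ?add0r ?addr0. Qed.

Let antidiag_mulr (X : 'M[F]_4) k l : (l < 4)%N ->
  (X *m J) (ord4 k) (ord4 l) = X (ord4 k) (ord4 (3 - l)).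
Proof. by case: l => [|[|[|[|//]]]] _; rewrite mul4E !JE //= ?mulr0 ?mulr1 ?add0r ?addr0. Qed.

Lemma star_root i j i' j' (e : F) : (i < 4)%N -> (j < 4)%N -> (i' < 4)%N -> (j' < 4)%N ->
  (forall k l, (k < 4)%N -> (l < 4)%N ->
    (hat (J *m crd P (E i j)) *m J) (ord4 k) (ord4 l) = e * crd P (E i' j') (ord4 k) (ord4 l)) ->
  star (E i j) = (s * e) *: E i' j'.
Proof.
move=> hi hj hi' hj' h; apply: crd_inj; rewrite crdZ crd_star; last exact: root_elt_so.
by rewrite -scalerA; congr (_ *: _); apply: mx4P => k l hk hl; rewrite h // scale4E.
Qed.

(** The star has eigenvalue s on E01, E10, E00 - E11 and -s on E02, E20, E00 + E11, which are the
    two simple ideals of so(4). *)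
Lemma star_witt :
  [/\ star (E 0 1) = s *: E 0 1, star (E 1 0) = s *: E 1 0,
      star (E 0 2) = - s *: E 0 2, star (E 2 0) = - s *: E 2 0 &
      star (E 0 0) = - s *: E 1 1 /\ star (E 1 1) = - s *: E 0 0].
Proof.
split; [rewrite -[s in RHS]mulr1|rewrite -[s in RHS]mulr1|rewrite -[- s]mulrN1|rewrite -[- s]mulrN1|
  split; rewrite -[- s]mulrN1].
all: apply: star_root => // -[|[|[|[|//]]]] [|[|[|[|//]]]] hk hl.
all: rewrite antidiag_mulr // hatE // /hat_entry /= ?antidiag_mull //.
all: rewrite !crdE //=.
all: ring.
Qed.

End Witt.
End Star.

(** * The Casimir operator twisted by the star *)

Section StarCasimir.
Variables (F : numFieldType) (g P : 'M[F]_4).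
Hypothesis hP : is_witt_basis g P.
Variables (M : lie_rep (so g)) (v : M) (lam : 'I_4 -> F) (a : F).
Hypotheses (wv : is_weight P v lam) (sv : is_singular P v) (v0 : v != 0).
Local Notation rho := (rep_act M).
Local Notation E := (root_elt g P).
Local Notation s := (\det P)^-1.

Let gT := metric_sym hP.
Let gU := metric_unit hP.
Let starE_so A : A \in so g -> star g A \in so g := @star_so F g gT A.

Let f i j := rho (E i j) (rho (star g (E j i)) v).

Let f_rev i j : f (rev_ord j) (rev_ord i) = f i j.
Proof.
rewrite /f !root_elt_rev linearN /= !rep_actN ?starE_so ?root_elt_so //.
by rewrite !opp_lfunE linearN /= opprK.
Qed.

Let f_rev0 i : f i (rev_ord i) = 0.
Proof. by rewrite /f root_elt_rev0 rep_act0 lfunE. Qed.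

(** Of the sixteen terms the four with j = rev i vanish and the reversal symmetry [f_rev] pairs the
    others, leaving six to evaluate on a singular vector. *)
Lemma star_casimir_sum : \sum_i \sum_j f i j =
  (- 4 * s * (lam (ord4 1) * (lam (ord4 0) + 1))) *: v.
Proof.
have rev4 k : (k < 4)%N -> rev_ord (ord4 k) = ord4 (3 - k).
  by move=> hk; apply: val_inj; rewrite /= !inordK //; lia.
have r0 := rev4 0%N isT; have r1 := rev4 1%N isT; have r2 := rev4 2%N isT; have r3 := rev4 3%N isT.
have z0 := f_rev0 (ord4 0); have z1 := f_rev0 (ord4 1); have z2 := f_rev0 (ord4 2); have z3 := f_rev0 (ord4 3).
rewrite ?(r0, r1, r2, r3) in z0 z1 z2 z3.
have fr i j : (i < 4)%N -> (j < 4)%N -> f (ord4 (3 - j)) (ord4 (3 - i)) = f (ord4 i) (ord4 j).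
  by move=> hi hj; rewrite -!rev4 ?f_rev.
have e1 := fr 0%N 0%N isT isT; have e2 := fr 1%N 1%N isT isT; have e3 := fr 0%N 1%N isT isT.
have e4 := fr 1%N 0%N isT isT; have e5 := fr 0%N 2%N isT isT; have e6 := fr 2%N 0%N isT isT.
rewrite !subn0 ?subn1 ?subn2 /= in z0 z1 z2 z3 e1 e2 e3 e4 e5 e6.
have [h01 h10 h02 h20 [h00 h11]] := star_witt gT gU hP.
have so' i j : E i j \in so g by apply: root_elt_so.
have l01 : (ord4 0 < ord4 1)%N by rewrite !inordK.
have l02 : (ord4 0 < ord4 2)%N by rewrite !inordK.
have f00 : f (ord4 0) (ord4 0) = (- s * lam (ord4 1) * lam (ord4 0)) *: v.
  by rewrite /f h00 (rep_actZ M _ (so' _ _)) scale_lfunE wv linearZ /= linearZ /= wv !scalerA.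
have f11 : f (ord4 1) (ord4 1) = (- s * lam (ord4 1) * lam (ord4 0)) *: v.
  by rewrite /f h11 (rep_actZ M _ (so' _ _)) scale_lfunE wv linearZ /= linearZ /= wv !scalerA mulrAC.
have f01 : f (ord4 0) (ord4 1) = (s * (lam (ord4 0) - lam (ord4 1))) *: v.
  rewrite /f h10 (rep_actZ M _ (so' _ _)) scale_lfunE linearZ /=.
  by rewrite (singular_root_root hP wv sv (l01 : (ord4 0 < ord4 1)%N)) ?scalerA // r0 -val_eqE /= !inordK.
have f10 : f (ord4 1) (ord4 0) = 0.
  by rewrite /f h01 (rep_actZ M _ (so' _ _)) scale_lfunE (sv l01) scaler0 linear0.
have l2 : lam (ord4 2) = - lam (ord4 1) by rewrite -(is_weight_rev hP _ v0 wv) r1.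
have f02 : f (ord4 0) (ord4 2) = (- s * (lam (ord4 0) + lam (ord4 1))) *: v.
  rewrite /f h20 (rep_actZ M _ (so' _ _)) scale_lfunE linearZ /=.
  by rewrite (singular_root_root hP wv sv (l02 : (ord4 0 < ord4 2)%N)) ?l2 ?opprK ?scalerA // r0 -val_eqE /= !inordK.
have f20 : f (ord4 2) (ord4 0) = 0.
  by rewrite /f h02 (rep_actZ M _ (so' _ _)) scale_lfunE (sv l02) scaler0 linear0.
rewrite !sum4 z0 z1 z2 z3 e1 e2 e3 e4 e5 e6 f00 f11 f01 f10 f02 f20.
rewrite !add0r !addr0 -!scalerDl; congr (_ *: _); ring.
Qed.

Lemma casimir_star : casimir (\1%VF + a *: star g) M v =
  (\sum_i lam i ^+ 2 + \sum_i lam i * two_rho F i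
   + a * (- 4 * s * (lam (ord4 1) * (lam (ord4 0) + 1)))) *: v.
Proof.
rewrite (casimir_witt gT gU (@twist_so F g gT a) hP) scalerDl -(casimir_weight hP wv sv) -scalerA.
rewrite -star_casimir_sum scaler_sumr -big_split; apply: eq_bigr => i _.
rewrite /= scaler_sumr -big_split; apply: eq_bigr => j _ /=.
rewrite add_lfunE scale_lfunE id_lfunE rep_actD ?rpredZ ?starE_so ?root_elt_so //.
by rewrite rep_actZ ?starE_so ?root_elt_so // add_lfunE scale_lfunE linearD linearZ.
Qed.

End StarCasimir.

Definition kinds4 (i : 'I_6) : hw_kind :=
  nth HW10 [:: HW32 true; HW32 false; HW30; HW21 true; HW21 false; HW10] i.

(** * The case n = 4 *)

Section DimensionFour.
Variables (R : realType) (g : 'M[R]_4).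
Local Notation toC := (map_mx (real_complex R)).
Local Notation gC := (toC g).
Variable P : 'M[R[i]]_4.
Hypothesis hP : is_witt_basis gC P.

(** A Witt basis has Gram determinant 1, as does the real basis [Q]. So the squares of the two
    determinants agree and \det P is plus or minus the real \det Q. *)
Lemma det_witt_real (Q : 'M[R]_4) : \det (Q^T *m g *m Q) = 1 ->
  exists d : R, \det P = real_complex R d.
Proof.
move=> dQ.
have dP : \det P ^+ 2 * \det gC = 1.
  have : \det (P^T *m gC *m P) = \det (antidiag R[i]) by rewrite hP.
  rewrite !det_mulmx det_tr expr2 mulrAC [X in X * _]mulrC => ->.
  by rewrite det4 !mxE !inordK //=; ring.
have dQ' : real_complex R (\det Q) ^+ 2 * \det gC = 1.
  rewrite det_map_mx -rmorphXn -rmorphM -[1 in RHS](rmorph1 (real_complex R)).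
  by rewrite -dQ !det_mulmx det_tr expr2 mulrAC.
have g0 : \det gC != 0 by apply: contraTneq (oner_neq0 R[i]) => e; rewrite -dP e mulr0 eqxx.
have /eqP : \det P ^+ 2 = real_complex R (\det Q) ^+ 2 by apply: (mulIf g0); rewrite dP dQ'.
rewrite eqf_sqr => /orP[] /eqP ->; first by exists (\det Q).
by exists (- \det Q); rewrite rmorphN.
Qed.

Variable d : R.
Hypothesis dP : \det P = real_complex R d.
Let n3 : (3 <= 4)%N := isT.

(** The coefficient -(\det P / 2) cancels the scale of the star and contributes a term odd in the
    second coordinate, which separates mirror weights. In the order of [kinds4] the values are 22,
    54, 30, 12, 24 and 6. *)
Definition hw_value4 k : R :=
  2 * (hw_l1 k)%:R ^+ 2 + 4 * (hw_l1 k)%:R + 2 * (hw_l2 k)%:R ^+ 2 +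
  2 * ((if hw_flip k then - (hw_l2 k)%:R else (hw_l2 k)%:R) * ((hw_l1 k)%:R + 1)).

Lemma casimir_star_hw_vec k :
  casimir (\1%VF + (- (\det P / 2)) *: star gC) (nabla_rep gC) (hw_vec gC P n3 k) =
  real_complex R (hw_value4 k) *: hw_vec gC P n3 k.
Proof.
have v0 : hw_vec gC P n3 k != 0.
  by apply/eqP => e; have := slot_hw_vec hP n3 k; rewrite e /slot nab_sym0 eqxx.
have wt := hw_vec_weight hP n3 k.
have sg : is_singular P (hw_vec gC P n3 k) by apply: hw_vec_singular.
rewrite (casimir_star hP _ wt sg v0); congr (_ *: _).
have [o0 o1] : ord4 0 = ord_fst n3 /\ ord4 1 = ord_snd n3 by split; apply: val_inj; rewrite /= inordK.
set l2 : R[i] := if hw_flip k then - (hw_l2 k)%:R else (hw_l2 k)%:R.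
have mu0 := hw_mu_fst R[i] n3 k; have mu1 : _ = l2 := hw_mu_snd R[i] n3 k isT.
have muE l : hw_mu R[i] n3 k l = (hw_l1 k)%:R * eps R[i] l (ord_fst n3) + l2 * eps R[i] l (ord_snd n3).
  by rewrite /hw_mu /hw_snd /l2; case: ifP => _ //; rewrite eps_rev mulrN mulNr.
rewrite o0 o1 mu0 mu1 (funext muE).
have E := casimir_value n3 (hw_l1 k)%:R l2; cbv zeta in E; rewrite E /=.
have d0 : \det P != 0 by have := witt_unit hP; rewrite unitmxE unitfE.
have -> : real_complex R (hw_value4 k) = 2 * (hw_l1 k)%:R ^+ 2 + 4 * (hw_l1 k)%:R +
    2 * l2 ^+ 2 + 2 * (l2 * ((hw_l1 k)%:R + 1)).
  have -> : l2 = real_complex R (if hw_flip k then - (hw_l2 k)%:R else (hw_l2 k)%:R).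
    by rewrite /l2; case: ifP => _; rewrite ?rmorphN rmorph_nat.
  rewrite /hw_value4 !(rmorphD, rmorphM, rmorphXn, rmorph_nat, rmorph1) /=.
  by case: ifP => _; rewrite ?rmorphN /= rmorph_nat; ring.
by field.
Qed.

Lemma curvature_split4 : curvature_split g P kinds4.
Proof.
have gT : g^T = g := real_metric_sym hP; have gU : g \in unitmx := real_metric_unit hP.
have gTC := metric_sym hP; have gUC := metric_unit hP.
have star_toC A : star gC (toC A) = toC (star g A).
  rewrite !starE -map_mxM [RHS]map_mxM; congr (_ *m _).
  by apply: mx4P => -[|[|[|[|//]]]] [|[|[|[|//]]]] hi hj; rewrite [RHS]mxE !hatE //= !mxE ?rmorph0.
apply: (@casimir_decomposition R 4 g P hP n3 (\1%VF + (- (d / 2)) *: star g)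
  (\1%VF + (- (\det P / 2)) *: star gC) _ _ _ _ _ _ kinds4 (fun i => hw_value4 (kinds4 i))) => //.
- exact: (@twist_so R g gT).
- exact: (@twist_ad R g gT gU).
- exact: (@twist_so R[i] gC gTC).
- exact: (@twist_ad R[i] gC gTC gUC).
- move=> A hA; rewrite !(add_lfunE, scale_lfunE, id_lfunE) map_mxD map_mxZ star_toC dP.
  by rewrite !(rmorphN, fmorph_div, rmorph_nat).
- move=> u lam wu su sl.
  have s1 := sl (inord 0); have s2 := sl (inord 1); have s3 := sl (inord 2).
  have s4 := sl (inord 3); have s5 := sl (inord 4); have s6 := sl (inord 5).
  rewrite /kinds4 !inordK //= /hw_snd /= ?rev_ordK in s1 s2 s3 s4 s5 s6.
  exact: (singular_eq0 hP (nab_form_contravariant hP) wu su s2 s3 s5 s6 (fun _ => conj s1 s4)).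
- move=> i j ij; have [e|ne] := eqVneq (hw_l1 (kinds4 i)) (hw_l1 (kinds4 j)).
    exists (ord_snd n3); rewrite !hw_mu_snd //.
    case: i j ij e => -[|[|[|[|[|[|//]]]]]] hi [[|[|[|[|[|[|//]]]]]] hj] //= _ _;
    by rewrite ?mulr0n ?[0 == _]eq_sym ?oppr_eq0 ?[_ == - _]eq_sym ?eqNr pnatr_eq0.
  by exists (ord_fst n3); rewrite !hw_mu_fst eqr_nat.
- move=> i j e; apply: val_inj; move: e; rewrite /hw_value4.
  case: i j => -[|[|[|[|[|[|//]]]]]] hi [[|[|[|[|[|[|//]]]]]] hj] //= e;
  by exfalso; move: e; rewrite /hw_value4 /=; lra.
- by move=> i; apply: casimir_star_hw_vec.
Qed.

End DimensionFour.

Lemma det_signature_even (R : realType) (p q : nat) : (p, q) \in [:: (4, 0); (2, 2); (0, 4)]%N ->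
  \det (diag_mx (\row_(i < 4) if (i < p)%N then 1 else -1 : R)) = 1.
Proof.
move=> h; have {h} : p \in [:: 4; 2; 0]%N.
  by move: h; rewrite !inE => /or3P[] /eqP[-> _].
rewrite !inE det_diag !big_ord_recl big_ord0 => /or3P[] /eqP ->; rewrite !mxE /=; ring.
Qed.

(** * The weights for n = 3 and n = 4 in terms of fundamental weights *)

Section SmallWeights.

Lemma weight3_6 : hw_weight 3 (HW32 false) = fund_weight 3 1 *+ 6.
Proof. by apply/rowP => -[[|//] hi]; rewrite mulmxnE !mxE. Qed.

Lemma weight3_4 : hw_weight 3 (HW21 false) = fund_weight 3 1 *+ 4.
Proof. by apply/rowP => -[[|//] hi]; rewrite mulmxnE !mxE. Qed.

Let w4 (k : hw_kind) (a b : nat) :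
  (forall i : 'I_2, hw_weight 4 k 0 i = (fund_weight 4 1 0 i) *+ a + (fund_weight 4 2 0 i) *+ b) ->
  hw_weight 4 k = fund_weight 4 1 *+ a + fund_weight 4 2 *+ b.
Proof. by move=> h; apply/rowP => i; rewrite h [RHS]mxE !mulmxnE. Qed.

Lemma weight4_51 : hw_weight 4 (HW32 true) = fund_weight 4 1 *+ 5 + fund_weight 4 2.
Proof. by apply: (w4 (b := 1)) => -[[|[|//]] hi]; rewrite !mxE. Qed.

Lemma weight4_15 : hw_weight 4 (HW32 false) = fund_weight 4 1 + fund_weight 4 2 *+ 5.
Proof. by apply: (w4 (a := 1)) => -[[|[|//]] hi]; rewrite !mxE. Qed.

Lemma weight4_33 : hw_weight 4 HW30 = fund_weight 4 1 *+ 3 + fund_weight 4 2 *+ 3.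
Proof. by apply: w4 => -[[|[|//]] hi]; rewrite !mxE. Qed.

Lemma weight4_31 : hw_weight 4 (HW21 true) = fund_weight 4 1 *+ 3 + fund_weight 4 2.
Proof. by apply: (w4 (b := 1)) => -[[|[|//]] hi]; rewrite !mxE. Qed.

Lemma weight4_13 : hw_weight 4 (HW21 false) = fund_weight 4 1 + fund_weight 4 2 *+ 3.
Proof. by apply: (w4 (a := 1)) => -[[|[|//]] hi]; rewrite !mxE. Qed.

End SmallWeights.

(** * Assembly of the isomorphisms *)

Section SplitSegments.
Variables (R : realType) (n m : nat) (g : 'M[R]_n) (P : 'M[R[i]]_n) (K : 'I_m -> hw_kind).
Hypothesis hK : curvature_split g P K.

Lemma split_segments : exists S : nat -> nat -> {vspace nabla_rep g},
  [/\ forall i : 'I_m, exists2 V : lie_rep (so g),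
        is_real_irrep P (hw_weight n (K i)) V & rep_embeds V (S i i.+1),
      forall i : 'I_m, K i = HW10 -> rep_embeds (rep_std (so g)) (S i i.+1),
      forall (A B : lie_rep (so g)) a b c, (a <= b <= c)%N ->
        rep_embeds A (S a b) -> rep_embeds B (S b c) -> rep_embeds (rep_sum A B) (S a c) &
      S 0%N m = fullv].
Proof.
have [U [dU fU irU stU]] := hK; exists (seg U); split.
- by move=> i; rewrite seg1.
- by move=> i Ki; rewrite seg1; exact: stU.
- by move=> A B a b c; apply: rep_embeds_seg.
- by rewrite seg_full.
Qed.
End SplitSegments.

Theorem theorem1 (R : realType) (n p q : nat) (g : 'M[R]_n)
    (hg : has_signature p q g)
    (P : 'M[R[i]]_n) (hP : is_witt_basis (map_mx (real_complex R) g) P) :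
  (n = 3%N ->
     exists V1 V2 : lie_rep (so g),
       [/\ is_real_irrep P (fund_weight n 1 *+ 6) V1,
           is_real_irrep P (fund_weight n 1 *+ 4) V2,
           rep_irreducible (rep_std (so g)) &
           rep_iso (rep_nabla_curvature (so_lie_closed (g := g)))
             (rep_sum V1 (rep_sum V2 (rep_std (so g))))]) /\
  ((p, q) \in [:: (4, 0); (2, 2); (0, 4)]%N ->
     exists V1 V1' V2 V3 V3' : lie_rep (so g),
       [/\ is_real_irrep P (fund_weight n 1 *+ 5 + fund_weight n 2) V1 /\
           is_real_irrep P (fund_weight n 1 + fund_weight n 2 *+ 5) V1',
           is_real_irrep P (fund_weight n 1 *+ 3 + fund_weight n 2 *+ 3) V2,
           is_real_irrep P (fund_weight n 1 *+ 3 + fund_weight n 2) V3 /\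
           is_real_irrep P (fund_weight n 1 + fund_weight n 2 *+ 3) V3',
           rep_irreducible (rep_std (so g)) &
           rep_iso (rep_nabla_curvature (so_lie_closed (g := g)))
             (rep_sum (rep_sum V1 V1')
               (rep_sum V2 (rep_sum (rep_sum V3 V3') (rep_std (so g)))))]) /\
  ((5 <= n)%N ->
     exists V1 V2 V3 : lie_rep (so g),
       [/\ is_real_irrep P (fund_weight n 1 + pi2bar n *+ 2) V1,
           is_real_irrep P (fund_weight n 1 *+ 3) V2,
           is_real_irrep P (fund_weight n 1 + pi2bar n) V3,
           rep_irreducible (rep_std (so g)) &
           rep_iso (rep_nabla_curvature (so_lie_closed (g := g)))
             (rep_sum V1 (rep_sum V2 (rep_sum V3 (rep_std (so g)))))]).
Proof.
have irr : (3 <= n)%N -> rep_irreducible (rep_std (so g)).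
  by move=> n3; apply: rep_std_irreducible n3; [apply: real_metric_sym hP|apply: real_metric_unit hP].
have ik m k (h : (k < m)%N) : (Ordinal h : 'I_m) = k :> nat by [].
split; last split.
- move=> n3; subst n; have [S [ir st cat fu]] := split_segments (curvature_split3 hP isT erefl).
  have [V1 V1i e1] := ir (Ordinal (isT : 0 < 3)%N).
  have [V2 V2i e2] := ir (Ordinal (isT : 1 < 3)%N).
  have e3 := st (Ordinal (isT : 2 < 3)%N) erefl.
  exists V1, V2; split; [by rewrite -weight3_6|by rewrite -weight3_4|exact: irr|].
  apply: rep_embeds_iso; rewrite -[fullv]fu.
  (* The cut points follow the bracketing of the nested sum. *)
  by apply: (cat _ _ _ 1%N) => //; apply: (cat _ _ _ 2%N).
- move=> pq; have n4 : n = 4%N.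
    by rewrite -(proj1 hg); move: pq; rewrite !inE => /or3P[] /eqP[-> ->].
  subst n; have [_ [Q _ QgQ]] := hg.
  (* An even number of negative directions makes the Gram determinant of the real diagonalising
     basis 1, so \det P is real and the twisted Casimir operator is defined over the reals. *)
  have [d dP] := det_witt_real hP (etrans (congr1 determinant QgQ) (det_signature_even R pq)).
  have [S [ir st cat fu]] := split_segments (curvature_split4 hP dP).
  have [V1 V1i e1] := ir (Ordinal (isT : 0 < 6)%N).
  have [V1' V1'i e1'] := ir (Ordinal (isT : 1 < 6)%N).
  have [V2 V2i e2] := ir (Ordinal (isT : 2 < 6)%N).
  have [V3 V3i e3] := ir (Ordinal (isT : 3 < 6)%N).
  have [V3' V3'i e3'] := ir (Ordinal (isT : 4 < 6)%N).
  have es := st (Ordinal (isT : 5 < 6)%N) erefl.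
  exists V1, V1', V2, V3, V3'; split.
  + by split; [rewrite -weight4_51|rewrite -weight4_15].
  + by rewrite -weight4_33.
  + by split; [rewrite -weight4_31|rewrite -weight4_13].
  + exact: irr.
  apply: rep_embeds_iso; rewrite -[fullv]fu.
  apply: (cat _ _ _ 2%N) => //; first by apply: (cat _ _ _ 1%N).
  apply: (cat _ _ _ 3%N) => //; apply: (cat _ _ _ 5%N) => //.
  by apply: (cat _ _ _ 4%N).
- move=> n5; have n3 : (3 <= n)%N by apply: leq_trans n5.
  have [S [ir st cat fu]] := split_segments (curvature_split5 hP n3 n5).
  have [V1 V1i e1] := ir (Ordinal (isT : 0 < 4)%N).
  have [V2 V2i e2] := ir (Ordinal (isT : 1 < 4)%N).
  have [V3 V3i e3] := ir (Ordinal (isT : 2 < 4)%N).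
  have es := st (Ordinal (isT : 3 < 4)%N) erefl.
  exists V1, V2, V3; split.
  + by rewrite -hw_weight32.
  + by rewrite -hw_weight30.
  + by rewrite -hw_weight21.
  + exact: irr.
  apply: rep_embeds_iso; rewrite -[fullv]fu.
  by apply: (cat _ _ _ 1%N) => //; apply: (cat _ _ _ 2%N) => //; apply: (cat _ _ _ 3%N).
Qed.
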